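(* Let $\mathcal{L}^2=\mathcal{L}^2(L^2((0,\infty);\mathbb{C}))$ be the Hilbert--Schmidt operators on $L^2((0,\infty);\mathbb{C})$. For $t>0$ let $S_t$ be the shift operator on $L^2((0,\infty);\mathbb{C})$, and define $\sigma_t,\tilde\sigma_t:\mathcal{L}^2\to\mathcal{L}^2$ by $\sigma_t(K)=S_t^\dagger KS_t$ and $\tilde\sigma_t(K)=S_tKS_t^\dagger$. Suppose that $K,L\in\mathcal{L}^2$. Then (i) $(\sigma_t)_{t>0}$ is a strongly continuous contraction semigroup on $\mathcal{L}^2$; (ii) $\sigma_t(K)\to0$ in the strong operator topology as $t\to\infty$; (iii) the infinitesimal generator of $(\sigma_t)_{t>0}$ is the diagonal derivative $\partial_\Delta$; (iv) $(\tilde\sigma_t)_{t>0}$ is a strongly continuous contraction semigroup on $\mathcal{L}^2$; (v) $\tilde\sigma_t(KL)=\tilde\sigma_t(K)\tilde\sigma_t(L)$ and $\langle\tilde\sigma_t(K),L\rangle=\langle K,\sigma_t(L)\rangle$; (vi) if $K$ is a product of vector-valued Hankel operators, then the kernel $\partial_\Delta k_t(x,y)$ is of finite rank.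
   Context: $S_tf(x)=f(x-t)\mathbb{I}_{(0,\infty)}(x-t)$ for $x>0$, with adjoint $S_t^\dagger$, so $S_t^\dagger f(x)=f(x+t)$. $\mathcal{L}^2$ has inner product $\langle K,L\rangle=\mathrm{trace}(KL^\dagger)$. If $K\in\mathcal{L}^2$ has kernel $k(x,y)\in L^2((0,\infty)\times(0,\infty);\mathbb{C})$, then $\sigma_t(K)$ is the integral operator with kernel $k_t(x,y)=k(x+t,y+t)$. For a differentiable function of two variables, the diagonal derivative is $\partial_\Delta k(x,y)=\bigl(\frac{\partial}{\partial x}+\frac{\partial}{\partial y}\bigr)k(x,y)$, acting on operators in $\mathcal{L}^2$ through their kernels. A Hankel integral operator with (vector-valued) impulse response function $\phi$ is $\Gamma_\phi f(x)=\int_0^\infty\phi(x+t)f(t)\,dt$. A product of vector-valued Hankel operators is an operator $K=\Gamma_\phi^\top\Gamma_\psi$ with kernel $k(x,y)=\int_0^\infty\phi(x+z)^\top\psi(z+y)\,dz$ where $\phi,\psi:(0,\infty)\to\mathbb{C}^n$ for some $n$, and $v^\top$ is the transpose of a column vector $v$. *)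

(* Defs.v *)
From HB Require Import structures.
From mathcomp Require Import all_boot all_order all_algebra.
From mathcomp Require Import all_classical all_reals all_analysis.
From mathcomp Require Import complex.

Set Implicit Arguments.
Unset Strict Implicit.
Unset Printing Implicit Defensive.

Import Order.TTheory GRing.Theory Num.Theory.
Import numFieldNormedType.Exports.

Local Open Scope classical_set_scope.
Local Open Scope ring_scope.
Local Open Scope complex_scope.

(* The library's Lp spaces are real-valued, so complex-valued measurability,
   integration and L^2 are set up through real and imaginary parts.  Elements
   of L^2 are represented by functions, and all identities between them are
   identities almost everywhere. *)

Section ComplexL2.
Context d (T : measurableType d) (R : realType).
Variables (mu : {measure set T -> \bar R}) (D : set T).

Definition cmeasurable (f : T -> R[i]) : Prop :=
  measurable_fun D (fun x => complex.Re (f x)) /\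
  measurable_fun D (fun x => complex.Im (f x)).

Definition cintegrable (f : T -> R[i]) : Prop :=
  mu.-integrable D (fun x => (complex.Re (f x))%:E) /\
  mu.-integrable D (fun x => (complex.Im (f x))%:E).

Definition cintegral (f : T -> R[i]) : R[i] :=
  Rintegral mu D (fun x => complex.Re (f x)) +i*
  Rintegral mu D (fun x => complex.Im (f x)).

Definition isL2 (f : T -> R[i]) : Prop :=
  cmeasurable f /\
  (\int[mu]_(x in D) ((Normc.normc (f x)) ^+ 2)%:E < +oo)%E.

Definition aeeq (f g : T -> R[i]) : Prop :=
  {ae mu, forall x, D x -> f x = g x}.

End ComplexL2.

Section Operators.
Variable R : realType.

Notation leb := (@lebesgue_measure R).

Definition halfline : set R := [set x | 0 < x].
Definition quadrant : set (R * R) := [set p | 0 < p.1 /\ 0 < p.2].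
Definition leb2 := (leb \x leb)%E.

(* Pins the sigma-algebra to the carrier of [lebesgue_measure]. *)
Definition measurable1 (f : R -> R[i]) : Prop :=
  @cmeasurable _ (measurableTypeR R) R halfline f.
Definition measurable2 (k : R * R -> R[i]) : Prop :=
  @cmeasurable _ (measurableTypeR R * measurableTypeR R)%type R quadrant k.

Definition L2 (f : R -> R[i]) : Prop := isL2 leb halfline f.
Definition L2eq (f g : R -> R[i]) : Prop := aeeq leb halfline f g.

Definition inner (f g : R -> R[i]) : R[i] :=
  cintegral leb halfline (fun x => f x * (g x)^*).
Definition L2norm (f : R -> R[i]) : R := Num.sqrt (complex.Re (inner f f)).

(* Candidates for operators on L^2(0,oo); only their values on [L2] matter. *)
Definition op := (R -> R[i]) -> (R -> R[i]).

Definition opeq (A B : op) : Prop := forall f, L2 f -> L2eq (A f) (B f).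

(* Compatibility with almost everywhere equality follows from linearity
   together with the norm bound. *)
Definition bounded_op (A : op) : Prop :=
  [/\ forall f, L2 f -> L2 (A f),
      forall (a : R[i]) f g, L2 f -> L2 g ->
        L2eq (A (fun x => a * f x + g x)) (fun x => a * A f x + A g x)
    & exists M : R, forall f, L2 f -> L2norm (A f) <= M * L2norm f].

Definition op_comp (A B : op) : op := fun f => A (B f).
Definition op_add (A B : op) : op := fun f x => A f x + B f x.
Definition op_sub (A B : op) : op := fun f x => A f x - B f x.
Definition op_scale (a : R[i]) (A : op) : op := fun f x => a * A f x.

Definition is_adjoint (A B : op) : Prop :=
  bounded_op B /\
  forall f g, L2 f -> L2 g -> inner (A f) g = inner f (B g).

(* The adjoint is unique up to [opeq] and exists for every bounded operator. *)
Definition adj (A : op) : op :=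
  xget (fun _ _ => 0 : R[i]) [set B | is_adjoint A B].

(** Hilbert--Schmidt operators *)

Definition is_onb (e : nat -> R -> R[i]) : Prop :=
  [/\ forall n, L2 (e n),
      forall m n, inner (e m) (e n) = (m == n)%:R
    & forall f, L2 f -> (forall n, inner f (e n) = 0) ->
        L2eq f (fun=> 0)].

Definition onb : nat -> R -> R[i] :=
  xget (fun _ _ => 0 : R[i]) [set e | is_onb e].

Definition trace (A : op) : R[i] :=
  limn (fun n => \sum_(i < n) complex.Re (inner (A (onb i)) (onb i))) +i*
  limn (fun n => \sum_(i < n) complex.Im (inner (A (onb i)) (onb i))).

Definition HS (A : op) : Prop :=
  bounded_op A /\
  exists2 e, is_onb e &
    (\sum_(0 <= n <oo) ((L2norm (A (e n))) ^+ 2)%:E < +oo)%E.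

Definition HSinner (A B : op) : R[i] := trace (op_comp A (adj B)).
Definition HSnorm (A : op) : R := Num.sqrt (complex.Re (HSinner A A)).

(** Integral operators on L^2(0,oo) *)

Definition integral_op (k : R * R -> R[i]) (A : op) : Prop :=
  measurable2 k /\
  forall f, L2 f ->
    {ae leb, forall x, halfline x ->
      cintegrable leb halfline (fun y => k (x, y) * f y) /\
      A f x = cintegral leb halfline (fun y => k (x, y) * f y)}.

Definition L2kernel (A : op) (k : R * R -> R[i]) : Prop :=
  isL2 leb2 quadrant k /\ integral_op k A.

Definition shift_kernel (t : R) (k : R * R -> R[i]) : R * R -> R[i] :=
  fun p => k (p.1 + t, p.2 + t).

(** The shift semigroups *)

Definition shift (t : R) : op := fun f x => if 0 < x - t then f (x - t) else 0.

Definition sigma (t : R) (A : op) : op :=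
  op_comp (adj (shift t)) (op_comp A (shift t)).
Definition sigma_tilde (t : R) (A : op) : op :=
  op_comp (shift t) (op_comp A (adj (shift t))).

Definition C0_contraction_semigroup (U : R -> op -> op) : Prop :=
  [/\ forall t A, 0 < t -> HS A -> HS (U t A),
      forall t (a : R[i]) A B, 0 < t -> HS A -> HS B ->
        opeq (U t (op_add (op_scale a A) B))
             (op_add (op_scale a (U t A)) (U t B)),
      forall s t A, 0 < s -> 0 < t -> HS A ->
        opeq (U (s + t) A) (U s (U t A)),
      forall t A, 0 < t -> HS A -> HSnorm (U t A) <= HSnorm A
    & forall A, HS A ->
        HSnorm (op_sub (U t A) A) @[t --> 0^'+] --> (0 : R)].

(* [generator U A B]: A is in the domain of the infinitesimal generator of U,
   which maps A to B. *)
Definition generator (U : R -> op -> op) (A B : op) : Prop :=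
  [/\ HS A, HS B
    & HSnorm (op_sub (op_scale (t^-1)%:C (op_sub (U t A) A)) B)
        @[t --> 0^'+] --> (0 : R)].

(** The diagonal derivative *)

Definition rdiag_deriv (u : R * R -> R) (p : R * R) : R :=
  'D_((1, 0) : R * R) u p + 'D_((0, 1) : R * R) u p.

Definition diag_deriv (k : R * R -> R[i]) (p : R * R) : R[i] :=
  rdiag_deriv (fun q => complex.Re (k q)) p +i*
  rdiag_deriv (fun q => complex.Im (k q)) p.

Definition differentiable_kernel (k : R * R -> R[i]) : Prop :=
  forall p, quadrant p ->
    differentiable (fun q => complex.Re (k q)) p /\
    differentiable (fun q => complex.Im (k q)) p.

(* C^1 functions with compact support in the open quadrant. *)
Definition test_function (u : R * R -> R) : Prop :=
  [/\ forall p, differentiable u p,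
      continuous (fun p => 'D_((1, 0) : R * R) u p),
      continuous (fun p => 'D_((0, 1) : R * R) u p)
    & exists a b : R, 0 < a /\
        forall p, u p != 0 -> a <= p.1 <= b /\ a <= p.2 <= b].

Definition weak_diag_deriv (k g : R * R -> R[i]) : Prop :=
  [/\ measurable2 k, measurable2 g
    & forall u, test_function u ->
      [/\ cintegrable leb2 quadrant (fun p => k p * (rdiag_deriv u p)%:C),
          cintegrable leb2 quadrant (fun p => g p * (u p)%:C)
        & cintegral leb2 quadrant (fun p => k p * (rdiag_deriv u p)%:C) =
          - cintegral leb2 quadrant (fun p => g p * (u p)%:C)]].

(* The diagonal derivative as an unbounded operator on the Hilbert--Schmidt
   operators, on its maximal domain: kernels k in L^2 whose derivative in the
   sense of distributions is again in L^2. *)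
Definition diag_deriv_op (A B : op) : Prop :=
  [/\ HS A, HS B
    & exists k g, [/\ L2kernel A k, L2kernel B g & weak_diag_deriv k g]].

(** Products of vector-valued Hankel operators *)

Definition hankel_op (phi : R -> R[i]) (A : op) : Prop :=
  bounded_op A /\ integral_op (fun p => phi (p.1 + p.2)) A.

(* Gamma_phi : L^2(0,oo) -> L^2((0,oo); C^n), given by its n components. *)
Definition vhankel_op n (phi : R -> 'cV[R[i]]_n) (A : 'I_n -> op) : Prop :=
  forall j, measurable1 (fun x => phi x j 0) /\
            hankel_op (fun x => phi x j 0) (A j).

Definition hankel_integrand n (phi psi : R -> 'cV[R[i]]_n) (p : R * R) (z : R)
    : R[i] :=
  ((phi (p.1 + z))^T *m psi (z + p.2)) 0 0.

Definition hankel_product_kernel n (phi psi : R -> 'cV[R[i]]_n) (p : R * R)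
    : R[i] :=
  cintegral leb halfline (hankel_integrand phi psi p).

Definition hankel_product (K : op) : Prop :=
  exists n (phi psi : R -> 'cV[R[i]]_n) (A B : 'I_n -> op),
    [/\ vhankel_op phi A, vhankel_op psi B,
        opeq K (fun f x => \sum_(j < n) A j (B j f) x),
        {ae leb2, forall p, quadrant p ->
          cintegrable leb halfline (hankel_integrand phi psi p)}
      & L2kernel K (hankel_product_kernel phi psi)].

Definition finite_rank_kernel (g : R * R -> R[i]) : Prop :=
  exists N (a b : 'I_N -> R -> R[i]),
    (forall j, measurable1 (a j) /\ measurable1 (b j)) /\
    aeeq leb2 quadrant g (fun p => \sum_(j < N) a j p.1 * b j p.2).

Definition finite_rank_op (A : op) : Prop :=
  bounded_op A /\
  exists N (u : 'I_N -> R -> R[i]), (forall j, L2 (u j)) /\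
    forall f, L2 f -> exists c : 'I_N -> R[i],
      L2eq (A f) (fun x => \sum_(j < N) c j * u j x).

End Operators.

(* Main.v *)
(** Through an orthonormal basis [e], a Hilbert-Schmidt operator [A] is the
    integral operator whose kernel is the L^2 sum of the tensors of [A e_n] with
    the conjugate of [e_n], and the Hilbert-Schmidt inner product is the L^2
    inner product of kernels.  In terms of kernels, [sigma t] is translation
    along the diagonal followed by restriction to the quadrant, [sigma_tilde t]
    is its adjoint, and the semigroup properties reduce to the continuity of
    translations in L^2 and dominated convergence.

    If [k] is in the domain of the generator with image [l], then differentiating
    [t |-> <k_t, u>] at 0 for a test function [u] shows that [l] is the weak
    diagonal derivative of [k].  Conversely, if [l] is the weak derivative of [k],
    the mean value theorem for [s |-> Re <k_s, U>] gives
      [2 Re <(k_t - k) / t - l, U> = 2 Re <l_c - l, U> <= |l_c - l|^2 + |U|^2]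
    for some [0 < c < t]; since test functions are dense,
    [|(k_t - k) / t - l|^2] is at most the supremum of [|l_c - l|^2].

    For a differentiable kernel [k] and a test function [u], the restriction of
    [k u] to almost every diagonal is everywhere differentiable with integrable
    derivative and compact support, so that the derivative has integral 0: an
    everywhere differentiable function with integrable derivative is the integral
    of its derivative.

    On almost every diagonal, the kernel of a Hankel product is the tail integral
    of [phi(x)^T psi(y)], so its weak diagonal derivative is minus that function.
    The corresponding operator maps compactly supported C^1 functions into the
    span of the components of [phi(x + t)]; the square-integrable elements of
    that span form a finite-dimensional, hence closed, subspace, which by
    boundedness contains the whole range. *)

Require Import Defs.
From HB Require Import structures.
From mathcomp Require Import all_boot all_order all_algebra.
From mathcomp Require Import all_classical all_reals all_analysis.
From mathcomp Require Import complex.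
From mathcomp Require Import measurable_realfun ring lra.

Set Implicit Arguments.
Unset Strict Implicit.
Unset Printing Implicit Defensive.
Import Order.TTheory GRing.Theory Num.Theory.
Import numFieldNormedType.Exports.
Local Open Scope classical_set_scope.
Local Open Scope ring_scope.
Local Open Scope complex_scope.

Local Notation "x ^*" := (conjc x) : ring_scope.

Local Notation ReC := complex.Re.
Local Notation ImC := complex.Im.

(** * Square-integrable complex functions *)

(** Elements of L^2 are functions, [adj] is a choice among almost everywhere equal adjoints, and
    [trace] uses a chosen basis [onb]. Kernels are the concrete handle on operators, so most claims
    are moved to identities or limits of kernels, known up to a null set. No orthonormal basis is
    constructed: one is extracted from the assumption that [K] is Hilbert-Schmidt and passed around
    as a hypothesis. Estimates are kept on squared norms, with [|f + g|^2 <= 2 |f|^2 + 2 |g|^2] for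
    the triangle inequality; hence tolerances such as [e / 4] and [e / 16]. The mean value theorem
    on scalar pairings stands in for the identity [k_t - k = int_0^t l_s ds], so that nothing is
    integrated with values in a Hilbert space; the supremum of [|l_c - l|^2] vanishes in the limit
    by strong continuity. The pointwise derivative of a kernel need be neither continuous nor
    locally bounded, which is why the fundamental theorem is proved for derivatives that are merely
    integrable. For Hankel products only local integrability of [phi] and [psi] is available, so
    integrals are exchanged instead of differentiated. *)

Section ComplexArith.
Variable R : realType.
Implicit Types a b : R[i].

Lemma ReM a b : ReC (a * b) = ReC a * ReC b - ImC a * ImC b.
Proof. by case: a; case: b. Qed.
Lemma ImM a b : ImC (a * b) = ReC a * ImC b + ImC a * ReC b.
Proof. by case: a; case: b. Qed.
Lemma ReD a b : ReC (a + b) = ReC a + ReC b.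
Proof. by case: a; case: b. Qed.
Lemma ImD a b : ImC (a + b) = ImC a + ImC b.
Proof. by case: a; case: b. Qed.
Lemma ReN a : ReC (- a) = - ReC a. Proof. by case: a. Qed.
Lemma ImN a : ImC (- a) = - ImC a. Proof. by case: a. Qed.
Lemma ReJ a : ReC a^* = ReC a. Proof. by case: a. Qed.
Lemma ImJ a : ImC a^* = - ImC a. Proof. by case: a. Qed.
Definition CE := (ReM, ImM, ReD, ImD, ReN, ImN, ReJ, ImJ).

Lemma Cext a b : ReC a = ReC b -> ImC a = ImC b -> a = b.
Proof. by case: a => ? ?; case: b => ? ? /= -> ->. Qed.

Lemma normc2E a : Normc.normc a ^+ 2 = ReC a ^+ 2 + ImC a ^+ 2.
Proof. by case: a => x y /=; rewrite sqr_sqrtr// addr_ge0// sqr_ge0. Qed.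

Lemma normc_ge0 a : 0 <= Normc.normc a.
Proof. by case: a => x y /=; exact: sqrtr_ge0. Qed.

Lemma normc_0 : Normc.normc (0 : R[i]) = 0.
Proof. exact: Normc.normc0. Qed.

Lemma Re_le_normc a : `|ReC a| <= Normc.normc a.
Proof. by rewrite -(@ler_pXn2r _ 2)// ?nnegrE ?normc_ge0// normc2E real_normK ?num_real// lerDl sqr_ge0. Qed.

Lemma Im_le_normc a : `|ImC a| <= Normc.normc a.
Proof. by rewrite -(@ler_pXn2r _ 2)// ?nnegrE ?normc_ge0// normc2E real_normK ?num_real// lerDr sqr_ge0. Qed.

Lemma normc_le_ReIm a : Normc.normc a <= `|ReC a| + `|ImC a|.
Proof.
rewrite -(@ler_pXn2r _ 2)// ?nnegrE ?normc_ge0 ?addr_ge0// normc2E sqrrD !real_normK ?num_real//.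
by rewrite -addrA lerD2l lerDr mulrn_wge0// mulr_ge0.
Qed.

(** Parallelogram identity: the right side minus the left is [|a - b|^2]. *)
Lemma normcD2 a b :
  Normc.normc (a + b) ^+ 2 <= 2 * Normc.normc a ^+ 2 + 2 * Normc.normc b ^+ 2.
Proof.
rewrite -subr_ge0 (_ : _ - _ = Normc.normc (a - b) ^+ 2) ?sqr_ge0//.
by rewrite !normc2E !CE; ring.
Qed.

Lemma normcJ2 a : Normc.normc a^* ^+ 2 = Normc.normc a ^+ 2.
Proof. by rewrite !normc2E !CE sqrrN. Qed.

Lemma mulJ_Re a : ReC (a * a^*) = Normc.normc a ^+ 2.
Proof. by rewrite normc2E !CE; ring. Qed.
Lemma mulJ_Im a : ImC (a * a^*) = 0.
Proof. by rewrite !CE; ring. Qed.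
Lemma mulJE a : a * a^* = (Normc.normc a ^+ 2)%:C.
Proof. by apply: Cext; rewrite ?mulJ_Re ?mulJ_Im. Qed.

End ComplexArith.

Section General.
Context d (T : measurableType d) (R : realType).
Variables (mu : {measure set T -> \bar R}) (D : set T).
Hypothesis mD : measurable D.
Implicit Types f g h : T -> R[i].
Notation cm := (@cmeasurable _ T R D).
Notation ci := (cintegrable mu D).
Notation cI := (cintegral mu D).
Notation L2 := (isL2 mu D).

Lemma cm_ext f g : (forall x, D x -> f x = g x) -> cm f -> cm g.
Proof.
move=> fg [f1 f2]; split.
  by apply: eq_measurable_fun f1 => x /set_mem Dx; rewrite fg.
by apply: eq_measurable_fun f2 => x /set_mem Dx; rewrite fg.
Qed.

Lemma cm_cst a : cm (fun=> a).
Proof. by split; exact: measurable_cst. Qed.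

Lemma cmD f g : cm f -> cm g -> cm (fun x => f x + g x).
Proof.
move=> [f1 f2] [g1 g2]; split.
  by under eq_fun do rewrite ReD; exact: measurable_funD.
by under eq_fun do rewrite ImD; exact: measurable_funD.
Qed.

Lemma cmN f : cm f -> cm (fun x => - f x).
Proof.
move=> [f1 f2]; split.
  by under eq_fun do rewrite ReN; exact: measurableT_comp.
by under eq_fun do rewrite ImN; exact: measurableT_comp.
Qed.

Lemma cmB f g : cm f -> cm g -> cm (fun x => f x - g x).
Proof. by move=> mf mg; apply: cmD mf (cmN mg). Qed.

Lemma cmM f g : cm f -> cm g -> cm (fun x => f x * g x).
Proof.
move=> [f1 f2] [g1 g2]; split.
  by under eq_fun do rewrite ReM; apply: measurable_funB; exact: measurable_funM.
by under eq_fun do rewrite ImM; apply: measurable_funD; exact: measurable_funM.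
Qed.

Lemma cmJ f : cm f -> cm (fun x => (f x)^*).
Proof.
move=> [f1 f2]; split; first by under eq_fun do rewrite ReJ.
by under eq_fun do rewrite ImJ; exact: measurableT_comp.
Qed.

Lemma cmZ a f : cm f -> cm (fun x => a * f x).
Proof. exact/cmM/cm_cst. Qed.

Lemma cm_real (u : T -> R) : measurable_fun D u -> cm (fun x => (u x)%:C).
Proof. by move=> mu'; split => //=; exact: measurable_cst. Qed.

Lemma cm_normc f : cm f -> measurable_fun D (fun x => Normc.normc (f x) ^+ 2).
Proof.
move=> [f1 f2]; under eq_fun do rewrite normc2E.
by apply: measurable_funD; exact: measurable_funX.
Qed.

Lemma intle (f g : T -> R) : measurable_fun D f ->
  (forall x, D x -> `|f x| <= g x) -> mu.-integrable D (EFin \o g) ->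
  mu.-integrable D (EFin \o f).
Proof.
move=> mf fg; apply: le_integrable => //; first exact/measurable_EFinP.
by move=> x Dx /=; rewrite lee_fin (le_trans (fg x Dx))// ler_norm.
Qed.

Lemma intD (f g : T -> R) : mu.-integrable D (EFin \o f) ->
  mu.-integrable D (EFin \o g) ->
  mu.-integrable D (EFin \o (fun x => f x + g x)).
Proof.
by move=> fi gi; apply: eq_integrable (integrableD mD fi gi).
Qed.

Lemma intZ a (f : T -> R) : mu.-integrable D (EFin \o f) ->
  mu.-integrable D (EFin \o (fun x => a * f x)).
Proof.
by move=> fi; apply: eq_integrable (integrableZl mD a fi).
Qed.

Lemma intN (f : T -> R) : mu.-integrable D (EFin \o f) ->
  mu.-integrable D (EFin \o (fun x => - f x)).
Proof.
by move=> fi; apply: eq_integrable (integrableN fi).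
Qed.

Lemma ci_cm f : ci f -> cm f.
Proof. by move=> [/measurable_int/measurable_EFinP ? /measurable_int/measurable_EFinP]. Qed.

Lemma ci_ext f g : (forall x, D x -> f x = g x) -> ci f -> ci g.
Proof.
move=> fg [f1 f2]; split.
  by apply: eq_integrable f1 => // x /set_mem Dx; rewrite /= fg.
by apply: eq_integrable f2 => // x /set_mem Dx; rewrite /= fg.
Qed.

Lemma ci0 : ci (fun=> 0).
Proof. by split; exact: integrable0. Qed.

Lemma ciD f g : ci f -> ci g -> ci (fun x => f x + g x).
Proof.
move=> [f1 f2] [g1 g2]; split.
  by apply: eq_integrable (intD f1 g1) => // x _ /=; rewrite ReD.
by apply: eq_integrable (intD f2 g2) => // x _ /=; rewrite ImD.
Qed.

Lemma ciZ a f : ci f -> ci (fun x => a * f x).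
Proof.
move=> [f1 f2]; split.
  apply: eq_integrable (intD (intZ (ReC a) f1) (intN (intZ (ImC a) f2))) => //.
  by move=> x _ /=; rewrite ReM.
apply: eq_integrable (intD (intZ (ReC a) f2) (intZ (ImC a) f1)) => //.
by move=> x _ /=; rewrite ImM.
Qed.

Lemma ciN f : ci f -> ci (fun x => - f x).
Proof. by move=> /(ciZ (-1)); apply: ci_ext => x _; rewrite mulN1r. Qed.

Lemma ciJ f : ci f -> ci (fun x => (f x)^*).
Proof.
move=> [f1 f2]; split.
  by apply: eq_integrable f1 => // x _ /=; rewrite ReJ.
by apply: eq_integrable (intN f2) => // x _ /=; rewrite ImJ.
Qed.

Lemma ci_sum n (F : nat -> T -> R[i]) : (forall i, ci (F i)) ->
  ci (fun x => \sum_(i < n) F i x).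
Proof.
move=> mF; elim: n => [|n IH].
  by apply: ci_ext ci0 => x _; rewrite big_ord0.
by apply: ci_ext (ciD IH (mF n)) => x _; rewrite big_ord_recr.
Qed.

Lemma ci_le f (g : T -> R) : cm f -> (forall x, D x -> Normc.normc (f x) <= g x) ->
  mu.-integrable D (EFin \o g) -> ci f.
Proof.
move=> [mf1 mf2] fg gi; split; apply: intle gi => // x Dx.
  exact: le_trans (Re_le_normc _) (fg x Dx).
exact: le_trans (Im_le_normc _) (fg x Dx).
Qed.

Lemma ci_normc f : ci f -> mu.-integrable D (EFin \o (fun x => Normc.normc (f x))).
Proof.
move=> fi; have [mf1 mf2] := ci_cm fi; case: fi => f1 f2.
apply: (intle _ _ (intD (integrable_norm f1) (integrable_norm f2))).
  have := measurableT_comp (continuous_measurable_fun (@sqrt_continuous R)) (cm_normc (conj mf1 mf2)).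
  by apply: eq_measurable_fun => x _ /=; rewrite sqrtr_sqr ger0_norm// normc_ge0.
by move=> x Dx /=; rewrite ger0_norm ?normc_ge0// normc_le_ReIm.
Qed.

Lemma cI_ext f g : (forall x, D x -> f x = g x) -> cI f = cI g.
Proof.
by move=> fg; congr (_ +i* _); apply: eq_Rintegral => x /set_mem Dx; rewrite fg.
Qed.

Lemma cI0 : cI (fun=> 0) = 0.
Proof. by rewrite /cintegral /Rintegral !integral0_eq. Qed.

Lemma cI_ae f g : cm f -> cm g -> aeeq mu D f g -> cI f = cI g.
Proof.
move=> [f1 f2] [g1 g2] fg; congr (_ +i* _); congr fine;
  apply: ae_eq_integral => //; try exact/measurable_EFinP.
  by apply: filterS fg => x fg Dx; rewrite fg.
by apply: filterS fg => x fg Dx; rewrite fg.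
Qed.

Lemma cID f g : ci f -> ci g -> cI (fun x => f x + g x) = cI f + cI g.
Proof.
move=> [f1 f2] [g1 g2]; apply: Cext; rewrite !CE /= -RintegralD//;
by apply: eq_Rintegral => x _; rewrite CE.
Qed.

Lemma cIZ a f : ci f -> cI (fun x => a * f x) = a * cI f.
Proof.
move=> [f1 f2]; apply: Cext; rewrite !CE /= -!RintegralZl//.
  rewrite -RintegralB//; [|exact: intZ..].
  by apply: eq_Rintegral => x _; rewrite CE.
rewrite -RintegralD//; [|exact: intZ..].
by apply: eq_Rintegral => x _; rewrite CE.
Qed.

Lemma cIN f : ci f -> cI (fun x => - f x) = - cI f.
Proof.
by move=> fi; rewrite -mulN1r -cIZ//; apply: cI_ext => x _; rewrite mulN1r.
Qed.

Lemma cIJ f : ci f -> cI (fun x => (f x)^*) = (cI f)^*.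
Proof.
move=> [f1 f2]; apply: Cext; rewrite !CE /=.
  by apply: eq_Rintegral => x _; rewrite CE.
rewrite -mulN1r -RintegralZl//.
by apply: eq_Rintegral => x _; rewrite CE mulN1r.
Qed.

Lemma cI_sum n (F : nat -> T -> R[i]) : (forall i, ci (F i)) ->
  cI (fun x => \sum_(i < n) F i x) = \sum_(i < n) cI (F i).
Proof.
move=> mF; elim: n => [|n IH].
  by rewrite big_ord0 -[RHS]cI0; apply: cI_ext => x _; rewrite big_ord0.
rewrite big_ord_recr/= -IH -cID//; last exact: ci_sum.
by apply: cI_ext => x _; rewrite big_ord_recr.
Qed.

Lemma L2_cm f : L2 f -> cm f. Proof. by case. Qed.

Lemma L2_int f : L2 f -> mu.-integrable D (EFin \o (fun x => Normc.normc (f x) ^+ 2)).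
Proof.
move=> [mf fi]; apply/integrableP; split.
  exact/measurable_EFinP/cm_normc.
apply: le_lt_trans fi; rewrite le_eqVlt; apply/orP; left; apply/eqP.
by apply: eq_integral => x _ /=; rewrite ger0_norm// sqr_ge0.
Qed.

Lemma int_L2 f : cm f -> mu.-integrable D (EFin \o (fun x => Normc.normc (f x) ^+ 2)) -> L2 f.
Proof.
move=> mf /integrableP[_ fi]; split=> //.
apply: le_lt_trans fi; rewrite le_eqVlt; apply/orP; left; apply/eqP.
by apply: eq_integral => x _ /=; rewrite ger0_norm// sqr_ge0.
Qed.

Lemma L2_le f (g : T -> R) : cm f -> (forall x, D x -> Normc.normc (f x) ^+ 2 <= g x) ->
  mu.-integrable D (EFin \o g) -> L2 f.
Proof.
move=> mf fg gi; apply: int_L2 => //; apply: intle gi; first exact: cm_normc.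
by move=> x Dx; rewrite ger0_norm ?sqr_ge0// fg.
Qed.

Lemma L2_ext f g : (forall x, D x -> f x = g x) -> L2 f -> L2 g.
Proof.
move=> fg f2; apply: L2_le (L2_int f2); first exact: cm_ext (L2_cm f2).
by move=> x Dx; rewrite fg.
Qed.

Lemma L2_0 : L2 (fun=> 0).
Proof.
apply: int_L2; first exact: cm_cst.
by apply: eq_integrable (integrable0 mu D) => // x _; rewrite /comp normc_0 expr0n.
Qed.

Lemma L2D f g : L2 f -> L2 g -> L2 (fun x => f x + g x).
Proof.
move=> f2 g2; apply: (L2_le _ _ (intD (intZ 2 (L2_int f2)) (intZ 2 (L2_int g2)))).
  exact: cmD (L2_cm f2) (L2_cm g2).
by move=> x Dx; exact: normcD2.
Qed.

Lemma L2Z a f : L2 f -> L2 (fun x => a * f x).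
Proof.
move=> f2; apply: (L2_le _ _ (intZ (Normc.normc a ^+ 2) (L2_int f2))).
  exact: cmZ (L2_cm f2).
by move=> x Dx; rewrite Normc.normcM exprMn.
Qed.

Lemma L2N f : L2 f -> L2 (fun x => - f x).
Proof. by move=> /(L2Z (-1)); apply: L2_ext => x _; rewrite mulN1r. Qed.

Lemma L2B f g : L2 f -> L2 g -> L2 (fun x => f x - g x).
Proof. by move=> fi /L2N; exact: L2D. Qed.

Lemma L2J f : L2 f -> L2 (fun x => (f x)^*).
Proof.
move=> f2; apply: (L2_le _ _ (L2_int f2)); first exact: cmJ (L2_cm f2).
by move=> x Dx; rewrite normcJ2.
Qed.

Lemma L2_sum n (F : nat -> T -> R[i]) : (forall i, L2 (F i)) ->
  L2 (fun x => \sum_(i < n) F i x).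
Proof.
move=> mF; elim: n => [|n IH].
  by apply: L2_ext L2_0 => x _; rewrite big_ord0.
by apply: L2_ext (L2D IH (mF n)) => x _; rewrite big_ord_recr.
Qed.

Lemma L2M_ci f g : L2 f -> L2 g -> ci (fun x => f x * g x).
Proof.
move=> f2 g2; apply: (ci_le _ _ (intD (L2_int f2) (L2_int g2))).
  exact: cmM (L2_cm f2) (L2_cm g2).
move=> x Dx; rewrite Normc.normcM.
have := normc_ge0 (f x); have := normc_ge0 (g x); nra.
Qed.

Lemma L2MJ_ci f g : L2 f -> L2 g -> ci (fun x => f x * (g x)^*).
Proof. by move=> f2 /L2J; exact: L2M_ci. Qed.

(* [nq] is the square of the L^2 norm. *)
Definition ip f g := cI (fun x => f x * (g x)^*).
Definition nq f := ReC (ip f f).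

Lemma ipE f g : ip f g = cI (fun x => f x * (g x)^*). Proof. by []. Qed.

Lemma nq_ip f : nq f = ReC (ip f f). Proof. by []. Qed.

Lemma ipDl f g h : L2 f -> L2 g -> L2 h ->
  ip (fun x => f x + g x) h = ip f h + ip g h.
Proof.
move=> f2 g2 h2; rewrite /ip -cID; [|exact: L2MJ_ci..].
by apply: cI_ext => x _; rewrite mulrDl.
Qed.

Lemma ipZl a f h : L2 f -> L2 h -> ip (fun x => a * f x) h = a * ip f h.
Proof.
move=> f2 h2; rewrite /ip -cIZ; last exact: L2MJ_ci.
by apply: cI_ext => x _; rewrite mulrA.
Qed.

Lemma ipJ f g : L2 f -> L2 g -> ip g f = (ip f g)^*.
Proof.
move=> f2 g2; rewrite /ip -cIJ; last exact: L2MJ_ci.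
by apply: cI_ext => x _; rewrite rmorphM/= conjcK mulrC.
Qed.

Lemma ipDr f g h : L2 f -> L2 g -> L2 h ->
  ip h (fun x => f x + g x) = ip h f + ip h g.
Proof.
move=> f2 g2 h2; rewrite /ip -cID; [|exact: L2MJ_ci..].
by apply: cI_ext => x _; rewrite rmorphD mulrDr.
Qed.

Lemma ipZr a f h : L2 f -> L2 h -> ip h (fun x => a * f x) = a^* * ip h f.
Proof.
move=> f2 h2; rewrite /ip -cIZ; last exact: L2MJ_ci.
by apply: cI_ext => x _; rewrite rmorphM mulrCA.
Qed.

Lemma ipNl f h : L2 f -> L2 h -> ip (fun x => - f x) h = - ip f h.
Proof.
move=> f2 h2; rewrite -mulN1r -ipZl//.
by apply: cI_ext => x _; rewrite mulN1r.
Qed.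

Lemma ipBl f g h : L2 f -> L2 g -> L2 h ->
  ip (fun x => f x - g x) h = ip f h - ip g h.
Proof. by move=> f2 g2 h2; rewrite ipDl ?ipNl//; exact: L2N. Qed.

Lemma ipBr f g h : L2 f -> L2 g -> L2 h ->
  ip h (fun x => f x - g x) = ip h f - ip h g.
Proof.
move=> f2 g2 h2; have fg2 := L2B f2 g2.
rewrite (ipJ fg2 h2) (ipJ f2 h2) (ipJ g2 h2) ipBl//.
by apply: Cext; rewrite !CE// opprD.
Qed.

Lemma ip_suml n (F : nat -> T -> R[i]) h : (forall i, L2 (F i)) -> L2 h ->
  ip (fun x => \sum_(i < n) F i x) h = \sum_(i < n) ip (F i) h.
Proof.
move=> F2 h2; rewrite /ip -(@cI_sum n (fun i x => F i x * (h x)^*)); last by move=> i; exact: L2MJ_ci.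
by apply: cI_ext => x _; rewrite mulr_suml.
Qed.

Lemma ip_aer f g h : L2 f -> L2 h -> L2 g -> aeeq mu D f g -> ip h f = ip h g.
Proof.
move=> f2 h2 g2 fg; apply: cI_ae.
- exact: cmM (L2_cm h2) (cmJ (L2_cm f2)).
- exact: cmM (L2_cm h2) (cmJ (L2_cm g2)).
- by apply: filterS fg => x fg Dx; rewrite fg.
Qed.

Lemma ip_ael f g h : L2 f -> L2 h -> L2 g -> aeeq mu D f g -> ip f h = ip g h.
Proof.
by move=> f2 h2 g2 fg; rewrite (ipJ h2 f2) (ip_aer f2 h2 g2 fg) -ipJ.
Qed.

Lemma nqE f : L2 f -> (\int[mu]_(x in D) (Normc.normc (f x) ^+ 2)%:E)%E = (nq f)%:E.
Proof.
move=> f2; rewrite /nq /ip /= /Rintegral fineK; last first.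
  by apply: integrable_fin_num => //; case: (L2MJ_ci f2 f2).
by apply: eq_integral => x _; rewrite mulJ_Re.
Qed.

Lemma ip_nq f : ip f f = (nq f)%:C.
Proof.
apply: Cext => //=; rewrite /Rintegral integral0_eq// => x _.
by rewrite mulJ_Im.
Qed.

Lemma nq_ge0 f : 0 <= nq f.
Proof. by apply: Rintegral_ge0 => x Dx; rewrite mulJ_Re sqr_ge0. Qed.

Lemma nq_ext f g : (forall x, D x -> f x = g x) -> nq f = nq g.
Proof. by move=> fg; rewrite /nq; congr ReC; apply: cI_ext => x Dx; rewrite fg. Qed.

Lemma nq_ae f g : L2 f -> L2 g -> aeeq mu D f g -> nq f = nq g.
Proof. by move=> f2 g2 fg; rewrite /nq (ip_ael f2 f2 g2 fg) (ip_aer f2 g2 g2 fg). Qed.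

Lemma nqD f g : L2 f -> L2 g -> nq (fun x => f x + g x) = nq f + nq g + 2 * ReC (ip f g).
Proof.
move=> f2 g2; have fg2 := L2D f2 g2.
by rewrite /nq ipDl// !ipDr// !ReD (ipJ f2 g2) ReJ; ring.
Qed.

Lemma nqZ a f : L2 f -> nq (fun x => a * f x) = Normc.normc a ^+ 2 * nq f.
Proof.
move=> f2; have af2 := L2Z a f2.
by rewrite /nq ipZl// ipZr// ip_nq mulrA mulJE -rmorphM.
Qed.

Lemma nqN f : L2 f -> nq (fun x => - f x) = nq f.
Proof.
move=> f2; rewrite -[RHS]mul1r (_ : 1 = Normc.normc (-1 : R[i]) ^+ 2).
  by rewrite -nqZ//; apply: nq_ext => x _; rewrite mulN1r.
by rewrite normc2E /= oppr0; ring.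
Qed.

Lemma nqB f g : L2 f -> L2 g -> nq (fun x => f x - g x) = nq f + nq g - 2 * ReC (ip f g).
Proof.
move=> f2 g2; have ng2 := L2N g2.
rewrite nqD// nqN// (ipJ ng2 f2) ReJ ipNl// ReN (ipJ f2 g2) ReJ; ring.
Qed.

Lemma nqD_le f g : L2 f -> L2 g -> nq (fun x => f x + g x) <= 2 * nq f + 2 * nq g.
Proof.
move=> f2 g2; have := nq_ge0 (fun x => f x - g x).
by rewrite nqB// nqD//; lra.
Qed.

Lemma nqB_le f g : L2 f -> L2 g -> nq (fun x => f x - g x) <= 2 * nq f + 2 * nq g.
Proof. by move=> f2 g2; rewrite -(nqN g2); apply: nqD_le => //; exact: L2N. Qed.

Lemma nqB_sym f g : L2 f -> L2 g -> nq (fun x => f x - g x) = nq (fun x => g x - f x).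
Proof.
by move=> f2 g2; rewrite -nqN; [apply: nq_ext => x _; rewrite opprB|exact: L2B].
Qed.

(** The squared norm of [f - t <f, g> g] is nonnegative for every real [t]; taking [t = 1 / |g|^2]
    gives the inequality when [|g|] is not 0. *)
Lemma CS f g : L2 f -> L2 g -> Normc.normc (ip f g) ^+ 2 <= nq f * nq g.
Proof.
move=> f2 g2; set A := Normc.normc _ ^+ 2.
have key t : 0 <= nq f - 2 * t * A + t ^+ 2 * A * nq g.
  have ag2 := L2Z (t%:C * ip f g) g2.
  have := nq_ge0 (fun x => f x - (t%:C * ip f g) * g x).
  rewrite nqB// nqZ// ipZr// Normc.normcM exprMn rmorphM.
  have -> : ReC ((t%:C)^* * (ip f g)^* * ip f g) = t * A.
    by rewrite /A normc2E !CE /=; ring.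
  have -> : Normc.normc (t%:C : R[i]) ^+ 2 = t ^+ 2 by rewrite normc2E/=; ring.
  by rewrite -/A !mulrA; move: A => A; lra.
have A0 : 0 <= A by rewrite sqr_ge0.
have [g0|] := eqVneq (nq g) 0; last first.
  rewrite neq_lt => /orP[|g0]; first by rewrite ltNge nq_ge0.
  have := key (nq g)^-1; rewrite (_ : _ + _ = nq f - A / nq g); last by field; rewrite gt_eqF.
  by rewrite subr_ge0 ler_pdivrMr.
rewrite g0 mulr0 leNgt; apply/negP => Ap.
(* With [|g| = 0] the expression is affine in [t], and this [t] gives it the value -1. *)
have := key ((nq f + 1) / (2 * A)).
rewrite g0 mulr0 addr0 (_ : _ - _ = -1) ?oppr_ge0 ?ler10//.
by field; rewrite gt_eqF.
Qed.

Lemma CS_Re f g : L2 f -> L2 g -> ReC (ip f g) ^+ 2 <= nq f * nq g.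
Proof.
move=> f2 g2; apply: le_trans (CS f2 g2).
by rewrite normc2E lerDl sqr_ge0.
Qed.

Lemma nq0_ae f : L2 f -> nq f = 0 -> aeeq mu D f (fun=> 0).
Proof.
move=> f2 f0.
have mf : measurable_fun D (fun x => (Normc.normc (f x) ^+ 2)%:E).
  exact/measurable_EFinP/cm_normc/L2_cm.
have : (\int[mu]_(x in D) `|(Normc.normc (f x) ^+ 2)%:E| = 0)%E.
  transitivity ((nq f)%:E); last by rewrite f0.
  rewrite -nqE//; apply: eq_integral => x _.
  by rewrite gee0_abs// lee_fin sqr_ge0.
move/(ae_eq_integral_abs mu mD mf); apply: filterS => x /[apply] -[].
by move=> /eqP; rewrite sqrf_eq0 => /eqP/Normc.eq0_normc.
Qed.

Lemma ae_nq0 f : L2 f -> aeeq mu D f (fun=> 0) -> nq f = 0.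
Proof.
move=> f2 f0; rewrite (nq_ae f2 L2_0 f0) /nq /ip.
by rewrite (@cI_ext _ (fun=> 0)) ?cI0// => x _; rewrite mul0r.
Qed.

End General.

Section AeFacts.
Context d (T : measurableType d) (R : realType) (mu : {measure set T -> \bar R}).

Lemma aeW (P : T -> Prop) : (forall x, P x) -> {ae mu, forall x, P x}.
Proof. by move=> h; exact: nearW. Qed.

Lemma aeS (P P1 : T -> Prop) : (forall x, P x -> P1 x) ->
  {ae mu, forall x, P x} -> {ae mu, forall x, P1 x}.
Proof. exact: filterS. Qed.

Lemma aeS2 (P P1 P2 : T -> Prop) : (forall x, P x -> P1 x -> P2 x) ->
  {ae mu, forall x, P x} -> {ae mu, forall x, P1 x} -> {ae mu, forall x, P2 x}.
Proof. exact: filterS2. Qed.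

End AeFacts.

Global Opaque ip nq.
Arguments cintegral : simpl never.
Arguments Normc.normc : simpl never.

Section Seq.
Variable R : realType.
Implicit Types u a : nat -> R.

Lemma cvg0P u : (forall n, 0 <= u n) ->
  (u n @[n --> \oo] --> (0 : R)) <->
  (forall e, 0 < e -> exists N, forall n, (N <= n)%N -> u n <= e).
Proof.
move=> u0; split=> [/cvgr0Pnorm_le uc e e0|h].
  have [N _ hN] := uc e e0; exists N => n Nn.
  by have := hN n Nn; rewrite ger0_norm.
apply/cvgr0Pnorm_le => e e0; have [N hN] := h e e0.
by exists N => // n /= Nn; rewrite ger0_norm// hN.
Qed.

(** Telescoping against a geometric series. The auxiliary bound keeps the subtracted term
    [2^-1 ^+ (k + m)], which lets the induction on [m] close. *)
Lemma geo_cvg a s : (forall k, `|a k.+1 - a k| <= s * 2^-1 ^+ k) ->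
  cvgn a /\ forall k, `|limn a - a k| <= s * 2 * 2^-1 ^+ k.
Proof.
move=> ha; have s0 : 0 <= s by have := ha 0%N; rewrite expr0 mulr1; apply: le_trans.
have p0 k : 0 <= (2^-1 : R) ^+ k by rewrite exprn_ge0.
have b k m : `|a (k + m)%N - a k| <= s * 2 * (2^-1 ^+ k - 2^-1 ^+ (k + m)).
  elim: m => [|m IH]; first by rewrite addn0 !subrr normr0 mulr0.
  rewrite addnS -(subrKA (a (k + m)%N)) (le_trans (ler_normD _ _))//.
  apply: le_trans (lerD (ha _) IH) _.
  by rewrite le_eqVlt; apply/orP; left; apply/eqP; rewrite exprS; lra.
have b' k n : (k <= n)%N -> `|a n - a k| <= s * 2 * 2^-1 ^+ k.
  move=> kn; rewrite -(subnKC kn); apply: le_trans (b _ _) _.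
  by apply: ler_wpM2l; [lra|rewrite lerBlDr lerDl].
have ca : cvgn a.
  apply: cauchy_cvg; apply/cauchy_exP => e e0.
  have : (s * 2 * 2^-1 ^+ k) @[k --> \oo] --> (0 : R).
    rewrite -(mulr0 (s * 2)); apply: cvgMr; apply: cvg_expr.
    by rewrite ger0_norm// invf_lt1// ltr1n.
  move/cvgr0Pnorm_lt => /(_ e e0)[N _ hN].
  exists (a N); exists N => // n /= Nn.
  rewrite /ball/= distrC; apply: le_lt_trans (b' _ _ Nn) _.
  by have := hN N (leqnn N); rewrite ger0_norm// !mulr_ge0.
split=> // k.
have c : `|a n - a k| @[n --> \oo] --> `|limn a - a k|.
  by apply: cvg_norm; apply: cvgB => //; exact: cvg_cst.
rewrite -(cvg_lim _ c)//; apply: limr_le; first by apply/cvg_ex; eexists; exact: c.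
by exists k => // n /= kn; exact: b'.
Qed.

End Seq.

(** * Completeness and orthonormal series *)

Section Complete.
Context d (T : measurableType d) (R : realType).
Variables (mu : {measure set T -> \bar R}) (D : set T).
Hypothesis mD : measurable D.
Implicit Types f g h : T -> R[i].
Notation cm := (@cmeasurable _ T R D).
Notation L2 := (isL2 mu D).
Notation nq := (nq mu D).
Notation ip := (ip mu D).

(* Weighting the squared increments by [4 ^ k] keeps their sum integrable, and
   where it is finite the increments are dominated by a geometric series. *)
Lemma L2_limit (f : nat -> T -> R[i]) : (forall n, L2 (f n)) ->
  (forall k, nq (fun x => f k.+1 x - f k x) <= 8^-1 ^+ k) ->
  exists2 g, L2 g & forall k, nq (fun x => f k x - g x) <= 16 * 4^-1 ^+ k.
Proof.
move=> f2 fd.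
pose dd k x := f k.+1 x - f k x.
have dd2 k : L2 (dd k) by exact: L2B.
pose F k x := (4 ^+ k * Normc.normc (dd k x) ^+ 2)%:E.
have F0 k x : (0 <= F k x)%E by rewrite lee_fin mulr_ge0 ?sqr_ge0// exprn_ge0.
have mF k : measurable_fun D (F k).
  apply/measurable_EFinP; apply: measurable_funM => //; exact/cm_normc/L2_cm.
pose S x := (\sum_(0 <= k <oo) F k x)%E.
have mS : measurable_fun D S by apply: ge0_emeasurable_sum.
have S0 x : (0 <= S x)%E by apply: nneseries_ge0.
(* The term of index [k] has integral at most [4 ^ k * 8^-1 ^ k = 2^-1 ^ k]. *)
have IS : (\int[mu]_(x in D) S x <= 2%:E)%E.
  rewrite integral_nneseries//.
  apply: lime_le; first by apply: is_cvg_nneseries => n _ _; exact: integral_ge0.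
  apply: nearW => n; apply: (@le_trans _ _ (2 - 2 * 2^-1 ^+ n)%:E); last first.
    by rewrite lee_fin gerDl oppr_le0 mulr_ge0// exprn_ge0.
  elim: n => [|n IH].
    by rewrite big_geq// expr0 mulr1 subrr.
  rewrite big_nat_recr//=; apply: le_trans (leeD IH _) _; last first.
    by instantiate (1 := (2^-1 ^+ n)%:E); rewrite -EFinD lee_fin exprS; lra.
  under eq_integral do rewrite /F EFinM.
  rewrite ge0_integralZl_EFin ?exprn_ge0//; last first.
    exact/measurable_EFinP/cm_normc/L2_cm.
    by move=> x _; rewrite lee_fin sqr_ge0.
  rewrite nqE// -EFinM lee_fin (le_trans (ler_wpM2l _ (fd n)))// ?exprn_ge0//.
  by rewrite -exprMn (_ : 4 * 8^-1 = 2^-1)//; lra.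
have dS k x s : S x = s%:E -> Normc.normc (dd k x) <= Num.sqrt s * 2^-1 ^+ k.
  move=> Ss; have s0 : 0 <= s by rewrite -lee_fin -Ss.
  rewrite -(@ler_pXn2r _ 2)// ?nnegrE ?normc_ge0 ?mulr_ge0 ?exprn_ge0//.
  rewrite exprMn sqr_sqrtr// -exprM mulnC exprM.
  have : (F k x <= S x)%E.
    apply: le_trans (@nneseries_lim_ge _ (F^~ x) xpredT 0%N k.+1 _) => //.
    by rewrite big_nat_recr//= leeDr// sume_ge0.
  rewrite Ss lee_fin -ler_pdivlMl ?exprn_gt0//.
  by rewrite [_ * s]mulrC -exprVn (_ : 2^-1 ^+ 2 = 4^-1 :> R)//; field.
pose G := D `&` [set x | (S x < +oo)%E].
(* The indicator [c] of [G] makes the sequences converge at every point of [D], as the measurability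
   of a pointwise limit requires; off [G] the limit is 0. *)
have mG : measurable G by rewrite /G; exact: emeasurable_fun_infty_o.
pose c x : R := \1_G x.
pose g x := limn (fun k => c x * ReC (f k x)) +i* limn (fun k => c x * ImC (f k x)).
(* The constant 8 is twice 4: the real and the imaginary part each contribute [4 * 4^-1 ^ k * s]. *)
have key x s : D x -> S x = s%:E ->
   [/\ cvgn (fun k => ReC (f k x)), cvgn (fun k => ImC (f k x)) &
   forall k, Normc.normc (f k x - g x) ^+ 2 <= 8 * 4^-1 ^+ k * s].
  move=> Dx Ss; have s0 : 0 <= s by rewrite -lee_fin -Ss.
  have c1 : c x = 1 by rewrite /c indicE mem_set//; split => //=; rewrite Ss ltry.
  have [|r1 r2] := @geo_cvg _ (fun k => ReC (f k x)) (Num.sqrt s).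
    move=> k; apply: le_trans (dS k x s Ss); apply: le_trans (Re_le_normc _).
    by rewrite /dd !CE.
  have [|i1 i2] := @geo_cvg _ (fun k => ImC (f k x)) (Num.sqrt s).
    move=> k; apply: le_trans (dS k x s Ss); apply: le_trans (Im_le_normc _).
    by rewrite /dd !CE.
  split=> // k; rewrite normc2E !CE /g c1 /=.
  rewrite (_ : (fun k => 1 * ReC (f k x)) = fun k => ReC (f k x)); last by apply/funext => ?; rewrite mul1r.
  rewrite (_ : (fun k => 1 * ImC (f k x)) = fun k => ImC (f k x)); last by apply/funext => ?; rewrite mul1r.
  have sq (y z : R) : `|z - y| <= Num.sqrt s * 2 * 2^-1 ^+ k -> (y - z) ^+ 2 <= 4 * 4^-1 ^+ k * s.
    rewrite -(@ler_pXn2r _ 2)// ?nnegrE ?mulr_ge0 ?exprn_ge0// real_normK ?num_real//.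
    rewrite !exprMn sqr_sqrtr// -exprM mulnC exprM (_ : 2^-1 ^+ 2 = 4^-1 :> R); last by field.
    by move=> h; rewrite -sqrrN opprB (le_trans h)//; lra.
  by have := sq _ _ (r2 k); have := sq _ _ (i2 k); lra.
have cG x : D x -> c x != 0 -> exists s, S x = s%:E.
  move=> Dx; rewrite /c indicE; have [/set_mem[_ /= Sf] _|] := boolP (x \in G); last by rewrite eqxx.
  by exists (fine (S x)); rewrite fineK// ge0_fin_numE.
have cvc (p : R[i] -> R) x : D x -> (forall s, S x = s%:E -> cvgn (fun k => p (f k x))) ->
    cvgn (fun k => c x * p (f k x)).
  move=> Dx h; have [c0|/(cG _ Dx)[s /h pc]] := eqVneq (c x) 0.
    rewrite (_ : (fun k => c x * p (f k x)) = cst 0); first exact: is_cvg_cst.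
    by apply/funext => k; rewrite c0 mul0r.
  exact: is_cvgMr pc.
have mg : cm g.
  split.
    apply: (@measurable_fun_cvg _ _ _ _ (fun k x => c x * ReC (f k x))) => [k|x Dx].
      apply: measurable_funM; first exact: measurable_indic.
      by case: (L2_cm (f2 k)).
    by apply: cvc => // s /(key x s Dx)[].
  apply: (@measurable_fun_cvg _ _ _ _ (fun k x => c x * ImC (f k x))) => [k|x Dx].
    apply: measurable_funM; first exact: measurable_indic.
    by case: (L2_cm (f2 k)).
  by apply: cvc => // s /(key x s Dx)[].
have bd k : (\int[mu]_(x in D) (Normc.normc (f k x - g x) ^+ 2)%:E <= (16 * 4^-1 ^+ k)%:E)%E.
  apply: (@le_trans _ _ (\int[mu]_(x in D) ((8 * 4^-1 ^+ k)%:E * S x))%E).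
    apply: ge0_le_integral => //.
    - by move=> x _; rewrite lee_fin sqr_ge0.
    - exact/measurable_EFinP/cm_normc/(cmB (L2_cm (f2 k)) mg).
    - exact: measurable_funeM.
    - move=> x Dx; move: (S0 x) (key x); case: (S x) => [s _ h|_ _|//].
        by rewrite -EFinM lee_fin; have [] := h s Dx erefl.
      by rewrite gt0_muley ?leey// lte_fin mulr_gt0// exprn_gt0.
  rewrite ge0_integralZl_EFin// ?mulr_ge0 ?exprn_ge0//.
  apply: le_trans (lee_wpmul2l _ IS) _; first by rewrite lee_fin mulr_ge0// exprn_ge0.
  by rewrite -EFinM lee_fin; lra.
have fg2 k : L2 (fun x => f k x - g x).
  by split; [exact: cmB (L2_cm (f2 k)) mg|exact: le_lt_trans (bd k) (ltry _)].
exists g => [|k].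
  by apply: (L2_ext mD _ (L2B mD (f2 0%N) (fg2 0%N))) => x _; rewrite opprB addrC subrK.
by rewrite -lee_fin -nqE.
Qed.

Theorem L2_complete (f : nat -> T -> R[i]) : (forall n, L2 (f n)) ->
  (forall e, 0 < e -> exists N, forall m n, (N <= m)%N -> (N <= n)%N ->
     nq (fun x => f m x - f n x) <= e) ->
  exists2 g, L2 g & nq (fun x => f n x - g x) @[n --> \oo] --> (0 : R).
Proof.
move=> f2 hc.
have /choice[N hN] k : exists N, forall m n, (N <= m)%N -> (N <= n)%N ->
     nq (fun x => f m x - f n x) <= 8^-1 ^+ k.
  by apply: hc; rewrite exprn_gt0.
(* Cumulative sums make the indices of the subsequence nondecreasing as well as at least [N k]. *)
pose M k := (\sum_(i < k.+1) N i)%N.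
have NM k : (N k <= M k)%N by rewrite /M big_ord_recr leq_addl.
have MS k : (M k <= M k.+1)%N by rewrite /M [X in (_ <= X)%N]big_ord_recr leq_addr.
have [g g2 hg] : exists2 g, L2 g & forall k, nq (fun x => f (M k) x - g x) <= 16 * 4^-1 ^+ k.
  apply: (@L2_limit (fun k => f (M k))) => // k.
  by apply: hN => //; exact: leq_trans (NM k) (MS k).
exists g => //; apply/cvg0P => [n|e e0]; first exact: nq_ge0.
have : (2 * 8^-1 ^+ k + 2 * (16 * 4^-1 ^+ k)) @[k --> \oo] --> (0 : R).
  rewrite (_ : 0 = 2 * 0 + 2 * (16 * 0)); last by rewrite !mulr0 addr0.
  apply: cvgD; first by apply: cvgMr; apply: cvg_expr; rewrite ger0_norm// invf_lt1// ltr1n.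
  by apply: cvgMr; apply: cvgMr; apply: cvg_expr; rewrite ger0_norm// invf_lt1// ltr1n.
move/cvgr0Pnorm_le => /(_ e e0)[k _ /(_ k (leqnn k))].
rewrite ger0_norm => [hk|]; last by rewrite addr_ge0// !mulr_ge0// exprn_ge0.
exists (N k) => n Nn; apply: le_trans hk.
rewrite (@nq_ext _ _ _ _ _ _ (fun x => (f n x - f (M k) x) + (f (M k) x - g x))); last first.
  by move=> x _; rewrite addrA subrK.
apply: le_trans (nqD_le mD _ _) _; [exact: L2B|exact: L2B|].
by rewrite lerD// ler_wpM2l// hN.
Qed.

(** Pythagoras: each new term is orthogonal to the block accumulated so far. *)
Lemma orth_nq (u : nat -> T -> R[i]) m k : (forall n, L2 (u n)) ->
  (forall i j, i != j -> ip (u i) (u j) = 0) ->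
  nq (fun x => \sum_(i < m + k) u i x - \sum_(i < m) u i x) =
  \sum_(i < m + k) nq (u i) - \sum_(i < m) nq (u i).
Proof.
move=> u2 uo; elim: k => [|k IH].
  rewrite addn0 subrr (@nq_ext _ _ _ _ _ _ (fun=> 0)); last by move=> x _; rewrite subrr.
  by apply: ae_nq0 => //; [exact: L2_0|exact: nearW].
have s2 n : L2 (fun x => \sum_(i < n) u i x) by exact: L2_sum.
rewrite addnS (@nq_ext _ _ _ _ _ _ (fun x =>
   (\sum_(i < m + k) u i x - \sum_(i < m) u i x) + u (m + k)%N x)); last first.
  by move=> x _; rewrite big_ord_recr/= addrAC.
rewrite nqD//; last exact: L2B.
have z n : (n <= m + k)%N -> ip (fun x => \sum_(i < n) u i x) (u (m + k)%N) = 0.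
  move=> nk; rewrite ip_suml// big1// => i _.
  by apply: uo; rewrite ltn_eqF// (leq_trans (ltn_ord i)).
have zz : ip (fun x => \sum_(i < m + k) u i x - \sum_(i < m) u i x) (u (m + k)%N) = 0.
  by apply: etrans (ipBl mD (s2 _) (s2 _) (u2 _)) _; rewrite !z ?leq_addr// subrr.
by rewrite IH big_ord_recr/= zz mulr0 addr0 addrAC.
Qed.

(** By Pythagoras the squared distances between partial sums are the increments of a bounded
    monotone real sequence, so the partial sums are Cauchy. *)
Lemma orth_series (u : nat -> T -> R[i]) M : (forall n, L2 (u n)) ->
  (forall i j, i != j -> ip (u i) (u j) = 0) ->
  (forall n, \sum_(i < n) nq (u i) <= M) ->
  exists2 g, L2 g & nq (fun x => \sum_(i < n) u i x - g x) @[n --> \oo] --> (0 : R).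
Proof.
move=> u2 uo uM.
have s2 n : L2 (fun x => \sum_(i < n) u i x) by exact: L2_sum.
apply: (@L2_complete (fun n x => \sum_(i < n) u i x)) => // e e0.
pose s n := \sum_(i < n) nq (u i).
have snd : nondecreasing_seq s.
  by apply/nondecreasing_seqP => n; rewrite /s big_ord_recr lerDl nq_ge0.
have sc : cvgn s.
  by apply: nondecreasing_is_cvgn => //; exists M => _ [n _ <-]; exact: uM.
have /cvgrPdist_le/(_ e e0)[N _ hN] := sc.
have lt n : s n <= limn s by exact: nondecreasing_cvgn_le.
exists N.
suff H m n : (N <= m)%N -> (m <= n)%N ->
    nq (fun x => \sum_(i < n) u i x - \sum_(i < m) u i x) <= e.
  move=> m n Nm Nn; have [mn|/ltnW nm] := leqP m n; last exact: H.
  by rewrite nqB_sym//; exact: H.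
move=> Nm mn; rewrite -(subnKC mn) orth_nq// subnKC// -/(s _) -/(s _).
have := hN m Nm; rewrite ger0_norm ?subr_ge0//; apply: le_trans.
by rewrite lerD2r.
Qed.

Section Parseval.
Variable e : nat -> T -> R[i].
Hypothesis e2 : forall n, L2 (e n).
Hypothesis eo : forall m n, ip (e m) (e n) = (m == n)%:R.
Hypothesis et : forall f, L2 f -> (forall n, ip f (e n) = 0) ->
  aeeq mu D f (fun=> 0).

Definition proj f n x := \sum_(i < n) ip f (e i) * e i x.

Lemma L2_proj f n : L2 (proj f n).
Proof. by apply: (@L2_sum _ _ _ _ _ mD n (fun i x => ip f (e i) * e i x)) => i; exact: L2Z. Qed.

Lemma ip_proj f n m : ip (proj f n) (e m) = if (m < n)%N then ip f (e m) else 0.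
Proof.
have ce2 i : L2 (fun x => ip f (e i) * e i x) by exact: L2Z.
rewrite /proj (@ip_suml _ _ _ _ _ mD n (fun i x => ip f (e i) * e i x))//.
case: ltnP => mn.
  rewrite (bigD1 (Ordinal mn))//= ipZl// eo eqxx mulr1 big1 ?addr0// => i im.
  by rewrite ipZl// eo (negbTE _ : (i == m :> nat) = false) ?mulr0.
rewrite big1// => i _; rewrite ipZl// eo ltn_eqF ?mulr0//.
exact: leq_trans (ltn_ord i) mn.
Qed.

(** Pythagoras again, removing one basis vector at a time. Bessel's inequality is the nonnegativity
    of the left side. *)
Lemma bessel f n : L2 f ->
  nq (fun x => f x - proj f n x) = nq f - \sum_(i < n) Normc.normc (ip f (e i)) ^+ 2.
Proof.
move=> f2; elim: n => [|n IH].
  by rewrite big_ord0 subr0; apply: nq_ext => x _; rewrite /proj big_ord0 subr0.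
have ce2 i : L2 (fun x => ip f (e i) * e i x) by exact: L2Z.
have fp2 : L2 (fun x => f x - proj f n x) by apply: L2B => //; exact: L2_proj.
rewrite (@nq_ext _ _ _ _ _ _ (fun x => (f x - proj f n x) - ip f (e n) * e n x)); last first.
  by move=> x _; rewrite /proj big_ord_recr/= opprD addrA.
rewrite nqB// IH nqZ// ipZr// ipBl//; last exact: L2_proj.
rewrite ip_proj ltnn subr0 [_^* * _]mulrC mulJ_Re big_ord_recr/=.
by rewrite [X in _ * X]nq_ip eo eqxx mulr1; lra.
Qed.

(** Completeness provides a limit [g] of the projections. The coefficient of index [n] of a
    projection is eventually that of [f], so [f - g] is orthogonal to the whole basis, and totality
    gives [f = g] almost everywhere. *)
Lemma parseval_cvg f : L2 f ->
  nq (fun x => f x - proj f n x) @[n --> \oo] --> (0 : R).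
Proof.
move=> f2.
have ce2 i : L2 (fun x => ip f (e i) * e i x) by exact: L2Z.
have nqc i : nq (fun x => ip f (e i) * e i x) = Normc.normc (ip f (e i)) ^+ 2.
  by rewrite nqZ// [X in _ * X]nq_ip eo eqxx mulr1.
have [||n|g g2 hg] := @orth_series (fun i x => ip f (e i) * e i x) (nq f).
- by [].
- by move=> i j ij; rewrite ipZl// ipZr// eo (negbTE ij) !mulr0.
- rewrite (eq_bigr (fun i : 'I_n => Normc.normc (ip f (e i)) ^+ 2)) => [|i _]; last exact: nqc.
  by rewrite -subr_ge0 -bessel// nq_ge0.
have fg2 : L2 (fun x => f x - g x) by exact: L2B.
have /et : forall n, ip (fun x => f x - g x) (e n) = 0.
  move=> n; apply: Normc.eq0_normc; apply/eqP; rewrite -sqrf_eq0 eq_le sqr_ge0 andbT.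
  apply/ler_addgt0Pr => eps eps0; rewrite add0r.
  have [N hN] := (cvg0P (fun m => nq_ge0 mu D _)).1 hg eps eps0.
  have := hN (maxn N n.+1); rewrite leq_maxl => /(_ isT).
  set m := maxn N n.+1; have nm : (n < m)%N by rewrite leq_maxr.
  apply: le_trans.
  have -> : ip (fun x => f x - g x) (e n) = ip (fun x => proj f m x - g x) (e n).
    by rewrite !ipBl ?ip_proj ?nm//; exact: L2_proj.
  apply: le_trans (CS mD _ (e2 n)) _; first by apply: L2B => //; exact: L2_proj.
  by rewrite [X in _ * X]nq_ip eo eqxx mulr1.
move=> /(_ fg2) fg0; apply: cvg_trans hg; apply: near_eq_cvg; apply: nearW => n /=.
rewrite nqB_sym//; last exact: L2_proj.
have p2 := L2_proj f n.
apply: nq_ae => //; [exact: L2B|exact: L2B|].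
by apply: filterS fg0 => x fg Dx; congr (_ - _); apply/esym/eqP; rewrite -subr_eq0 fg.
Qed.

Lemma parseval f : L2 f ->
  \sum_(i < n) Normc.normc (ip f (e i)) ^+ 2 @[n --> \oo] --> nq f.
Proof.
move=> f2; have h := parseval_cvg f2.
rewrite -[nq f]subr0.
rewrite (_ : (fun n => _) = fun n => nq f - nq (fun x => f x - proj f n x)); last first.
  by apply/funext => n; rewrite bessel//; ring.
by apply: cvgB => //; exact: cvg_cst.
Qed.

End Parseval.
End Complete.

(** * Measure-preserving maps and iterated integrals *)

Section MeasurePreserving.
Context d (T : measurableType d) (R : realType) (mu : {measure set T -> \bar R}).
Implicit Type h : T -> T.

Definition mpres h :=
  measurable_fun setT h /\ forall A, measurable A -> mu (h @^-1` A) = mu A.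

Variables (h : T -> T) (hm : mpres h).

Lemma mpres_meas D : measurable D -> measurable (h @^-1` D).
Proof. by move=> mD; rewrite -[X in measurable X]setTI; apply: hm.1. Qed.

Lemma mpres_fun d' (T' : sigmaRingType d') D (F : T -> T') : measurable D ->
  measurable_fun D F -> measurable_fun (h @^-1` D) (F \o h).
Proof.
move=> mD mF; apply: (measurable_comp mD) => //; first by move=> _ [x /= Dx <-].
by apply: measurable_funTS; exact: hm.1.
Qed.

Lemma mpres_ge0 D (F : T -> \bar R) : measurable D -> measurable_fun D F ->
  (forall x, D x -> 0 <= F x)%E ->
  (\int[mu]_(x in h @^-1` D) F (h x) = \int[mu]_(x in D) F x)%E.
Proof.
move=> mD mF F0.
have F0' : {in D, forall x, 0 <= F x}%E by move=> x /set_mem; exact: F0.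
have <- := @ge0_integral_pushforward _ _ T T R h hm.1 mu D F mD mF F0'.
apply: eq_measure_integral; first exact: hm.1.
by move=> ? A mA _; exact: hm.2.
Qed.

Lemma mpres_eq D (F : T -> \bar R) : measurable D -> measurable_fun D F ->
  (\int[mu]_(x in h @^-1` D) F (h x) = \int[mu]_(x in D) F x)%E.
Proof.
move=> mD mF.
transitivity (\int[mu]_(x in h @^-1` D) (F \o h) x)%E => //.
rewrite [LHS]integralE [RHS]integralE funepos_comp funeneg_comp; congr (_ - _)%E.
  exact: (mpres_ge0 mD (measurable_funepos mF) (fun _ _ => funepos_ge0 _ _)).
exact: (mpres_ge0 mD (measurable_funeneg mF) (fun _ _ => funeneg_ge0 _ _)).
Qed.

Lemma mpres_integrable D (F : T -> \bar R) : measurable D ->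
  mu.-integrable D F -> mu.-integrable (h @^-1` D) (F \o h).
Proof.
move=> mD /integrableP[mF Fi]; apply/integrableP; split.
  exact: mpres_fun.
by rewrite (@mpres_ge0 _ (fun x => `|F x|%E))//; exact: measurableT_comp.
Qed.

Lemma mpres_ae (P : T -> Prop) : {ae mu, forall x, P x} -> {ae mu, forall x, P (h x)}.
Proof.
move=> [N [mN N0 NP]]; exists (h @^-1` N); split.
- exact: mpres_meas.
- by rewrite hm.2.
- by move=> x /= nP; apply: NP.
Qed.

Variables (D : set T) (mD : measurable D).
Implicit Type f : T -> R[i].

Lemma mpres_cm f : cmeasurable D f -> cmeasurable (h @^-1` D) (f \o h).
Proof. by move=> [f1 f2]; split; [exact: (mpres_fun mD f1)|exact: (mpres_fun mD f2)]. Qed.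

Lemma mpres_ci f : cintegrable mu D f -> cintegrable mu (h @^-1` D) (f \o h).
Proof. by move=> [f1 f2]; split; [exact: (mpres_integrable mD f1)|exact: (mpres_integrable mD f2)]. Qed.

Lemma mpres_cI f : cmeasurable D f ->
  cintegral mu (h @^-1` D) (f \o h) = cintegral mu D f.
Proof.
move=> [f1 f2]; rewrite /cintegral /Rintegral; congr (fine _ +i* fine _).
  by rewrite -(@mpres_eq D)//; exact/measurable_EFinP.
by rewrite -(@mpres_eq D)//; exact/measurable_EFinP.
Qed.

Lemma mpres_L2 f : isL2 mu D f -> isL2 mu (h @^-1` D) (f \o h).
Proof.
move=> [mf fi]; split; first exact: mpres_cm.
by rewrite (@mpres_ge0 D (fun x => (Normc.normc (f x) ^+ 2)%:E))// => [|x _];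
  [exact/measurable_EFinP/cm_normc|rewrite lee_fin sqr_ge0].
Qed.

Lemma mpres_ip f g : cmeasurable D f -> cmeasurable D g ->
  ip mu (h @^-1` D) (f \o h) (g \o h) = ip mu D f g.
Proof. by move=> mf mg; rewrite !ipE -mpres_cI//; apply/cmM => //; exact: cmJ. Qed.

Lemma mpres_nq f : cmeasurable D f ->
  nq mu (h @^-1` D) (f \o h) = nq mu D f.
Proof. by move=> mf; rewrite !nq_ip mpres_ip. Qed.

End MeasurePreserving.

(** * Tonelli and Fubini on rectangles *)

Section Prod.
Context d1 d2 (T1 : measurableType d1) (T2 : measurableType d2) (R : realType).
Variables (m1 : {sigma_finite_measure set T1 -> \bar R})
          (m2 : {sigma_finite_measure set T2 -> \bar R}).
Variables (A : set T1) (B : set T2).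
Hypotheses (mA : measurable A) (mB : measurable B).
Notation D := (A `*` B).

Lemma mAB : measurable D. Proof. exact: measurableX. Qed.
Local Notation mD := mAB.

Lemma patchX (F : T1 * T2 -> \bar R) x y :
  (F \_ D) (x, y) = if x \in A then ((fun y => F (x, y)) \_ B) y else 0%E.
Proof. by rewrite !patchE in_setX; case: (x \in A). Qed.

Lemma section_meas d' (T' : sigmaRingType d') (F : T1 * T2 -> T') x :
  measurable_fun D F -> A x -> measurable_fun B (fun y => F (x, y)).
Proof.
move=> mF Ax; apply: (measurable_comp (F := D) (g := pair x) mD _ mF) => //.
  by move=> _ [y By <-].
by apply: measurable_funTS; exact: measurable_pair1.
Qed.

Lemma meas_fst d' (T' : sigmaRingType d') (a : T1 -> T') :
  measurable_fun A a -> measurable_fun D (fun p => a p.1).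
Proof.
move=> ma; apply: (measurable_comp (F := A) (g := fst) mA _ ma).
  by move=> _ [p [? ?] <-].
exact: measurable_funTS measurable_fst.
Qed.

Lemma meas_snd d' (T' : sigmaRingType d') (a : T2 -> T') :
  measurable_fun B a -> measurable_fun D (fun p => a p.2).
Proof.
move=> ma; apply: (measurable_comp (F := B) (g := snd) mB _ ma).
  by move=> _ [p [? ?] <-].
exact: measurable_funTS measurable_snd.
Qed.

Lemma fubini_patch (F : T1 * T2 -> \bar R) x : A x ->
  (\int[m2]_y (F \_ D) (x, y) = \int[m2]_(y in B) F (x, y))%E.
Proof.
move=> Ax; rewrite [RHS]integral_mkcond; apply: eq_integral => y _.
by rewrite patchX mem_set.
Qed.

Lemma fubini_patch0 (F : T1 * T2 -> \bar R) x : ~ A x ->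
  (\int[m2]_y (F \_ D) (x, y) = 0)%E.
Proof.
by move=> Ax; apply: integral0_eq => y _; rewrite patchX memNset.
Qed.

Lemma tonelli_meas (F : T1 * T2 -> \bar R) : measurable_fun D F ->
  (forall p, D p -> 0 <= F p)%E -> measurable_fun A (fun x => \int[m2]_(y in B) F (x, y))%E.
Proof.
move=> mF F0.
have : measurable_fun A (fubini_F m2 (F \_ D)).
  apply: measurable_funTS; apply: measurable_fun_fubini_tonelli_F => [|p].
    by apply/(measurable_restrictT _ mD).
  by apply: erestrict_ge0.
by apply: eq_measurable_fun => x /set_mem Ax; rewrite /fubini_F fubini_patch.
Qed.

Lemma tonelli_prod (F : T1 * T2 -> \bar R) : measurable_fun D F ->
  (forall p, D p -> 0 <= F p)%E ->
  (\int[m1 \x m2]_(p in D) F p = \int[m1]_(x in A) \int[m2]_(y in B) F (x, y))%E.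
Proof.
move=> mF F0; rewrite integral_mkcond fubini_tonelli1; last 2 first.
  by apply/(measurable_restrictT _ mD).
  exact: erestrict_ge0.
rewrite [RHS]integral_mkcond; apply: eq_integral => x _; rewrite /fubini_F patchE.
by have [/set_mem Ax|/negP xA] := boolP (x \in A); [exact: fubini_patch|
  apply: fubini_patch0 => Ax; apply: xA; exact: mem_set].
Qed.

(** The inner integral is [fine] of a difference of two measurable functions with extended real
    values, so it stays measurable even where it diverges and takes a default value. *)
Lemma Rint_meas (f : T1 * T2 -> R) : measurable_fun D f ->
  measurable_fun A (fun x => Rintegral m2 B (fun y => f (x, y))).
Proof.
move=> mf; apply: measurableT_comp; first exact: fine_measurable.
have mF : measurable_fun D (EFin \o f) by exact/measurable_EFinP.
have h1 := @tonelli_meas ((EFin \o f)^\+)%E (measurable_funepos mF) (fun _ _ => funepos_ge0 _ _).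
have h2 := @tonelli_meas ((EFin \o f)^\-)%E (measurable_funeneg mF) (fun _ _ => funeneg_ge0 _ _).
apply: eq_measurable_fun (emeasurable_funB h1 h2) => x _.
transitivity (\int[m2]_(y in B) ((EFin \o f) \o pair x) y)%E => //.
by rewrite [RHS]integralE (funepos_comp (EFin \o f) (pair x)) (funeneg_comp (EFin \o f) (pair x)).
Qed.

Lemma cI_meas (f : T1 * T2 -> R[i]) : cmeasurable D f ->
  cmeasurable A (fun x => cintegral m2 B (fun y => f (x, y))).
Proof. by move=> [f1 f2]; split; [exact: (Rint_meas f1)|exact: (Rint_meas f2)]. Qed.

Lemma fubini_real (f : T1 * T2 -> R) : integrable (m1 \x m2)%E D (EFin \o f) ->
  [/\ {ae m1, forall x, A x -> m2.-integrable B (EFin \o (fun y => f (x, y)))},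
    m1.-integrable A (EFin \o (fun x => Rintegral m2 B (fun y => f (x, y)))) &
    Rintegral (m1 \x m2)%E D f =
    Rintegral m1 A (fun x => Rintegral m2 B (fun y => f (x, y)))].
Proof.
move=> fi; have gi := (integrable_mkcond (EFin \o f) mD).1 fi.
have mf : measurable_fun D f by apply/measurable_EFinP; exact: measurable_int fi.
set g := (EFin \o f) \_ D in gi.
have ae1 : {ae m1, forall x, A x -> m2.-integrable B (EFin \o (fun y => f (x, y)))}.
  apply: filterS (ae_integrable1 gi) => x + Ax.
  move=> h; apply/(integrable_mkcond _ mB); apply: eq_integrable h => // y _.
  by rewrite /g patchX mem_set.
have FA x : A x -> fubini_F m2 g x = (\int[m2]_(y in B) (f (x, y))%:E)%E.
  by move=> Ax; rewrite /fubini_F fubini_patch.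
have Fi : m1.-integrable A (fubini_F m2 g).
  by apply: integrableS (integrable_fubini_F gi).
have Ri : {ae m1, forall x, A x -> fubini_F m2 g x = (Rintegral m2 B (fun y => f (x, y)))%:E}.
  apply: filterS ae1 => x h Ax; rewrite FA// /Rintegral fineK//.
  exact: integrable_fin_num (h Ax).
have mRI := Rint_meas mf.
have RI : m1.-integrable A (EFin \o (fun x => Rintegral m2 B (fun y => f (x, y)))).
  apply: (le_integrable mA _ _ Fi); first exact/measurable_EFinP.
  move=> x Ax; rewrite /= FA// /Rintegral.
  have fine_le (u : \bar R) : (`|(fine u)%:E| <= `|u|)%E by case: u => [r||] /=; rewrite ?leey.
  exact: fine_le.
split=> //; congr fine.
transitivity (\int[m1]_(x in A) fubini_F m2 g x)%E.
  rewrite [LHS]integral_mkcond -(integral12_prod_meas1 gi) [RHS]integral_mkcond.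
  apply: eq_integral => x _; rewrite patchE.
  have [//|/negP xA] := boolP (x \in A).
  by rewrite /fubini_F fubini_patch0// => Ax; apply: xA; exact: mem_set.
apply: ae_eq_integral => //; first exact: measurable_int Fi.
exact/measurable_EFinP.
Qed.

Lemma fubini_C (f : T1 * T2 -> R[i]) : cintegrable (m1 \x m2)%E D f ->
  [/\ {ae m1, forall x, A x -> cintegrable m2 B (fun y => f (x, y))},
    cintegrable m1 A (fun x => cintegral m2 B (fun y => f (x, y))) &
    cintegral (m1 \x m2)%E D f =
    cintegral m1 A (fun x => cintegral m2 B (fun y => f (x, y)))].
Proof.
move=> [/fubini_real[a1 b1 c1] /fubini_real[a2 b2 c2]]; split.
- by move: a2; apply: filterS2 a1 => x h1 h2 Ax; split; [exact: h1|exact: h2].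
- by split.
- by rewrite /cintegral c1 c2.
Qed.

Lemma ci_tensor (a : T1 -> R[i]) (b : T2 -> R[i]) : cintegrable m1 A a ->
  cintegrable m2 B b -> cintegrable (m1 \x m2)%E D (fun p => a p.1 * b p.2).
Proof.
move=> ai bi.
have ma : cmeasurable D (fun p : T1 * T2 => a p.1).
  by have [u v] := ci_cm ai; split; [exact: (meas_fst u)|exact: (meas_fst v)].
have mb : cmeasurable D (fun p : T1 * T2 => b p.2).
  by have [u v] := ci_cm bi; split; [exact: (meas_snd u)|exact: (meas_snd v)].
have mab := cmM ma mb.
apply: (ci_le mD mab (g := fun p => Normc.normc (a p.1) * Normc.normc (b p.2))).
  by move=> p _; rewrite Normc.normcM.
have na := ci_normc mA ai; have nb := ci_normc mB bi.
have mn : measurable_fun D (fun p : T1 * T2 => Normc.normc (a p.1) * Normc.normc (b p.2)).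
  apply: measurable_funM.
    by apply: (meas_fst (a := fun x => Normc.normc (a x))); apply/measurable_EFinP; exact: measurable_int na.
  by apply: (meas_snd (a := fun x => Normc.normc (b x))); apply/measurable_EFinP; exact: measurable_int nb.
apply/integrableP; split; first exact/measurable_EFinP.
rewrite tonelli_prod; last 2 first.
  by apply: measurableT_comp => //; exact/measurable_EFinP.
  by [].
under eq_integral => x _.
  under eq_integral => y _ do rewrite /= ger0_norm ?mulr_ge0 ?normc_ge0// EFinM.
  rewrite ge0_integralZl_EFin ?normc_ge0//; [over|..].
    by move=> y _; rewrite lee_fin normc_ge0.
  exact: measurable_int nb.
rewrite /= ge0_integralZr//; last 3 first.
- exact: measurable_int na.
- by move=> x _; rewrite lee_fin normc_ge0.
- by apply: integral_ge0 => y _; rewrite lee_fin normc_ge0.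
have fin (d' : measure_display) (T' : measurableType d') (m : {measure set T' -> \bar R}) (E : set T') (u : T' -> R[i]) :
   m.-integrable E (EFin \o (fun x => Normc.normc (u x))) ->
   (\int[m]_(x in E) (Normc.normc (u x))%:E < +oo)%E.
  move=> /integrableP[_]; apply: le_lt_trans; rewrite le_eqVlt; apply/orP; left; apply/eqP.
  by apply: eq_integral => x _ /=; rewrite ger0_norm// normc_ge0.
apply: lte_mul_pinfty.
- by apply: integral_ge0 => y _; rewrite lee_fin normc_ge0.
- by rewrite ge0_fin_numE ?fin//; apply: integral_ge0 => y _; rewrite lee_fin normc_ge0.
- exact: fin.
Qed.

(** The measure of a null set is the integral of the measures of its sections, so almost all
    sections are null. *)
Lemma ae_prod (P : T1 * T2 -> Prop) : {ae (m1 \x m2)%E, forall p, D p -> P p} ->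
  {ae m1, forall x, A x -> {ae m2, forall y, B y -> P (x, y)}}.
Proof.
move=> [N [mN N0 NP]].
have : (\int[m1]_x `|m2 (xsection N x)| = 0)%E.
  rewrite -[RHS]N0; apply: eq_integral => x _ /=; rewrite gee0_abs//.
move/(ae_eq_integral_abs m1 measurableT (measurable_fun_xsection m2 mN)).
apply: filterS => x /(_ I) h Ax; exists (xsection N x); split => //.
  exact: measurable_xsection.
move=> y /= nP; rewrite /xsection/= inE; apply: NP => /= h'; apply: nP => By.
by apply: h'.
Qed.

End Prod.

Section ProdMP.
Context d1 d2 (T1 : measurableType d1) (T2 : measurableType d2) (R : realType).
Variables (m1 : {sigma_finite_measure set T1 -> \bar R})
          (m2 : {sigma_finite_measure set T2 -> \bar R}).

(** A skew product: [k x] preserves the measure of each section, and [h] preserves the integral of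
    the section measures. Letting [k] depend on the first coordinate covers shears. *)
Lemma mpres_prod (h : T1 -> T1) (k : T1 -> T2 -> T2) : mpres m1 h ->
  (forall x, mpres m2 (k x)) -> measurable_fun setT (fun p : T1 * T2 => k p.1 p.2) ->
  mpres (m1 \x m2)%E (fun p => (h p.1, k p.1 p.2)).
Proof.
move=> hm km mk; have ms : measurable_fun setT (fun p : T1 * T2 => (h p.1, k p.1 p.2)).
  apply: measurable_fun_pair => //.
  by apply: measurableT_comp => //; exact: hm.1.
split=> // A mA; rewrite /product_measure1 /=.
transitivity (\int[m1]_x (m2 (xsection A (h x))))%E.
  apply: eq_integral => x _ /=.
  rewrite -((km x).2 (xsection A (h x))); last exact: measurable_xsection.
  by congr (m2 _); apply/seteqP; split => y; rewrite /xsection /= !inE.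
rewrite -[RHS](@mpres_ge0 _ _ _ _ h hm setT (fun x => m2 (xsection A x))) ?preimage_setT//.
exact: measurable_fun_xsection.
Qed.

End ProdMP.

Section Swap.
Context d (T : measurableType d) (R : realType).
Variables (m : {sigma_finite_measure set T -> \bar R}).

(** Pulling back along the swap is integrating over sections in the other order; the two product
    measures agree on rectangles, hence everywhere. *)
Lemma mpres_swap : mpres (m \x m)%E (fun p => (p.2, p.1)).
Proof.
have ms : measurable_fun setT (fun p : T * T => (p.2, p.1)).
  exact: measurable_fun_pair.
split=> // A mA.
transitivity ((m \x^ m)%E A).
  by apply: eq_integral => x _ /=; congr (m _).
apply/esym; apply: product_measure_unique => // X Y mX mY.
exact: product_measure2E.
Qed.

End Swap.

Section Lebesgue.
Variable R : realType.
Notation leb := (@lebesgue_measure R).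
Notation RR := (measurableTypeR R).

Lemma mpres_translate (t : R) : mpres (T := RR) leb (fun x => x + t : R).
Proof.
have mt : measurable_fun (setT : set RR) (fun x : RR => x + t : RR).
  by apply: measurable_funD.
split=> // A mA; apply/esym.
apply: (@lebesgue_measure_unique _ (pushforward leb (fun x : RR => x + t : RR))) => //.
move=> _ [[a b]] _ <-.
transitivity (leb `](a - t), (b - t)]%classic).
  rewrite !lebesgue_measure_itv/= !lte_fin ltrD2r -!EFinB.
  by case: ifP => // _; congr EFin; ring.
apply: (congr1 leb); apply/seteqP.
by split => x /=; rewrite !in_itv/= ltrBlDr lerBrDr.
Qed.

Lemma mpres_translate2 (s t : R) :
  mpres (@leb2 R) (fun p : RR * RR => (p.1 + s, p.2 + t)).
Proof.
apply: (@mpres_prod _ _ RR RR R leb leb (fun x => x + s) (fun _ y => y + t)).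
- exact: mpres_translate.
- by move=> _; exact: mpres_translate.
- by apply: measurable_funD.
Qed.

Lemma mpres_shear : mpres (@leb2 R) (fun p : RR * RR => (p.1, p.2 + p.1)).
Proof.
apply: (@mpres_prod _ _ RR RR R leb leb id (fun x y => y + x)).
- by split => // A mA; rewrite preimage_id.
- exact: mpres_translate.
- by apply: measurable_funD.
Qed.

Lemma mpres_swap2 : mpres (@leb2 R) (fun p : RR * RR => (p.2, p.1)).
Proof. exact: mpres_swap. Qed.

Lemma halflineE : @halfline R = `]0, +oo[%classic :> set R.
Proof. by apply/seteqP; split => x; rewrite /= in_itv/= andbT. Qed.

Lemma m_half : measurable (@halfline R : set RR).
Proof. by rewrite halflineE; exact: measurable_itv. Qed.

Lemma quadrantE : @quadrant R = @halfline R `*` @halfline R :> set (R * R).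
Proof. by []. Qed.

Lemma m_quad : measurable (@quadrant R : set (RR * RR)).
Proof. exact: measurableX m_half m_half. Qed.

Lemma m_gt (t : R) : measurable ([set x | t < x] : set RR).
Proof.
rewrite (_ : mkset _ = `]t, +oo[%classic); first exact: measurable_itv.
by apply/seteqP; split => x; rewrite /= in_itv/= andbT.
Qed.

End Lebesgue.

(** * Operators with square-integrable kernels *)

Section Kernels.
Variable R : realType.
Notation leb := (@lebesgue_measure R).
Notation leb2 := (@leb2 R).
Notation RR := (measurableTypeR R).
Notation H := (@halfline R).
Notation Q := (@quadrant R).
Notation n1 := (nq leb H).
Notation i1 := (ip leb H).
Notation n2 := (nq leb2 Q).
Notation i2 := (ip leb2 Q).
Notation mH := (@m_half R).
Notation mQ := (@m_quad R).
Implicit Types (f g : R -> R[i]) (k l : R * R -> R[i]).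

Lemma nqR d (T : measurableType d) (mu : {measure set T -> \bar R}) D (f : T -> R[i]) :
  nq mu D f = Rintegral mu D (fun x => Normc.normc (f x) ^+ 2).
Proof.
by rewrite nq_ip ipE; apply: eq_Rintegral => x _; rewrite mulJ_Re.
Qed.

Lemma L2sec k : isL2 leb2 Q k ->
  [/\ {ae leb, forall x, H x -> L2 (fun y => k (x, y))},
      leb.-integrable H (EFin \o (fun x => n1 (fun y => k (x, y)))) &
      n2 k = Rintegral leb H (fun x => n1 (fun y => k (x, y)))].
Proof.
move=> k2; have [mk1 mk2] := L2_cm k2.
have [a b c] := @fubini_real _ _ RR RR R leb leb H H mH mH _ (L2_int k2).
split.
- apply: (aeS _ a) => x + Hx => /(_ Hx) h; apply: int_L2 => //.
  by split; [exact: (section_meas mH mH mk1)|exact: (section_meas mH mH mk2)].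
- by apply: eq_integrable b => //; [exact: mH|move=> x _ /=; rewrite nqR].
- by rewrite nqR c; apply: eq_Rintegral => x _; rewrite nqR.
Qed.

Definition Kop k : op R := fun f x => cintegral leb H (fun y => k (x, y) * f y).

Lemma Kop_cm k f : @cmeasurable _ (RR * RR)%type R Q k -> @cmeasurable _ RR R H f -> @cmeasurable _ RR R H (Kop k f).
Proof.
move=> mk mf; apply: (@cI_meas _ _ RR RR R leb H H mH mH (fun p => k p * f p.2)).
apply: cmM => //; case: mf => f1 f2.
by split; [exact: (meas_snd mH f1)|exact: (meas_snd mH f2)].
Qed.

Lemma Kop_ip k f x : Kop k f x = i1 (fun y => k (x, y)) (fun y => (f y)^*).
Proof. by rewrite ipE; apply: cI_ext => y _; rewrite conjcK. Qed.

Lemma n1J f : n1 (fun y => (f y)^*) = n1 f.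
Proof. by rewrite !nqR; apply: eq_Rintegral => y _; rewrite normcJ2. Qed.

(** The order of the quantifiers matters: the exceptional null set depends on [k] only, since
    Cauchy-Schwarz applies to every [f] as soon as the section of [k] is square integrable. *)
Lemma Kop_sec k : isL2 leb2 Q k ->
  {ae leb, forall x, H x -> forall f, L2 f ->
    cintegrable leb H (fun y => k (x, y) * f y) /\
    Normc.normc (Kop k f x) ^+ 2 <= n1 (fun y => k (x, y)) * n1 f}.
Proof.
move=> /L2sec[a _ _]; apply: (aeS _ a) => x + Hx f f2 => /(_ Hx) kx2.
split; first exact: (L2M_ci mH kx2 f2).
rewrite Kop_ip -(n1J f); apply: (CS mH kx2); exact: (L2J mH f2).
Qed.

(** The pointwise Cauchy-Schwarz bound is integrated over [x]: the Hilbert-Schmidt norm dominates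
    the operator norm. *)
Lemma Kop_bound k f : isL2 leb2 Q k -> L2 f ->
  L2 (Kop k f) /\ n1 (Kop k f) <= n2 k * n1 f.
Proof.
move=> k2 f2; have mKf := Kop_cm (L2_cm k2) (L2_cm f2).
have [_ b c] := L2sec k2.
have bf : leb.-integrable H (EFin \o (fun x => n1 f * n1 (fun y => k (x, y)))).
  exact: (intZ mH).
have le : (\int[leb]_(x in H) (Normc.normc (Kop k f x) ^+ 2)%:E <=
   \int[leb]_(x in H) (n1 f * n1 (fun y => k (x, y)))%:E)%E.
  apply: ae_ge0_le_integral => //.
  - exact: mH.
  - by move=> x _; rewrite lee_fin sqr_ge0.
  - by apply/measurable_EFinP; exact: (cm_normc mKf).
  - by move=> x _; rewrite lee_fin mulr_ge0// nq_ge0.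
  - exact: measurable_int bf.
  - apply: (aeS _ (Kop_sec k2)) => x h Hx; rewrite lee_fin mulrC.
    by have [] := h Hx f f2.
have eqI : (\int[leb]_(x in H) (n1 f * n1 (fun y => k (x, y)))%:E = (n2 k * n1 f)%:E)%E.
  rewrite c mulrC -(RintegralZl _ mH b) /Rintegral fineK//.
  exact: (integrable_fin_num mH bf).
have K2 : L2 (Kop k f).
  by split => //; rewrite (le_lt_trans le)// eqI ltry.
by split => //; rewrite -lee_fin -(nqE mH K2) -eqI.
Qed.

Lemma Kop_linf k (a : R[i]) f g : isL2 leb2 Q k -> L2 f -> L2 g ->
  L2eq (Kop k (fun x => a * f x + g x)) (fun x => a * Kop k f x + Kop k g x).
Proof.
move=> k2 f2 g2; apply: (aeS _ (Kop_sec k2)) => x h Hx.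
have [kf _] := h Hx f f2; have [kg _] := h Hx g g2.
rewrite /Kop -(cIZ mH)// -(cID mH)//; last exact: ciZ mH _ _ kf.
by apply: cI_ext => y _; ring.
Qed.

Lemma Kop_link k l (a : R[i]) f : isL2 leb2 Q k -> isL2 leb2 Q l -> L2 f ->
  L2eq (Kop (fun p => a * k p + l p) f) (fun x => a * Kop k f x + Kop l f x).
Proof.
move=> k2 l2 f2; apply: (aeS2 _ (Kop_sec k2) (Kop_sec l2)) => x h h' Hx.
have [kf _] := h Hx f f2; have [kg _] := h' Hx f f2.
rewrite /Kop -(cIZ mH)// -(cID mH)//; last exact: ciZ mH _ _ kf.
by apply: cI_ext => y _; ring.
Qed.

Lemma L2eq_refl f : L2eq f f. Proof. exact: aeW. Qed.
Lemma L2eq_sym f g : L2eq f g -> L2eq g f.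
Proof. by apply: aeS => x h Hx; rewrite h. Qed.
Lemma L2eq_trans f g h : L2eq f g -> L2eq g h -> L2eq f h.
Proof. by apply: aeS2 => x h1 h2 Hx; rewrite h1// h2. Qed.

(** For a square-integrable kernel the convergence of the defining integrals is automatic, so
    [L2kernel] reduces to agreement with [Kop k]. *)
Lemma L2kernelP (A : op R) k : L2kernel A k <->
  isL2 leb2 Q k /\ forall f, L2 f -> L2eq (A f) (Kop k f).
Proof.
split=> [[k2 [mk h]]|[k2 h]]; split => //.
  by move=> f /h; apply: aeS => x + Hx => /(_ Hx)[].
split; first exact: L2_cm k2.
move=> f f2; apply: (aeS2 _ (h f f2) (Kop_sec k2)) => x hf hk Hx.
by split; [exact: (hk Hx f f2).1|exact: hf].
Qed.

Definition kadj k : R * R -> R[i] := fun p => (k (p.2, p.1))^*.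

Lemma L2kadj k : isL2 leb2 Q k -> isL2 leb2 Q (kadj k).
Proof.
move=> k2; have : isL2 leb2 Q (k \o (fun p : RR * RR => (p.2, p.1))).
  rewrite (_ : Q = (fun p : RR * RR => (p.2, p.1)) @^-1` Q).
    exact: (mpres_L2 (@mpres_swap2 R) mQ k2).
  by apply/seteqP; split => p [].
exact: (L2J mQ).
Qed.

Lemma i2kadj k l : isL2 leb2 Q k -> isL2 leb2 Q l -> i2 (kadj l) (kadj k) = i2 k l.
Proof.
move=> k2 l2; rewrite -(mpres_ip (@mpres_swap2 R) mQ (L2_cm k2) (L2_cm l2)).
rewrite (_ : _ @^-1` Q = Q); last by apply/seteqP; split => p [].
by rewrite !ipE; apply: cI_ext => p _; rewrite /kadj /= conjcK mulrC.
Qed.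

Lemma L2tensor f g : L2 f -> L2 g -> isL2 leb2 Q (fun p => f p.1 * g p.2) /\
  n2 (fun p => f p.1 * g p.2) = n1 f * n1 g.
Proof.
move=> f2 g2.
have cr d (T : measurableType d) (mu : {measure set T -> \bar R}) D (u : T -> R) :
    mu.-integrable D (EFin \o u) -> measurable D -> cintegrable mu D (fun x => (u x)%:C).
  by move=> ui mD; split => //; exact: integrable0.
have ci := @ci_tensor _ _ RR RR R leb leb H H mH mH _ _
   (cr _ _ _ _ _ (L2_int f2) mH) (cr _ _ _ _ _ (L2_int g2) mH).
have mfg : cmeasurable Q (fun p : RR * RR => f p.1 * g p.2).
  case: (L2_cm f2) => a b; case: (L2_cm g2) => a' b'.
  have mf : @cmeasurable _ (RR * RR)%type R Q (fun p => f p.1).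
    by split; [exact: (meas_fst (B := H) mH a)|exact: (meas_fst (B := H) mH b)].
  have mg : @cmeasurable _ (RR * RR)%type R Q (fun p => g p.2).
    by split; [exact: (meas_snd (A := H) mH a')|exact: (meas_snd (A := H) mH b')].
  exact: cmM.
have I2 : leb2.-integrable Q (EFin \o (fun p => Normc.normc (f p.1 * g p.2) ^+ 2)).
  by apply: eq_integrable ci.1 => //; [exact: mQ|move=> p _ /=; rewrite Normc.normcM exprMn mulr0 subr0].
split; first exact: int_L2.
have [_ _ c] := @fubini_real _ _ RR RR R leb leb H H mH mH _ I2.
have ef : n1 f = Rintegral leb H (fun x => Normc.normc (f x) ^+ 2) by exact: nqR.
have eg : n1 g = Rintegral leb H (fun x => Normc.normc (g x) ^+ 2) by exact: nqR.
rewrite nqR c ef -(RintegralZr _ mH (L2_int f2)); apply: eq_Rintegral => x _.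
rewrite eg -(RintegralZl _ mH (L2_int g2)); apply: eq_Rintegral => y _.
by rewrite Normc.normcM exprMn.
Qed.

(** Fubini in both orders; joint integrability holds because [k] is paired with a tensor that is
    itself in L^2. *)
Lemma Kop_adj k f g : isL2 leb2 Q k -> L2 f -> L2 g ->
  i1 (Kop k f) g = i1 f (Kop (kadj k) g).
Proof.
move=> k2 f2 g2.
have [t2 _] := L2tensor (L2J mH g2) f2.
have ci : cintegrable leb2 Q (fun p => k p * ((g p.1)^* * f p.2)) by exact: (L2M_ci mQ).
have [_ _ c] := @fubini_C _ _ RR RR R leb leb H H mH mH _ ci.
have ci' : cintegrable leb2 Q (fun p => k (p.2, p.1) * ((g p.2)^* * f p.1)).
  have := mpres_ci (@mpres_swap2 R) mQ ci.
  by rewrite (_ : _ @^-1` Q = Q)//; apply/seteqP; split => p [].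
have [_ _ c'] := @fubini_C _ _ RR RR R leb leb H H mH mH _ ci'.
transitivity (cintegral leb2 Q (fun p => k p * ((g p.1)^* * f p.2))).
  rewrite c ipE; apply: (cI_ae mH).
  - by apply: cmM; [exact: Kop_cm (L2_cm k2) (L2_cm f2)|apply: cmJ; exact: L2_cm g2].
  - by apply: (@cI_meas _ _ RR RR R leb H H mH mH (fun p => k p * ((g p.1)^* * f p.2))); exact: ci_cm ci.
  - apply: (aeS _ (Kop_sec k2)) => x h Hx; have [kf _] := h Hx f f2.
    rewrite mulrC -(cIZ mH)//; apply: cI_ext => y _; ring.
transitivity (cintegral leb2 Q (fun p => k (p.2, p.1) * ((g p.2)^* * f p.1))).
  rewrite -(mpres_cI (@mpres_swap2 R) mQ (ci_cm ci)).
  by rewrite (_ : _ @^-1` Q = Q)//; apply/seteqP; split => p [].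
rewrite c' ipE; apply: (cI_ae mH).
- by apply: (@cI_meas _ _ RR RR R leb H H mH mH (fun p => k (p.2, p.1) * ((g p.2)^* * f p.1))); exact: ci_cm ci'.
- by apply: cmM; [exact: L2_cm f2|apply: cmJ; exact: Kop_cm (L2_cm (L2kadj k2)) (L2_cm g2)].
- apply: (aeS _ (Kop_sec (L2kadj k2))) => x h Hx; have [kf _] := h Hx g g2.
  rewrite -(cIJ mH kf) -(cIZ mH); last exact: (ciJ mH kf).
  by apply: cI_ext => y _; rewrite /kadj rmorphM/= conjcK; ring.
Qed.

Section Onb.
Variables (e : nat -> R -> R[i]) (eb : is_onb e).

Let e2 n : L2 (e n). Proof. by case: eb. Qed.
Let eo m n : i1 (e m) (e n) = (m == n)%:R. Proof. by case: eb => _ + _; apply. Qed.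
Let et f : L2 f -> (forall n, i1 f (e n) = 0) -> aeeq leb H f (fun=> 0).
Proof. by case: eb => _ _; apply. Qed.

Lemma onb_parseval f : L2 f ->
  \sum_(i < n) Normc.normc (i1 f (e i)) ^+ 2 @[n --> \oo] --> n1 f.
Proof. exact: (parseval mH e2 eo et). Qed.

Lemma onb_expand f : L2 f ->
  n1 (fun x => f x - proj leb H e f n x) @[n --> \oo] --> (0 : R).
Proof. exact: (parseval_cvg mH e2 eo et). Qed.

Lemma onb_bessel f n : L2 f ->
  \sum_(i < n) Normc.normc (i1 f (e i)) ^+ 2 <= n1 f.
Proof. by move=> f2; rewrite -subr_ge0 -(bessel mH e2 eo)// nq_ge0. Qed.

Lemma Kop_ipJ k f x : L2 (fun y => k (x, y)) -> L2 f ->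
  Kop k f x = (i1 (fun y => (k (x, y))^*) f)^*.
Proof.
move=> k2 f2; have ci := L2M_ci mH k2 f2.
by rewrite ipE -(conjcK (Kop k f x)) /Kop -(cIJ mH ci); congr (_^*);
  apply: cI_ext => y _; rewrite rmorphM.
Qed.

(** For almost every [x], Parseval is applied to the conjugate of [y |-> k (x, y)]. The partial sums
    are dominated by the squared norm of the section, which is integrable in [x]. *)
Lemma Kop_parseval k : isL2 leb2 Q k ->
  \sum_(i < n) n1 (Kop k (e i)) @[n --> \oo] --> n2 k.
Proof.
move=> k2; have [a b c] := L2sec k2.
pose F n x : \bar R := (\sum_(i < n) Normc.normc (Kop k (e i) x) ^+ 2)%:E.
have mF n : measurable_fun H (F n : RR -> _).
  apply/measurable_EFinP.
  apply: (@measurable_sum _ RR R H _ (index_enum 'I_n) (fun (i : 'I_n) x => Normc.normc (Kop k (e i) x) ^+ 2)) => i.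
  by apply: cm_normc; exact: Kop_cm (L2_cm k2) (L2_cm (e2 i)).
have := @dominated_convergence _ RR R leb H mH F
  (EFin \o (fun x => n1 (fun y => k (x, y)))) (EFin \o (fun x => n1 (fun y => k (x, y)))) mF.
move=> []//.
- exact: measurable_int b.
- apply: (aeS _ a) => x + Hx => /(_ Hx) kx2.
  have := onb_parseval (L2J mH kx2); rewrite n1J => hc.
  rewrite (_ : (fun n => F n x) = EFin \o (fun n => \sum_(i < n) Normc.normc (i1 (fun y => (k (x, y))^*) (e i)) ^+ 2)).
    by apply: cvg_EFin => //; exact: nearW.
  apply/funext => n; rewrite /F /=; congr EFin; apply: eq_bigr => i _.
  by rewrite Kop_ipJ// normcJ2.
- apply: (aeS _ a) => x h n Hx; have kx2 := h Hx.
  rewrite /F /= lee_fin ger0_norm; last by apply: sumr_ge0 => i _; exact: sqr_ge0.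
  rewrite -n1J (eq_bigr (fun i : 'I_n => Normc.normc (i1 (fun y => (k (x, y))^*) (e i)) ^+ 2)).
    by apply: onb_bessel; exact: (L2J mH).
  by move=> i _; rewrite Kop_ipJ// normcJ2.
move=> _ _ h.
have : (\sum_(i < n) n1 (Kop k (e i)))%:E @[n --> \oo] --> (n2 k)%:E.
  rewrite c /Rintegral fineK; last exact: (integrable_fin_num mH b).
  apply: cvg_trans h; apply: near_eq_cvg; apply: nearW => n /=.
  rewrite /F; under eq_integral do rewrite -sumEFin.
  rewrite ge0_integral_sum//.
  - rewrite -sumEFin; apply: eq_bigr => i _; rewrite (nqE mH)//.
    exact: (Kop_bound k2 (e2 i)).1.
  - exact: mH.
  - move=> i; apply/measurable_EFinP; apply: cm_normc.
    exact: Kop_cm (L2_cm k2) (L2_cm (e2 i)).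
  - by move=> i x _; rewrite lee_fin sqr_ge0.
by move/fine_cvg.
Qed.

End Onb.

End Kernels.

(** * Hilbert-Schmidt operators, their kernels and their inner product *)

Section HilbertSchmidt.
Variable R : realType.
Notation leb := (@lebesgue_measure R).
Notation leb2 := (@leb2 R).
Notation RR := (measurableTypeR R).
Notation H := (@halfline R).
Notation Q := (@quadrant R).
Notation n1 := (nq leb H).
Notation i1 := (ip leb H).
Notation n2 := (nq leb2 Q).
Notation i2 := (ip leb2 Q).
Notation mH := (@m_half R).
Notation mQ := (@m_quad R).
Implicit Types (f g : R -> R[i]) (k l : R * R -> R[i]) (e : nat -> R -> R[i]).

Lemma n1_ext f g : (forall x, H x -> f x = g x) -> n1 f = n1 g.
Proof. exact: (@nq_ext _ RR R leb H f g). Qed.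

Lemma n2_ext k l : (forall p, Q p -> k p = l p) -> n2 k = n2 l.
Proof. exact: (@nq_ext _ (RR * RR)%type R leb2 Q k l). Qed.

Lemma L2_lin (a : R[i]) f g : L2 f -> L2 g -> L2 (fun x => a * f x + g x).
Proof. by move=> f2 g2; apply: (L2D mH) => //; exact: (L2Z mH). Qed.

Lemma L2k_lin (a : R[i]) k l : isL2 leb2 Q k -> isL2 leb2 Q l ->
  isL2 leb2 Q (fun p => a * k p + l p).
Proof. by move=> f2 g2; apply: (L2D mQ) => //; exact: (L2Z mQ). Qed.

Lemma L2z : L2 (fun=> 0 : R[i]). Proof. exact: (@L2_0 _ RR R leb H mH). Qed.

Lemma innerE f g : inner f g = i1 f g.
Proof. by rewrite ipE. Qed.

Lemma L2normE f : L2norm f = Num.sqrt (n1 f).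
Proof. by rewrite nq_ip -innerE. Qed.

Lemma L2norm2 f : L2norm f ^+ 2 = n1 f.
Proof. by rewrite L2normE sqr_sqrtr// nq_ge0. Qed.

Lemma bounded_nq (A : op R) : bounded_op A ->
  exists2 M, 0 <= M & forall f, L2 f -> n1 (A f) <= M * n1 f.
Proof.
move=> [_ _ [M hM]]; exists (M ^+ 2); first exact: sqr_ge0.
move=> f f2; rewrite -!L2norm2 -exprMn.
have h := hM f f2; rewrite ler_sqr// nnegrE.
  by rewrite L2normE sqrtr_ge0.
by apply: le_trans h; rewrite L2normE sqrtr_ge0.
Qed.

Lemma nq_bounded (A : op R) M : (forall f, L2 f -> L2 (A f)) ->
  (forall (a : R[i]) f g, L2 f -> L2 g ->
        L2eq (A (fun x => a * f x + g x)) (fun x => a * A f x + A g x)) ->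
  0 <= M -> (forall f, L2 f -> n1 (A f) <= M * n1 f) -> bounded_op A.
Proof.
move=> A2 Al M0 hM; split=> //; exists (Num.sqrt M) => f f2.
by rewrite !L2normE -sqrtrM// ler_wsqrtr// hM.
Qed.

Lemma L2eq_nq f g : L2 f -> L2 g -> L2eq f g <-> n1 (fun x => f x - g x) = 0.
Proof.
move=> f2 g2; have fg2 := L2B mH f2 g2; split=> h.
  by apply: (ae_nq0 mH fg2); apply: (aeS _ h) => x hx Hx; rewrite hx// subrr.
apply: (aeS _ (nq0_ae mH fg2 h)) => x hx Hx.
by apply/eqP; rewrite -subr_eq0 hx.
Qed.

(** Operators act on functions rather than on classes, so this needs an argument: [g - f] has norm
    0, hence so has its image, which by linearity is [A g - A f]. *)
Lemma bounded_ae (A : op R) f g : bounded_op A -> L2 f -> L2 g -> L2eq f g ->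
  L2eq (A f) (A g).
Proof.
move=> bA f2 g2 fg; have [M M0 hM] := bounded_nq bA; case: bA => A2 Al _.
pose h x := -1 * f x + g x.
have h2 : L2 h by exact: L2_lin.
have h0 : n1 h = 0.
  by apply: (ae_nq0 mH h2); apply: (aeS _ fg) => x hx Hx; rewrite /h hx// mulN1r addNr.
have Ah0 : n1 (A h) = 0.
  by apply/eqP; rewrite eq_le nq_ge0 andbT (le_trans (hM h h2))// h0 mulr0.
apply: (aeS2 _ (Al (-1) f g f2 g2) (nq0_ae mH (A2 h h2) Ah0)) => x e1 e2 Hx.
by have := e2 Hx; rewrite /h e1// mulN1r addrC => /eqP; rewrite subr_eq0 => /eqP.
Qed.

Lemma bounded_comp (A B : op R) : bounded_op A -> bounded_op B -> bounded_op (op_comp A B).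
Proof.
move=> bA bB; have [M M0 hM] := bounded_nq bA; have [N N0 hN] := bounded_nq bB.
have [A2 Al _] := bA; have [B2 Bl _] := bB.
apply: (@nq_bounded _ (M * N)) => [f f2|a f g f2 g2||f f2].
- exact/A2/B2.
- apply: L2eq_trans (Al a _ _ (B2 f f2) (B2 g g2)); rewrite /op_comp.
  apply: bounded_ae => //.
  + exact: B2 (L2_lin _ f2 g2).
  + exact: L2_lin (B2 _ f2) (B2 _ g2).
  + exact: Bl.
- exact: mulr_ge0.
- by rewrite (le_trans (hM _ (B2 f f2)))// -mulrA ler_wpM2l// hN.
Qed.

Lemma bounded_lin (a : R[i]) (A B : op R) : bounded_op A -> bounded_op B ->
  bounded_op (op_add (op_scale a A) B).
Proof.
move=> bA bB; have [M M0 hM] := bounded_nq bA; have [N N0 hN] := bounded_nq bB.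
have [A2 Al _] := bA; have [B2 Bl _] := bB.
have S2 f : L2 f -> L2 (fun x => a * A f x + B f x).
  by move=> f2; exact: L2_lin (A2 _ f2) (B2 _ f2).
apply: (@nq_bounded _ (2 * (Normc.normc a ^+ 2 * M) + 2 * N)) => //.
- move=> b f g f2 g2; apply: (aeS2 _ (Al b f g f2 g2) (Bl b f g f2 g2)) => x e1 e2 Hx.
  by rewrite /op_add /op_scale e1// e2//; ring.
- by apply: addr_ge0; apply: mulr_ge0 => //; apply: mulr_ge0 => //; exact: sqr_ge0.
- move=> f f2; apply: le_trans (nqD_le mH (L2Z mH a (A2 f f2)) (B2 f f2)) _.
  rewrite (nqZ mH)//; last exact: A2.
  rewrite [leRHS]mulrDl -!mulrA; apply: lerD; rewrite ler_wpM2l// ?hN//.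
  by rewrite !ler_wpM2l ?normc_ge0// hM.
Qed.

Lemma bounded_sub (A B : op R) : bounded_op A -> bounded_op B ->
  bounded_op (op_sub A B).
Proof.
move=> bA bB; have := bounded_lin (-1) bB bA.
by rewrite (_ : op_add _ _ = op_sub A B)//; apply/funext => f; apply/funext => x;
  rewrite /op_add /op_scale /op_sub mulN1r addrC.
Qed.

Lemma bounded_scale (a : R[i]) (A : op R) : bounded_op A -> bounded_op (op_scale a A).
Proof.
move=> bA; have := bounded_lin (a - 1) bA bA.
by rewrite (_ : op_add _ _ = op_scale a A)//; apply/funext => f; apply/funext => x;
  rewrite /op_add /op_scale; ring.
Qed.

Lemma bounded_Kop k : isL2 leb2 Q k -> bounded_op (Kop k).
Proof.
move=> k2; apply: (@nq_bounded _ (n2 k)).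
- by move=> f f2; exact: (Kop_bound k2 f2).1.
- by move=> a f g f2 g2; exact: Kop_linf.
- exact: nq_ge0.
- by move=> f f2; exact: (Kop_bound k2 f2).2.
Qed.

Lemma adjoint_Kop (A : op R) k : (forall f, L2 f -> L2 (A f)) -> L2kernel A k ->
  is_adjoint A (Kop (kadj k)).
Proof.
move=> A2 /L2kernelP[k2 Ak]; split; first exact/bounded_Kop/L2kadj.
move=> f g f2 g2; rewrite !innerE -Kop_adj//.
by apply: (ip_ael mH) => //; [exact: A2|exact: (Kop_bound k2 f2).1|exact: Ak].
Qed.

(** Once one adjoint exists, the chosen [adj A] is a genuine one. Uniqueness comes from pairing with
    the difference [adj A g - B g] itself. *)
Lemma adjP (A B : op R) : is_adjoint A B ->
  is_adjoint A (adj A) /\ forall g, L2 g -> L2eq (adj A g) (B g).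
Proof.
move=> AB; have AA : is_adjoint A (adj A).
  by rewrite /adj; case: xgetP => [C _ //|/(_ B)]; exact.
split=> // g g2; have [[B2 _ _] hB] := AB; have [[C2 _ _] hC] := AA.
apply/L2eq_nq; [exact: C2|exact: B2|].
have d2 := L2B mH (C2 g g2) (B2 g g2).
rewrite nq_ip (ipBr mH (C2 g g2) (B2 g g2) d2).
have : forall f, L2 f -> L2 (A f) -> i1 f (adj A g) = i1 f (B g).
  by move=> f f2 _; rewrite -!innerE -hC// hB.
move=> h; rewrite -!innerE -hC// hB// subrr.
by [].
Qed.

(** The basis used by [trace] is a genuine one as soon as some basis is known. *)
Lemma onbP e : is_onb e -> is_onb (@onb R).
Proof. by move=> eb; rewrite /onb; case: xgetP => [C _ //|/(_ e)]; exact. Qed.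

Lemma Kop_Z (a : R[i]) k f : isL2 leb2 Q k -> L2 f ->
  L2eq (Kop (fun p => a * k p) f) (fun x => a * Kop k f x).
Proof.
move=> k2 f2; apply: (aeS _ (Kop_sec k2)) => x h Hx; have [kf _] := h Hx f f2.
by rewrite /Kop -(cIZ mH)//; apply: cI_ext => y _; rewrite mulrA.
Qed.

Lemma L2eq_n1 f g : L2 f -> L2 g -> L2eq f g -> n1 f = n1 g.
Proof. exact: (nq_ae mH). Qed.

Lemma half_polar (x y z : R) : z = 2^-1 * (x + y + 2 * z - x - y).
Proof. by field. Qed.

(** Polarization of [Kop_parseval]. Only real parts are treated; imaginary parts are recovered by
    multiplying the second argument by the imaginary unit. *)
Lemma Kop_polar e u v : is_onb e -> isL2 leb2 Q u -> isL2 leb2 Q v ->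
  \sum_(i < n) ReC (i1 (Kop u (e i)) (Kop v (e i))) @[n --> \oo] --> ReC (i2 u v).
Proof.
move=> eb u2 v2; have e2 n : L2 (e n) by case: eb.
have w2 : isL2 leb2 Q (fun p => 1 * u p + v p) by exact: L2k_lin.
have E i : ReC (i1 (Kop u (e i)) (Kop v (e i))) = 2^-1 *
   (n1 (Kop (fun p => 1 * u p + v p) (e i)) - n1 (Kop u (e i)) - n1 (Kop v (e i))).
  have a2 := (Kop_bound u2 (e2 i)).1; have b2 := (Kop_bound v2 (e2 i)).1.
  rewrite (L2eq_n1 (Kop_bound w2 (e2 i)).1 _ (Kop_link 1 u2 v2 (e2 i))); last exact: L2_lin.
  rewrite (@n1_ext _ (fun x => Kop u (e i) x + Kop v (e i) x)); last first.
    by move=> x _; rewrite mul1r.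
  by rewrite (nqD mH a2 b2); exact: half_polar.
have -> : ReC (i2 u v) = 2^-1 * (n2 (fun p => 1 * u p + v p) - n2 u - n2 v).
  rewrite (@n2_ext _ (fun x => u x + v x)); last first.
    by move=> x _; rewrite mul1r.
  by rewrite (nqD mQ u2 v2); exact: half_polar.
rewrite (_ : (fun n => _) = fun n => 2^-1 * (\sum_(i < n) n1 (Kop (fun p => 1 * u p + v p) (e i))
   - \sum_(i < n) n1 (Kop u (e i)) - \sum_(i < n) n1 (Kop v (e i)))); last first.
  by apply/funext => n; rewrite -!sumrB mulr_sumr; apply: eq_bigr => i _; exact: E.
by apply: cvgMr; apply: cvgB; [apply: cvgB|]; exact: Kop_parseval.
Qed.

Lemma Im_ip d (T : measurableType d) (mu : {measure set T -> \bar R}) D (a b : T -> R[i]) :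
  measurable D -> isL2 mu D a -> isL2 mu D b ->
  ImC (ip mu D a b) = ReC (ip mu D a (fun x => (0 +i* 1) * b x)).
Proof. by move=> mD a2 b2; rewrite (ipZr mD)// !CE /=; ring. Qed.

(** Writing [<A B^* e_i, e_i> = <B^* e_i, A^* e_i>] avoids computing the kernel of a composition.
    Polarized Parseval gives the inner product of the adjoint kernels, and passing to adjoints
    exchanges the two arguments. *)
Lemma HSinnerE e (A B : op R) k l : is_onb e ->
  (forall f, L2 f -> L2 (A f)) -> L2kernel A k ->
  (forall f, L2 f -> L2 (B f)) -> L2kernel B l -> HSinner A B = i2 k l.
Proof.
move=> /onbP eb A2 Ak B2 Bl.
have e2 n : L2 (onb n : R -> R[i]) by case: eb => h _ _; exact: h.
have [_ hA] := adjoint_Kop A2 Ak.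
have [[[aB2 _ _] _] aBE] := adjP (adjoint_Kop B2 Bl).
have [k2 _] := (L2kernelP _ _).1 Ak; have [l2 _] := (L2kernelP _ _).1 Bl.
have ak2 := L2kadj k2; have al2 := L2kadj l2.
have E i : inner (op_comp A (adj B) (onb i)) (onb i) =
    i1 (Kop (kadj l) (onb i)) (Kop (kadj k) (onb i)).
  rewrite /op_comp hA//; last exact: aB2.
  rewrite innerE; apply: (ip_ael mH).
  - exact: aB2.
  - exact: (Kop_bound ak2 (e2 i)).1.
  - exact: (Kop_bound al2 (e2 i)).1.
  - exact: aBE.
rewrite -(i2kadj k2 l2) /HSinner /trace.
have hR : limn (fun n => \sum_(i < n) ReC (inner (op_comp A (adj B) (onb i)) (onb i))) =
    ReC (i2 (kadj l) (kadj k)).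
  apply: cvg_lim => //; rewrite (_ : (fun n => _) = fun n => \sum_(i < n)
      ReC (i1 (Kop (kadj l) (onb i)) (Kop (kadj k) (onb i)))); first exact: Kop_polar.
  by apply/funext => n; apply: eq_bigr => i _; rewrite E.
have hI : limn (fun n => \sum_(i < n) ImC (inner (op_comp A (adj B) (onb i)) (onb i))) =
    ImC (i2 (kadj l) (kadj k)).
  apply: cvg_lim => //; rewrite (_ : (fun n => _) = fun n => \sum_(i < n)
      ReC (i1 (Kop (kadj l) (onb i)) (Kop (fun p => (0 +i* 1) * kadj k p) (onb i)))).
    by rewrite (Im_ip mQ)//; apply: Kop_polar => //; exact: (L2Z mQ _ ak2).
  apply/funext => n; apply: eq_bigr => i _; rewrite E (Im_ip mH); last 2 first.
  - exact: (Kop_bound al2 (e2 i)).1.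
  - exact: (Kop_bound ak2 (e2 i)).1.
  congr ReC; apply: (ip_aer mH).
  - exact: (L2Z mH _ (Kop_bound ak2 (e2 i)).1).
  - exact: (Kop_bound al2 (e2 i)).1.
  - exact: (Kop_bound (L2Z mQ _ ak2) (e2 i)).1.
  - by apply: L2eq_sym; exact: Kop_Z.
by rewrite hR hI; case: (i2 _ _).
Qed.

Lemma HSnormE e (A : op R) k : is_onb e -> (forall f, L2 f -> L2 (A f)) ->
  L2kernel A k -> HSnorm A = Num.sqrt (n2 k).
Proof. by move=> eb A2 Ak; rewrite /HSnorm (HSinnerE eb A2 Ak A2 Ak) -nq_ip. Qed.

Lemma kernel_partial_sum e k n : is_onb e -> isL2 leb2 Q k ->
  \sum_(i < n) n1 (Kop k (e i)) <= n2 k.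
Proof.
move=> eb k2; have kc := Kop_parseval eb k2.
rewrite -(cvg_lim _ kc)//.
apply: (@nondecreasing_cvgn_le _ (fun n => \sum_(i < n) n1 (Kop k (e i)))).
  by apply/nondecreasing_seqP => m; rewrite big_ord_recr lerDl nq_ge0.
by apply/cvg_ex; exists (n2 k).
Qed.

Lemma kernel_HS e (A : op R) k : is_onb e -> bounded_op A -> L2kernel A k -> HS A.
Proof.
move=> eb bA /L2kernelP[k2 Ak]; split=> //; exists e => //.
have e2 n : L2 (e n) by case: eb.
apply: (@le_lt_trans _ _ (n2 k)%:E); last exact: ltry.
apply: lime_le; first by apply: is_cvg_nneseries => n _ _; rewrite lee_fin sqr_ge0.
apply: nearW => n; rewrite sumEFin lee_fin big_mkord.
apply: le_trans (kernel_partial_sum n eb k2).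
apply: ler_sum => i _; rewrite L2norm2 (L2eq_n1 _ _ (Ak (e i) (e2 i)))//.
  by case: bA => + _ _; apply.
exact: (Kop_bound k2 (e2 i)).1.
Qed.

(** The operator of the difference kernel annihilates a basis, so by Parseval that kernel has norm
    0. *)
Lemma kernel_unique e (A : op R) k l : is_onb e -> L2kernel A k -> L2kernel A l ->
  aeeq leb2 Q k l.
Proof.
move=> eb /L2kernelP[k2 Ak] /L2kernelP[l2 Al]; have e2 n : L2 (e n) by case: eb.
pose m p := -1 * l p + k p.
have m2 : isL2 leb2 Q m by exact: L2k_lin.
have m0 i : n1 (Kop m (e i)) = 0.
  apply: (ae_nq0 mH); first exact: (Kop_bound m2 (e2 i)).1.
  have lk := L2eq_trans (L2eq_sym (Al _ (e2 i))) (Ak _ (e2 i)).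
  apply: (aeS2 _ (Kop_link (-1) l2 k2 (e2 i)) lk) => x e1 h Hx.
  by rewrite e1// h// mulN1r addNr.
have := Kop_parseval eb m2; rewrite (_ : (fun n => _) = fun=> 0); last first.
  by apply/funext => n; rewrite big1.
move/cvg_lim => h; have n0 : n2 m = 0 by rewrite -h// lim_cst.
apply: (aeS _ (nq0_ae mQ m2 n0)) => p hp Hp; apply/eqP; rewrite -subr_eq0.
by rewrite -(hp Hp) /m mulN1r addrC.
Qed.

Lemma ip_tensor f g f' g' : L2 f -> L2 g -> L2 f' -> L2 g' ->
  i2 (fun p => f p.1 * g p.2) (fun p => f' p.1 * g' p.2) = i1 f f' * i1 g g'.
Proof.
move=> f2 g2 f2' g2'.
have ci := L2MJ_ci mQ (L2tensor f2 g2).1 (L2tensor f2' g2').1.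
have [_ _ c] := @fubini_C _ _ RR RR R leb leb H H mH mH _ ci.
rewrite ipE c !ipE mulrC -(cIZ mH); last exact: (L2MJ_ci mH f2 f2').
apply: cI_ext => x _; rewrite mulrC -(cIZ mH); last exact: (L2MJ_ci mH g2 g2').
by apply: cI_ext => y _ /=; rewrite rmorphM/=; ring.
Qed.

Lemma bounded_sum (A : op R) n (c : nat -> R[i]) (e : nat -> R -> R[i]) : bounded_op A ->
  (forall i, L2 (e i)) ->
  L2eq (A (fun x => \sum_(i < n) c i * e i x)) (fun x => \sum_(i < n) c i * A (e i) x).
Proof.
move=> bA e2; have [A2 Al _] := bA.
have s2 m : L2 (fun x => \sum_(i < m) c i * e i x).
  by apply: (@L2_sum _ _ _ _ _ mH m (fun i x => c i * e i x)) => i; exact: (L2Z mH (c i) (e2 i)).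
elim: n => [|n IH].
  have z2 := L2z.
  apply: L2eq_trans (_ : L2eq (A (fun=> 0)) _).
    by apply: bounded_ae => //; apply: aeW => x _; rewrite big_ord0.
  apply: (aeS2 _ (Al (-1) _ _ z2 z2) (bounded_ae bA z2 _ _ :
     L2eq (A (fun=> 0)) (A (fun x => -1 * 0 + 0)))) => [x e1 e3 Hx||].
  - by rewrite big_ord0 e3// e1// mulN1r addNr.
  - exact: L2_lin.
  - by apply: aeW => x _; rewrite mulr0 addr0.
apply: L2eq_trans (_ : L2eq (A (fun x => c n * e n x + \sum_(i < n) c i * e i x)) _).
  apply: bounded_ae => //; first exact: L2_lin.
  by apply: aeW => x _; rewrite big_ord_recr addrC.
apply: (aeS2 _ (Al (c n) _ _ (e2 n) (s2 n)) IH) => x e1 e3 Hx.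
by rewrite e1// e3// big_ord_recr addrC.
Qed.

(** The tensors are mutually orthogonal with squared norms [|A e_n|^2], which are summable, so their
    series converges. The tensors remain in the conclusion because they later reduce the density of
    test functions to that of tensors. *)
Lemma HS_kernel_series (A : op R) : HS A -> exists k (a b : nat -> R -> R[i]),
  [/\ L2kernel A k, forall n, L2 (a n), forall n, L2 (b n) &
    n2 (fun p => \sum_(i < n) a i p.1 * b i p.2 - k p) @[n --> \oo] --> (0 : R)].
Proof.
move=> [bA [e eb eA]]; have e2 n : L2 (e n) by case: eb.
have eo m n : i1 (e m) (e n) = (m == n)%:R by case: eb => _ + _; rewrite -innerE; apply.
have [M M0 hM] := bounded_nq bA; have [A2 Al _] := bA.
pose u n p := A (e n) p.1 * (e n p.2)^*.
have ce2 n : L2 (fun y => (e n y)^*) by exact: (L2J mH (e2 n)).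
have u2 n : isL2 leb2 Q (u n) by exact: (L2tensor (A2 _ (e2 n)) (ce2 n)).1.
have nu n : n2 (u n) = n1 (A (e n)).
  rewrite (L2tensor (A2 _ (e2 n)) (ce2 n)).2 n1J.
  by rewrite [X in _ * X]nq_ip eo eqxx mulr1.
have uo i j : i != j -> i2 (u i) (u j) = 0.
  move=> ij; rewrite (ip_tensor (A2 _ (e2 i)) (ce2 i) (A2 _ (e2 j)) (ce2 j)).
  rewrite (_ : i1 (fun y => (e i y)^*) _ = (i1 (e i) (e j))^*).
    by rewrite eo (negbTE ij) conjc0 mulr0.
  rewrite !ipE -(cIJ mH); last exact: (L2MJ_ci mH (e2 i) (e2 j)).
  by apply: cI_ext => y _; rewrite rmorphM.
have uM n : \sum_(i < n) n2 (u i) <= fine (\sum_(0 <= n <oo) ((L2norm (A (e n))) ^+ 2)%:E)%E.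
  rewrite -lee_fin fineK; last first.
    rewrite ge0_fin_numE//; apply: nneseries_ge0 => i _ _; rewrite lee_fin sqr_ge0//.
  apply: le_trans (@nneseries_lim_ge _ _ xpredT 0%N n _) => [|i _ _]; last by rewrite lee_fin sqr_ge0.
  by rewrite sumEFin big_mkord lee_fin; apply: ler_sum => i _; rewrite L2norm2 nu.
have [k k2 kc] := orth_series mQ u2 uo uM.
exists k, (fun n => A (e n)), (fun n y => (e n y)^*).
split=> // [|n]; last by exact: A2.
apply/L2kernelP; split=> // f f2.
have Kf2 := (Kop_bound k2 f2).1; have Af2 := A2 _ f2.
apply/L2eq_nq => //.
have p2 n : L2 (proj leb H e f n) by exact: (L2_proj mH).
pose S n p := \sum_(i < n) u i p.
have S2 n : isL2 leb2 Q (S n) by exact: (L2_sum mQ n u2).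
(* The partial sum of the series is the kernel of [A] composed with the projection on the first [n]
   basis vectors. Comparing [A f] with [Kop k f] through it leaves two errors, both tending to 0. *)
have KS n : L2eq (A (proj leb H e f n)) (Kop (S n) f).
  apply: L2eq_trans (@bounded_sum A n (fun i => i1 f (e i)) e bA e2) _.
  apply: aeW => x _; rewrite /Kop /S.
  have ci i : cintegrable leb H (fun y => u i (x, y) * f y).
    apply: (ci_ext mH) (ciZ mH (A (e i) x) (L2MJ_ci mH f2 (e2 i))) => y _.
    by rewrite /u /=; ring.
  transitivity (cintegral leb H (fun y => \sum_(i < n) u i (x, y) * f y)).
    rewrite (@cI_sum _ _ _ _ _ mH n (fun i y => u i (x, y) * f y))//.
    apply: eq_bigr => i _; rewrite mulrC ipE -(cIZ mH); last exact: (L2MJ_ci mH f2 (e2 i)).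
    by apply: cI_ext => y _; rewrite /u /=; ring.
  by apply: cI_ext => y _; rewrite mulr_suml.
have bd n : n1 (fun x => A f x - Kop k f x) <=
   2 * (M * n1 (fun x => f x - proj leb H e f n x)) + 2 * (n2 (fun p => S n p - k p) * n1 f).
  have Ap2 := A2 _ (p2 n); have KS2 := (Kop_bound (S2 n) f2).1.
  rewrite (@n1_ext _ (fun x => (A f x - A (proj leb H e f n) x) +
     (A (proj leb H e f n) x - Kop k f x))); last by move=> x _; rewrite addrA subrK.
  apply: le_trans (nqD_le mH (L2B mH Af2 Ap2) (L2B mH Ap2 Kf2)) _.
  apply: lerD; rewrite ler_wpM2l//.
    have fp2 := L2B mH f2 (p2 n).
    rewrite -(L2eq_n1 (A2 _ fp2)) ?hM//; first exact: (L2B mH Af2 Ap2).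
    have q2 : L2 (fun x => -1 * proj leb H e f n x + f x) by exact: L2_lin.
    have E : L2eq (fun x => f x - proj leb H e f n x) (fun x => -1 * proj leb H e f n x + f x).
      by apply: aeW => x _; rewrite mulN1r addrC.
    apply: L2eq_trans (bounded_ae bA fp2 q2 E) _.
    by apply: (aeS _ (Al (-1) _ _ (p2 n) f2)) => x h Hx; rewrite h// mulN1r addrC.
  have d2 : isL2 leb2 Q (fun p => S n p - k p) by exact: (L2B mQ (S2 n) k2).
  rewrite (L2eq_n1 (g := Kop (fun p => S n p - k p) f)).
  - exact: (Kop_bound d2 f2).2.
  - exact: (L2B mH Ap2 Kf2).
  - exact: (Kop_bound d2 f2).1.
  - apply: (aeS2 _ (KS n) (Kop_link (-1) k2 (S2 n) f2)) => x h1 h2 Hx.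
    rewrite h1//; have -> : (fun p => S n p - k p) = (fun p => -1 * k p + S n p).
      by apply/funext => p; rewrite mulN1r addrC.
    by rewrite h2// mulN1r addrC.
apply/eqP; rewrite eq_le nq_ge0 andbT; apply/ler_addgt0Pr => eps eps0; rewrite add0r.
have : (2 * (M * n1 (fun x => f x - proj leb H e f n x)) + 2 * (n2 (fun p => S n p - k p) * n1 f))
   @[n --> \oo] --> 2 * (M * (0 : R)) + 2 * ((0 : R) * n1 f).
  apply: cvgD; apply: cvgMr; first by apply: cvgMr; exact: onb_expand.
  by apply: cvgMl.
rewrite mul0r !mulr0 addr0 => /cvgr0Pnorm_le/(_ eps eps0)[n _ /(_ n (leqnn n))] h.
by apply: le_trans (bd n) (le_trans (ler_norm _) h).
Qed.

Lemma HS_kernel (A : op R) : HS A -> exists k, L2kernel A k.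
Proof. by move=> /HS_kernel_series[k [a [b [Ak _ _ _]]]]; exists k. Qed.

End HilbertSchmidt.

(** * Restriction to a measurable subset as extension by zero *)

Section Restriction.
Context d (T : measurableType d) (R : realType) (mu : {measure set T -> \bar R}).
Variables (D : set T) (b : T -> bool).
Hypotheses (mD : measurable D) (mb : measurable [set x | b x]).
Implicit Type f : T -> R[i].
Notation E := [set x | b x].

Let bE x : (x \in E) = b x.
Proof. by apply/idP/idP; rewrite inE. Qed.

Let mDE : measurable (D `&` E). Proof. exact: measurableI. Qed.

Lemma Re_if f : (fun x => ReC (if b x then f x else 0)) = (fun x => ReC (f x)) \_ E.
Proof. by apply/funext => x; rewrite patchE bE; case: (b x). Qed.
Lemma Im_if f : (fun x => ImC (if b x then f x else 0)) = (fun x => ImC (f x)) \_ E.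
Proof. by apply/funext => x; rewrite patchE bE; case: (b x). Qed.

Lemma cm_if f : cmeasurable (D `&` E) f -> cmeasurable D (fun x => if b x then f x else 0).
Proof.
move=> [f1 f2]; split; rewrite ?Re_if ?Im_if.
  exact/(measurable_restrict _ mb mD).
exact/(measurable_restrict _ mb mD).
Qed.

Lemma cI_if f : cintegral mu D (fun x => if b x then f x else 0) = cintegral mu (D `&` E) f.
Proof. by rewrite /cintegral Re_if Im_if !Rintegral_mkcondr. Qed.

Lemma nq_if f : nq mu D (fun x => if b x then f x else 0) = nq mu (D `&` E) f.
Proof.
rewrite !nq_ip !ipE -cI_if; congr ReC; apply: cI_ext => x _.
by case: (b x) => //; rewrite mul0r.
Qed.

Lemma L2_if f : isL2 mu (D `&` E) f -> isL2 mu D (fun x => if b x then f x else 0).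
Proof.
move=> [mf fi]; split; first exact: cm_if.
rewrite integral_mkcondr in fi; apply: le_lt_trans fi.
rewrite le_eqVlt; apply/orP; left; apply/eqP; apply: eq_integral => x _.
by rewrite patchE bE; case: (b x) => //; rewrite normc_0 expr0n.
Qed.

Lemma cm_sub f (G : set T) : measurable G -> G `<=` D -> cmeasurable D f -> cmeasurable G f.
Proof. by move=> mG GD [f1 f2]; split; [exact: measurable_funS mD GD f1|exact: measurable_funS mD GD f2]. Qed.

Lemma L2_sub f (G : set T) : measurable G -> G `<=` D -> isL2 mu D f -> isL2 mu G f.
Proof.
move=> mG GD f2; apply: int_L2; first exact: cm_sub GD (L2_cm f2).
exact: integrableS (L2_int f2).
Qed.

Lemma ci_sub f (G : set T) : measurable G -> G `<=` D -> cintegrable mu D f -> cintegrable mu G f.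
Proof. by move=> mG GD [f1 f2]; split; [exact: integrableS f1|exact: integrableS f2]. Qed.

Lemma ci_if f : cintegrable mu (D `&` E) f -> cintegrable mu D (fun x => if b x then f x else 0).
Proof.
move=> fi; have ni := ci_normc mDE fi.
apply: (ci_le mD (g := (fun x => Normc.normc (f x)) \_ E)).
- by apply: cm_if; exact: ci_cm fi.
- by move=> x _; rewrite patchE bE; case: (b x) => //; rewrite normc_0.
- apply/integrableP; move/integrableP: ni => [m i]; split.
    apply/measurable_EFinP/(measurable_restrict _ mb mD); exact/measurable_EFinP.
  rewrite integral_mkcondr in i; apply: le_lt_trans i.
  rewrite le_eqVlt; apply/orP; left; apply/eqP; apply: eq_integral => x _ /=.
  by rewrite !patchE bE; case: (b x) => //=; rewrite normr0.
Qed.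

End Restriction.

(** * The shift semigroups *)

Section Shift.
Variable R : realType.
Notation leb := (@lebesgue_measure R).
Notation leb2 := (@leb2 R).
Notation RR := (measurableTypeR R).
Notation H := (@halfline R).
Notation Q := (@quadrant R).
Notation n1 := (nq leb H).
Notation i1 := (ip leb H).
Notation n2 := (nq leb2 Q).
Notation i2 := (ip leb2 Q).
Notation mH := (@m_half R).
Notation mQ := (@m_quad R).
Notation shiftR := (@Defs.shift R).
Implicit Types (f g : R -> R[i]) (k l : R * R -> R[i]).

Variable t : R.
Hypothesis t0 : 0 <= t.

Let mtr (s : R) := @mpres_translate R s.

(** The concrete adjoint of the shift; [adj (shift t)] is a chosen operator known to agree with it
    almost everywhere. *)
Definition back (f : R -> R[i]) : R -> R[i] := fun x => f (x + t).

Lemma pre_back : (fun x : RR => x + t) @^-1` [set x | t < x] = H.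
Proof. by apply/seteqP; split => x /=; rewrite /halfline /= ltrDr. Qed.

Lemma pre_shift : (fun x : RR => x - t) @^-1` H = [set x | t < x].
Proof. by apply/seteqP; split => x /=; rewrite /halfline /= subr_gt0. Qed.

Lemma half_gt : H `&` [set x | 0 < x - t] = [set x | t < x] :> set RR.
Proof.
apply/seteqP; split => x /=; rewrite /halfline /= subr_gt0; first by case.
by move=> tx; split => //; exact: le_lt_trans tx.
Qed.

Lemma m_gtb : measurable ([set x | 0 < x - t] : set RR).
Proof. by have := m_gt t; congr measurable; apply/seteqP; split => x /=; rewrite subr_gt0. Qed.

Lemma gt_sub : [set x | t < x] `<=` H.
Proof. by move=> x /= tx; exact: le_lt_trans tx. Qed.

Lemma shift_cm f : @cmeasurable _ RR R H f -> @cmeasurable _ RR R [set x | t < x] (fun x => f (x - t)).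
Proof. by move=> mf; rewrite -pre_shift; exact: (mpres_cm (mtr (- t)) mH mf). Qed.

Lemma L2_shift f : L2 f -> L2 (shiftR t f).
Proof.
move=> f2; apply: (L2_if mH m_gtb); rewrite half_gt -pre_shift.
exact: (mpres_L2 (mtr (- t)) mH f2).
Qed.

Lemma n1_shift f : L2 f -> n1 (shiftR t f) = n1 f.
Proof.
move=> f2; rewrite -(mpres_nq (mtr (- t)) mH (L2_cm f2)) pre_shift -half_gt.
exact: (@nq_if _ RR).
Qed.

Lemma L2_back f : L2 f -> L2 (back f).
Proof.
move=> f2; rewrite /L2 -pre_back.
apply: (mpres_L2 (mtr t) (m_gt t)); exact: (L2_sub mH (m_gt t) gt_sub f2).
Qed.

Lemma n1_back f : L2 f -> n1 (back f) = nq leb [set x | t < x] f.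
Proof.
move=> f2; rewrite -(mpres_nq (mtr t) (m_gt t)) ?pre_back//.
exact: (cm_sub mH (m_gt t) gt_sub (L2_cm f2)).
Qed.

Lemma nq_sub d (T : measurableType d) (mu : {measure set T -> \bar R}) (D E : set T) (f : T -> R[i]) :
  measurable D -> measurable E -> E `<=` D -> isL2 mu D f -> nq mu E f <= nq mu D f.
Proof.
move=> mD mE ED f2; rewrite -lee_fin -!nqE//; last exact: L2_sub ED f2.
apply: ge0_subset_integral => //; first by apply/measurable_EFinP; exact: cm_normc (L2_cm f2).
by move=> x _; rewrite lee_fin sqr_ge0.
Qed.

Lemma n1_back_le f : L2 f -> n1 (back f) <= n1 f.
Proof. by move=> f2; rewrite n1_back//; exact: (nq_sub mH (m_gt t) gt_sub f2). Qed.

Lemma shift_back_ip f g : L2 f -> L2 g -> i1 (shiftR t f) g = i1 f (back g).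
Proof.
move=> f2 g2.
transitivity (cintegral leb [set x | t < x] (fun x => f (x - t) * (g x)^*)).
  rewrite ipE -half_gt -(cI_if _ _ (fun x : RR => 0 < x - t)); apply: cI_ext => x _; rewrite /Defs.shift.
  by case: ifP => //; rewrite mul0r.
have cf := @shift_cm f (L2_cm f2).
rewrite -(mpres_cI (mtr t) (m_gt t)).
  rewrite pre_back ipE; apply: cI_ext => x _; rewrite /= /back.
  by rewrite addrK.
by apply: cmM cf _; apply: cmJ; exact: (cm_sub mH (m_gt t) gt_sub (L2_cm g2)).
Qed.

Lemma adjoint_shift : is_adjoint (shiftR t) back.
Proof.
split; last by move=> f g f2 g2; rewrite !innerE shift_back_ip.
apply: (@nq_bounded _ _ 1) => //.
- exact: L2_back.
- by move=> a f g f2 g2; exact: L2eq_refl.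
- by move=> f f2; rewrite mul1r n1_back_le.
Qed.

Lemma bounded_shift : bounded_op (shiftR t).
Proof.
apply: (@nq_bounded _ _ 1) => //.
- exact: L2_shift.
- by move=> a f g f2 g2; apply: aeW => x _; rewrite /Defs.shift; case: ifP; rewrite ?mulr0 ?addr0.
- by move=> f f2; rewrite mul1r n1_shift.
Qed.

Lemma adj_shift f : L2 f -> L2eq (adj (shiftR t) f) (back f).
Proof. exact: (adjP adjoint_shift).2. Qed.

Lemma bounded_adj_shift : bounded_op (adj (shiftR t)).
Proof. by case: (adjP adjoint_shift) => -[]. Qed.

Lemma bounded_sigma A : bounded_op A -> bounded_op (sigma t A).
Proof.
move=> bA; apply: bounded_comp bounded_adj_shift _.
exact: bounded_comp bA bounded_shift.
Qed.

Lemma bounded_sigma_tilde A : bounded_op A -> bounded_op (sigma_tilde t A).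
Proof.
move=> bA; apply: bounded_comp bounded_shift _.
exact: bounded_comp bA bounded_adj_shift.
Qed.

Lemma back_ae f g : L2eq f g -> L2eq (back f) (back g).
Proof.
move=> fg; apply: (aeS _ (mpres_ae (mtr t) fg)) => x h Hx; apply: h.
by rewrite /halfline /= ltr_wpDr.
Qed.

Lemma shift_ae f g : L2eq f g -> L2eq (shiftR t f) (shiftR t g).
Proof.
move=> fg; apply: (aeS _ (mpres_ae (mtr (- t)) fg)) => x h Hx.
by rewrite /Defs.shift; case: ifP => // xt; apply: h.
Qed.

Definition Qt : set (R * R) := [set p | t < p.1 /\ t < p.2].

Lemma m_Qt : measurable (Qt : set (RR * RR)).
Proof. exact: (measurableX (m_gt t) (m_gt t)). Qed.

Lemma Qt_sub : Qt `<=` Q.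
Proof. by move=> p [] h1 h2; split; exact: le_lt_trans t0 _. Qed.

Lemma pre_Qt : (fun p : RR * RR => (p.1 + t, p.2 + t)) @^-1` Qt = Q.
Proof. by apply/seteqP; split => p /= []; rewrite /= ?ltrDr => ? ?; split; rewrite /= ?ltrDr. Qed.

Lemma pre_Q : (fun p : RR * RR => (p.1 - t, p.2 - t)) @^-1` Q = Qt.
Proof. by apply/seteqP; split => p /= []; rewrite /= ?subr_gt0 => ? ?; split; rewrite /= ?subr_gt0. Qed.

(* The kernel of [sigma_tilde t A] when [k] is the kernel of [A]. *)
Definition fkernel k : R * R -> R[i] :=
  fun p => if (t < p.1) && (t < p.2) then k (p.1 - t, p.2 - t) else 0.

Lemma Qt_b : [set p | (t < p.1) && (t < p.2)] = Qt.
Proof. by apply/seteqP; split => p /= /andP. Qed.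

Lemma m_Qtb : measurable ([set p : RR * RR | (t < p.1) && (t < p.2)]).
Proof. by have := m_Qt; rewrite -Qt_b. Qed.

Lemma Q_Qt : Q `&` [set p | (t < p.1) && (t < p.2)] = Qt.
Proof. by rewrite Qt_b; apply/setIidr/Qt_sub. Qed.

Lemma L2_shift_kernel k : isL2 leb2 Q k -> isL2 leb2 Q (shift_kernel t k).
Proof.
move=> k2; rewrite -[Q]pre_Qt; apply: (mpres_L2 (@mpres_translate2 R t t) m_Qt).
exact: (L2_sub mQ m_Qt Qt_sub k2).
Qed.

Lemma n2_shift_kernel k : isL2 leb2 Q k -> n2 (shift_kernel t k) = nq leb2 Qt k.
Proof.
move=> k2; rewrite -(mpres_nq (@mpres_translate2 R t t) m_Qt) ?pre_Qt//.
exact: (cm_sub mQ m_Qt Qt_sub (L2_cm k2)).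
Qed.

Lemma n2_shift_kernel_le k : isL2 leb2 Q k -> n2 (shift_kernel t k) <= n2 k.
Proof. by move=> k2; rewrite n2_shift_kernel//; exact: (nq_sub mQ m_Qt Qt_sub k2). Qed.

Lemma L2_fkernel k : isL2 leb2 Q k -> isL2 leb2 Q (fkernel k).
Proof.
move=> k2; apply: (L2_if mQ m_Qtb); rewrite Q_Qt -pre_Q.
exact: (mpres_L2 (@mpres_translate2 R (- t) (- t)) mQ k2).
Qed.

Lemma n2_fkernel k : isL2 leb2 Q k -> n2 (fkernel k) = n2 k.
Proof.
move=> k2; rewrite -(mpres_nq (@mpres_translate2 R (- t) (- t)) mQ (L2_cm k2)).
rewrite pre_Q -Q_Qt; exact: (@nq_if _ (RR * RR)%type).
Qed.

Lemma i2_fkernel k l : isL2 leb2 Q k -> isL2 leb2 Q l ->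
  i2 (fkernel k) l = i2 k (shift_kernel t l).
Proof.
move=> k2 l2.
transitivity (cintegral leb2 Qt (fun p => k (p.1 - t, p.2 - t) * (l p)^*)).
  rewrite ipE -Q_Qt -(cI_if _ _ (fun p : RR * RR => (t < p.1) && (t < p.2))); apply: cI_ext => p _; rewrite /fkernel.
  by case: ifP => //; rewrite mul0r.
rewrite -(mpres_cI (@mpres_translate2 R t t) m_Qt).
  by rewrite pre_Qt ipE; apply: cI_ext => -[x y] _; rewrite /= /shift_kernel /= !addrK.
apply: cmM.
  by rewrite -pre_Q; exact: (mpres_cm (@mpres_translate2 R (- t) (- t)) mQ (L2_cm k2)).
by apply: cmJ; exact: (cm_sub mQ m_Qt Qt_sub (L2_cm l2)).
Qed.

Lemma sigma_kernel A k : bounded_op A -> L2kernel A k ->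
  L2kernel (sigma t A) (shift_kernel t k).
Proof.
move=> bA /L2kernelP[k2 Ak]; apply/L2kernelP; split; first exact: L2_shift_kernel.
move=> f f2; have s2 := L2_shift f2; have [A2 _ _] := bA.
apply: L2eq_trans (adj_shift (A2 _ s2)) _.
apply: L2eq_trans (back_ae (Ak _ s2)) _.
apply: aeW => x Hx; rewrite /back /Kop.
have Hxt : H (x + t) by rewrite /halfline /= ltr_wpDr.
have [k1 k3] := L2_cm k2.
have ms : @cmeasurable _ RR R [set y | t < y] (fun y => k (x + t, y) * f (y - t)).
  apply: cmM; last exact: shift_cm (L2_cm f2).
  apply: (cm_sub mH (m_gt t) gt_sub).
  by split; [exact: (section_meas mH mH k1)|exact: (section_meas mH mH k3)].
transitivity (cintegral leb [set y | t < y] (fun y => k (x + t, y) * f (y - t))).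
  rewrite -half_gt -(cI_if _ _ (fun x : RR => 0 < x - t)); apply: cI_ext => y _; rewrite /Defs.shift.
  by case: ifP => //; rewrite mulr0.
rewrite -(mpres_cI (mtr t) (m_gt t) ms) pre_back.
by apply: cI_ext => y _; rewrite /= addrK.
Qed.

Lemma sigma_tilde_kernel A k : bounded_op A -> L2kernel A k ->
  L2kernel (sigma_tilde t A) (fkernel k).
Proof.
move=> bA /L2kernelP[k2 Ak]; apply/L2kernelP; split; first exact: L2_fkernel.
move=> f f2; have b2 := L2_back f2; have [A2 _ _] := bA.
have a2 : L2 (adj (shiftR t) f) by case: bounded_adj_shift => + _ _; apply.
apply: L2eq_trans (shift_ae (bounded_ae bA a2 b2 (adj_shift f2))) _.
apply: L2eq_trans (shift_ae (Ak _ b2)) _.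
apply: aeW => x Hx; rewrite /Defs.shift /Kop /fkernel /= subr_gt0.
case: ifP => tx; last first.
  by rewrite -[LHS](cI0 leb H); apply: cI_ext => y _; rewrite mul0r.
have Hxt : H (x - t) by rewrite /halfline /= subr_gt0.
have [k1 k3] := L2_cm k2.
have ms : @cmeasurable _ RR R [set y | t < y] (fun y => k (x - t, y - t) * f y).
  apply: cmM; last exact: (cm_sub mH (m_gt t) gt_sub (L2_cm f2)).
  apply: (@shift_cm (fun y => k (x - t, y))).
  by split; [exact: (section_meas mH mH k1)|exact: (section_meas mH mH k3)].
transitivity (cintegral leb [set y | t < y] (fun y => k (x - t, y - t) * f y)).
  rewrite -(mpres_cI (mtr t) (m_gt t) ms) pre_back.
  by apply: cI_ext => y _; rewrite /= addrK.
rewrite -half_gt -(cI_if _ _ (fun x : RR => 0 < x - t)); apply: cI_ext => y _; rewrite subr_gt0.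
by case: ifP => //=; rewrite mul0r.
Qed.

End Shift.

Lemma nq_dct d (T : measurableType d) (R : realType) (mu : {measure set T -> \bar R})
    (D : set T) (w : nat -> T -> R[i]) (g : T -> R) : measurable D ->
  (forall n, cmeasurable D (w n)) -> mu.-integrable D (EFin \o g) ->
  {ae mu, forall x, D x -> forall n, Normc.normc (w n x) ^+ 2 <= g x} ->
  {ae mu, forall x, D x -> Normc.normc (w n x) ^+ 2 @[n --> \oo] --> (0 : R)} ->
  nq mu D (w n) @[n --> \oo] --> (0 : R).
Proof.
move=> mD mw gi wg w0.
pose F n x : \bar R := (Normc.normc (w n x) ^+ 2)%:E.
have mF n : measurable_fun D (F n) by apply/measurable_EFinP; exact: cm_normc.
have h1 : {ae mu, forall x, D x -> F ^~ x @ \oo --> (cst 0 : T -> \bar R) x}.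
  apply: (aeS _ w0) => x + Dx => /(_ Dx) h.
  by apply: cvg_EFin => //; exact: nearW.
have h2 : {ae mu, forall x n, D x -> (`|F n x| <= (EFin \o g) x)%E}.
  apply: (aeS _ wg) => x h n Dx; rewrite /F /= lee_fin ger0_norm ?sqr_ge0//.
  exact: h.
have [_ _ h] := dominated_convergence mD mF (measurable_cst _) h1 gi h2.
rewrite integral0 in h.
have : fine (\int[mu]_(x in D) F n x)%E @[n --> \oo] --> (0 : R) by move/fine_cvg : h.
rewrite (_ : (fun n => _) = fun n => nq mu D (w n))//.
by apply/funext => n; rewrite nqR.
Qed.

(** * Continuity of translations *)

Section Average.
Variable R : realType.
Notation leb := (@lebesgue_measure R).
Notation RR := (measurableTypeR R).
Notation H := (@halfline R).
Notation n1 := (nq leb H).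
Notation mH := (@m_half R).
Implicit Types (f : R -> R[i]).

Implicit Types (h v : R -> R) (a b M s : R).

(** Bounded measurable functions of bounded support. The bounds are parameters because averaging
    moves the support and the later constants depend on them. *)
Definition bc a b M h := [/\ measurable_fun (setT : set RR) h,
  forall x, `|h x| <= M & forall x, h x != 0 -> a <= x <= b].

Lemma leb_itv_fin a b (b0 b1 : bool) : (leb [set` Interval (BSide b0 a) (BSide b1 b)] < +oo)%E.
Proof. by rewrite lebesgue_measure_itv/=; case: ifP => _; rewrite -?EFinB ltry. Qed.

Lemma int_bounded (A : set RR) (u : R -> R) M : measurable A -> (leb A < +oo)%E ->
  measurable_fun A u -> (forall x, A x -> `|u x| <= M) -> leb.-integrable A (EFin \o u).
Proof.
move=> mA Af mu uM; apply: (measurable_bounded_integrable mA) => //.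
exists M; split; first by rewrite num_real.
by move=> N MN x Ax /=; rewrite (le_trans (uM x Ax))// ltW.
Qed.

Lemma int_indic b : leb.-integrable H (EFin \o (\1_(`]0, b] : set RR) : RR -> R)).
Proof.
by apply: (integrableS _ _ _ (@integrable_indic_itv R 0 b false false)) => //; exact: mH.
Qed.

Lemma is_derive_translate (F : R -> R) x s (df : R) :
  is_derive (x + s) 1 F df -> is_derive x 1 (fun y => F (y + s)) df.
Proof.
move=> [d v].
have E : (fun r : R => r^-1 *: (((fun y => F (y + s)) \o shift x) (r *: 1) - F (x + s))) =
   (fun r : R => r^-1 *: ((F \o shift (x + s)) (r *: 1) - F (x + s))).
  by apply/funext => r /=; rewrite addrA.
by split; [rewrite /derivable E|rewrite /derive E].
Qed.

Lemma bc_int a b M h (A : set RR) : bc a b M h -> measurable A ->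
  leb.-integrable A (EFin \o h).
Proof.
move=> [mh hM hs] mA; apply: (@integrableS _ _ _ leb setT) => //.
have mab : measurable (`[a, b]%classic : set RR) by exact: measurable_itv.
have i : leb.-integrable (`[a, b]%classic : set RR) (EFin \o h).
  by apply: (int_bounded (M := M)) => //; [exact: leb_itv_fin|exact: measurable_funTS].
have i' := (@integrable_mkcond _ RR R leb _ (EFin \o h) mab).1 i.
apply: eq_integrable i' => // x _.
rewrite patchE; case: ifPn => //; rewrite notin_setE /= in_itv/= => /negP xab.
have [->//|/hs h0] := eqVneq (h x) 0.
by rewrite h0 in xab.
Qed.

Lemma bc_M0 a b M h : bc a b M h -> 0 <= M.
Proof. by move=> [_ /(_ 0) hM _]; apply: le_trans hM. Qed.

(* Steklov averages: [avg s h x] is the mean of [h] over [x, x + s].  Averaging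
   turns a bounded function into a Lipschitz one and a continuous one into C^1. *)
Definition prim h x := Rintegral leb `]-oo, x] h.
Definition avg s h x := s^-1 * (prim h (x + s) - prim h x).

Lemma prim_sub a b M h x y : bc a b M h -> x <= y ->
  prim h y - prim h x = Rintegral leb `]x, y] h.
Proof.
by move=> hb xy; apply: Rintegral_itvB; [exact: (bc_int hb)| |rewrite bnd_simp].
Qed.

Lemma prim_lip a b M h x y : bc a b M h -> x <= y -> `|prim h y - prim h x| <= M * (y - x).
Proof.
move=> hb xy; rewrite (prim_sub hb xy).
have hi : leb.-integrable (`]x, y] : set RR) (EFin \o h) by exact: (bc_int hb).
apply: le_trans (le_normr_Rintegral _ hi) _ => //.
have mxy : (leb `]x, y] = (y - x)%:E)%E.
  by rewrite lebesgue_measure_itv/= lte_fin -EFinB; move: xy; rewrite le_eqVlt => /predU1P[->|->//];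
    rewrite ltxx subrr.
rewrite -[leRHS](_ : Rintegral leb `]x, y] (fun=> M) = _); last first.
  by rewrite Rintegral_cst//= mxy.
apply: le_Rintegral => //.
- exact: integrable_norm.
- by apply: (int_bounded (M := `|M|)) => //; exact: leb_itv_fin.
- by move=> z _; case: hb.
Qed.

Lemma prim_lip2 a b M h x y : bc a b M h -> `|prim h y - prim h x| <= M * `|y - x|.
Proof.
move=> hb; have [xy|/ltW yx] := leP x y.
  by rewrite [X in M * X]ger0_norm ?subr_ge0//; exact: prim_lip hb _.
by rewrite distrC [X in M * X]distrC [X in M * X]ger0_norm ?subr_ge0//; exact: prim_lip hb _.
Qed.

Lemma lip_continuous (u : R -> R) L : (forall x y, `|u y - u x| <= L * `|y - x|) -> continuous u.
Proof.
move=> hu x; apply/cvgrPdist_le => e e0.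
have L0 : 0 < `|L| + 1 by rewrite ltr_wpDl.
near=> y; rewrite (le_trans (hu _ _))//.
apply: (@le_trans _ _ ((`|L| + 1) * `|x - y|)).
  by rewrite ler_wpM2r// (le_trans (ler_norm L))// lerDl.
rewrite -ler_pdivlMl// mulrC.
near: y; apply: (@cvgr_dist_le _ _ _ _ _ id x); first exact: cvg_id.
by rewrite divr_gt0.
Unshelve. all: by end_near. Qed.

Lemma avg_lip a b M h s x y : bc a b M h -> 0 < s ->
  `|avg s h y - avg s h x| <= (2 * M / s) * `|y - x|.
Proof.
move=> hb s0; rewrite /avg -mulrBr normrM (gtr0_norm (_ : 0 < s^-1)) ?invr_gt0//.
rewrite mulrAC mulrC ler_pM2r ?invr_gt0//.
have -> : prim h (y + s) - prim h y - (prim h (x + s) - prim h x) =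
   (prim h (y + s) - prim h (x + s)) - (prim h y - prim h x) by ring.
apply: le_trans (ler_normB _ _) _.
have := prim_lip2 (x + s) (y + s) hb; have := prim_lip2 x y hb.
rewrite (_ : y + s - (x + s) = y - x); last by ring.
by move=> h1 h2; rewrite -mulrA; lra.
Qed.

(** The mean over [[x, x + s]] looks to the right, so the support grows to the left only; to keep it
    inside the half line, [s] must stay below [a]. *)
Lemma avg_bc a b M h s : bc a b M h -> 0 < s -> bc (a - s) b M (avg s h).
Proof.
move=> hb s0; split.
- by apply: continuous_measurable_fun; apply: lip_continuous => x y; exact: avg_lip hb s0.
- move=> x; rewrite /avg normrM gtr0_norm ?invr_gt0// ler_pdivrMl// mulrC.
  have := @prim_lip _ _ _ _ x (x + s) hb; rewrite (_ : x + s - x = s); last by ring.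
  by apply; rewrite lerDl ltW.
- move=> x; have xs : x <= x + s by rewrite lerDl ltW.
  rewrite /avg (prim_sub hb xs) => hx.
  apply: contraNT hx => xab; rewrite /Rintegral integral0_eq ?mulr0//= => y.
  rewrite /= in_itv/= => /andP[xy yxs]; congr EFin; case: hb => _ _ hs.
  apply/eqP; apply: contraNT xab => /hs /andP[ay yb].
  by rewrite lerBlDr (le_trans ay)//= (le_trans (ltW xy)).
Qed.

Lemma bc_L2 a b M h : bc a b M h -> L2 (fun x => (h x)%:C).
Proof.
move=> hb; have [mh hM hs] := hb.
have mh' : @cmeasurable _ RR R H (fun x => (h x)%:C).
  by apply: cm_real; exact: measurable_funTS.
apply: (int_L2 mh').
have hi := intZ mH M (integrable_norm (bc_int hb mH)).
apply: (intle mH _ _ hi); first exact: (cm_normc mh').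
move=> x Hx; rewrite ger0_norm ?sqr_ge0// normc2E /= expr0n addr0 -real_normK ?num_real// expr2.
by rewrite ler_wpM2r.
Qed.

Lemma n1_real_bound (w : R -> R[i]) (c b : R) : @cmeasurable _ RR R H w -> 0 <= b ->
  (forall x, 0 < x <= b -> Normc.normc (w x) ^+ 2 <= c) ->
  (forall x, b < x -> w x = 0) -> L2 w /\ n1 w <= c * b.
Proof.
move=> mw b0 wc w0.
have m1 : leb.-integrable H (EFin \o (fun x => c * \1_(`]0, b] : set RR) x)).
  exact: (intZ mH _ (int_indic b)).
have le x : H x -> Normc.normc (w x) ^+ 2 <= c * \1_(`]0, b] : set RR) x.
  move=> Hx; rewrite indicE; case: (boolP (x \in _)) => [/set_mem|]; rewrite /= ?notin_setE /= in_itv/=.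
    by move=> /wc; rewrite mulr1.
  move=> /negP; rewrite Hx/= -ltNge => /w0 ->.
  by rewrite normc_0 expr0n mulr0.
have w2 : L2 w by exact: (L2_le mH mw le m1).
split=> //; rewrite nqR.
apply: le_trans (le_Rintegral mH (L2_int w2) m1 le) _.
rewrite (RintegralZl _ mH (int_indic b)).
rewrite /Rintegral integral_indic//; last exact: mH.
rewrite (_ : _ `&` H = `]0, b]%classic); last first.
  by apply/setIidl => x /=; rewrite in_itv/= => /andP[].
have mb : fine (leb (`]0, b]%classic : set RR)) = b.
  rewrite lebesgue_measure_itv/= lte_fin; move: b0; rewrite le_eqVlt => /predU1P[<-|b0].
    by rewrite ltxx.
  by rewrite b0 /= subr0.
by rewrite (_ : fine _ = b)//; exact: mb.
Qed.

Lemma prim_ae a b M h : bc a b M h ->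
  {ae leb, forall x, derivable (prim h) x 1 /\ derive1 (prim h) x = h x}.
Proof.
move=> hb; apply: FTC1Ny => [y|]; first exact: (bc_int hb).
apply: open_integrable_locally; first exact: openT.
exact: (bc_int hb).
Qed.

Lemma avg_pointwise h x : derivable (prim h) x 1 -> derive1 (prim h) x = h x ->
  avg n.+1%:R^-1 h x @[n --> \oo] --> h x.
Proof.
move=> /cvg_ex[l hl] hx.
have lE : l = h x by rewrite -hx derive1E; apply/esym/cvg_lim.
rewrite lE in hl.
have cond : (forall n : nat, (n.+1%:R^-1 : R) != 0) /\ (n.+1%:R^-1 : R) @[n --> \oo] --> (0 : R).
  by split; [move=> n; rewrite invr_neq0|exact: cvg_harmonic].
have hc := (cvgr_dnbhsP _ _ _).1 hl _ cond.
apply: cvg_trans hc; apply: near_eq_cvg; apply: nearW => n /=.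
have sc (p q : R) : p *: q = p * q by [].
by rewrite !sc mulr1 /avg [_ + x]addrC.
Qed.

(** Lebesgue differentiation gives convergence almost everywhere, and the differences are dominated
    by [2 * M] times the indicator of []0, b]]. *)
Lemma avg_cvg a b M h : bc a b M h -> 0 <= b ->
  n1 (fun x => (avg n.+1%:R^-1 h x - h x)%:C) @[n --> \oo] --> (0 : R).
Proof.
move=> hb b0; have [mh hM hs] := hb; have M0 := bc_M0 hb.
have sn n : 0 < (n.+1%:R^-1 : R) by rewrite invr_gt0.
have ab n := avg_bc hb (sn n).
have g2 := @n1_real_bound (fun x => (2 * M * \1_(`]0, b] : set RR) x)%:C) ((2 * M) ^+ 2) b.
have mi : measurable (`]0, b] : set RR) by exact: measurable_itv.
have mg : @cmeasurable _ RR R H (fun x => (2 * M * \1_(`]0, b] : set RR) x)%:C).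
  by apply: cm_real; apply: measurable_funM => //; exact: measurable_indic.
have [||G2 _] := g2 mg b0.
- move=> x xb; rewrite normc2E /= expr0n addr0 indicE mem_set ?mulr1//.
- by move=> x bx; rewrite indicE memNset ?mulr0//= in_itv/= [x <= b]leNgt bx andbF.
apply: (nq_dct mH _ (L2_int G2)).
- move=> n; apply: cm_real; apply: measurable_funTS; apply: measurable_funB => //.
  by case: (ab n).
- apply: aeW => x Hx n; rewrite !normc2E /= expr0n !addr0.
  have [_ aM as_] := ab n.
  have [xb|bx] := leP x b.
    rewrite indicE mem_set ?mulr1//=; last by rewrite in_itv/= Hx.
    rewrite -real_normK ?num_real// ler_sqr ?nnegrE ?mulr_ge0//.
    by rewrite (le_trans (ler_normB _ _))// (le_trans (lerD (aM x) (hM x)))//; lra.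
  have -> : avg n.+1%:R^-1 h x = 0.
    by apply/eqP; apply: contraTT bx => /as_ /andP[_]; rewrite -leNgt.
  have -> : h x = 0.
    by apply/eqP; apply: contraTT bx => /hs /andP[_]; rewrite -leNgt.
  by rewrite subrr expr0n/= sqr_ge0.
- apply: (aeS _ (prim_ae hb)) => x [h1 h2] Hx.
  rewrite (_ : (fun n => _) = fun n => (avg n.+1%:R^-1 h x - h x) ^+ 2); last first.
    by apply/funext => n; rewrite normc2E /= expr0n addr0.
  rewrite (_ : 0 = (h x - h x) ^+ 2); last by rewrite subrr expr0n.
  by apply: cvgM; apply: cvgB; [exact: avg_pointwise|exact: cvg_cst|exact: avg_pointwise|exact: cvg_cst].
Qed.

Definition C1c v := [/\ forall x, derivable v x 1, continuous (derive1 v) &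
  exists a b, 0 < a /\ forall x, v x != 0 -> a <= x <= b].

Lemma avg_C1c a b M h s : bc a b M h -> continuous h -> 0 < s -> s < a -> C1c (avg s h).
Proof.
move=> hb hc s0 sa.
have pd (x : R) : is_derive x 1 (prim h) (h x).
  have [] := @continuous_FTC1 R h -oo%O x (x + 1).
  - by rewrite ltrDl.
  - exact: (bc_int hb).
  - exact: ltNyr.
  - exact: hc.
  move=> d1 d2; have d1' : derivable (prim h) x 1 := d1.
  have d2' : derive1 (prim h) x = h x := d2.
  by apply: DeriveDef; [exact: d1'|rewrite -derive1E].
have ad (x : R) : is_derive x 1 (avg s h) (s^-1 * (h (x + s) - h x)).
  have c : is_derive x 1 (fun y => prim h (y + s)) (h (x + s)).
    exact: is_derive_translate (pd _).
  rewrite /avg; apply: is_deriveZ (is_deriveB c (pd x)).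
split.
- by move=> x; case: (ad x).
- rewrite (_ : derive1 (avg s h) = fun x => s^-1 * (h (x + s) - h x)); last first.
    by apply/funext => x; rewrite derive1E; case: (ad x).
  move=> x; apply: cvgMr; apply: cvgB; last exact: hc.
  apply: (@continuous_comp _ _ _ (fun y => y + s) h); last exact: hc.
  by apply: cvgD; [exact: cvg_id|exact: cvg_cst].
- exists (a - s), b; split; first by rewrite subr_gt0.
  by have [_ _] := avg_bc hb s0.
Qed.

(** Truncation both in position and in height; every point of the half line ends up in the sets
    [E m], and [|v|^2] dominates the squared differences. *)
Lemma real_bc_dense v e : measurable_fun (H : set RR) v -> L2 (fun x => (v x)%:C) -> 0 < e ->
  exists a b M h, [/\ 0 < a, 0 <= b, bc a b M h & n1 (fun x => (v x - h x)%:C) <= e].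
Proof.
move=> mv v2 e0.
pose E m : set RR := H `&` ((fun x => `|v x|) @^-1` `]-oo, m.+1%:R]) `&` `[m.+1%:R^-1, m.+1%:R].
have mE m : measurable (E m).
  apply: measurableI; last exact: measurable_itv.
  have mnv : measurable_fun (H : set RR) (fun x => `|v x|) by exact: measurableT_comp.
  exact: (mnv mH _ (measurable_itv _)).
pose h m := v \_ (E m).
have hb m : bc m.+1%:R^-1 m.+1%:R m.+1%:R (h m).
  split.
  - apply/(measurable_restrictT _ (mE m)); apply: measurable_funS mv; first exact: mH.
    by move=> x [[]].
  - move=> x; rewrite /h patchE; case: ifPn => [/set_mem[[_ /=]]|_]; last by rewrite normr0.
    by rewrite in_itv.
  - move=> x; rewrite /h patchE; case: ifPn => [/set_mem[_ /=]|_]; last by rewrite eqxx.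
    by rewrite in_itv.
have c : n1 (fun x => (v x - h n x)%:C) @[n --> \oo] --> (0 : R).
  apply: (nq_dct mH _ (L2_int v2)).
  - move=> n; apply: cm_real; apply: measurable_funB => //.
    by apply: measurable_funTS; case: (hb n).
  - apply: aeW => x Hx n; rewrite !normc2E /= expr0n !addr0 /h patchE.
    by case: ifP => _; rewrite ?subr0// subrr expr0n sqr_ge0.
  - apply: aeW => x Hx; apply/cvg0P => [n|d d0]; first exact: sqr_ge0.
    have [N hN] : exists N, forall n, (N <= n)%N -> x \in E n.
      (* An integer above this sum exceeds each of [|v x|], [x] and [1 / x], the three conditions
         that define [E n]. *)
      pose r := `|v x| + x + x^-1; exists (Num.truncn r).+1 => n Nn.
      have rn : r < n.+1%:R.
        by rewrite (lt_le_trans (truncnS_gt r))// ler_nat (leq_trans Nn).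
      have x1 : 0 < x^-1 by rewrite invr_gt0.
      have v0 : 0 <= `|v x| by [].
      rewrite inE; split; [split => //=|]; rewrite /= in_itv/=; rewrite /r in rn.
        by move: Hx; rewrite /halfline/= => Hx; lra.
      apply/andP; split; last by move: Hx; rewrite /halfline/= => Hx; lra.
      by rewrite -[leRHS]invrK lef_pV2 ?posrE// ; move: Hx; rewrite /halfline/= => Hx; lra.
    exists N => n Nn; rewrite /h patchE hN// subrr normc_0 expr0n/=; exact: ltW.
have [N hN] := (cvg0P (fun n => nq_ge0 leb H _)).1 c e e0.
exists N.+1%:R^-1, N.+1%:R, N.+1%:R, (h N); split => //.
exact: hN.
Qed.

Lemma n1_tri (u v w : R -> R) e1 e2 : L2 (fun x => (u x)%:C) -> L2 (fun x => (v x)%:C) ->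
  L2 (fun x => (w x)%:C) ->
  n1 (fun x => (u x - v x)%:C) <= e1 -> n1 (fun x => (v x - w x)%:C) <= e2 ->
  n1 (fun x => (u x - w x)%:C) <= 2 * e1 + 2 * e2.
Proof.
move=> u2 v2 w2 h1 h2.
rewrite (@n1_ext _ _ (fun x => ((u x)%:C - (v x)%:C) + ((v x)%:C - (w x)%:C))); last first.
  by move=> x _; apply: Cext; rewrite !CE /=; ring.
apply: le_trans (nqD_le mH (L2B mH u2 v2) (L2B mH v2 w2)) _.
rewrite lerD// ler_wpM2l//.
  by apply: le_trans h1; rewrite le_eqVlt; apply/orP; left; apply/eqP; apply: n1_ext => x _; rewrite rmorphB.
by apply: le_trans h2; rewrite le_eqVlt; apply/orP; left; apply/eqP; apply: n1_ext => x _; rewrite rmorphB.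
Qed.

(** One averaging of a bounded truncation: the result is Lipschitz, which suffices for the
    continuity of translations. *)
Lemma real_avg_dense v e : measurable_fun (H : set RR) v -> L2 (fun x => (v x)%:C) -> 0 < e ->
  exists a b M h L, [/\ 0 < a, 0 <= b, bc a b M h,
    (forall x y, `|h y - h x| <= L * `|y - x|) & n1 (fun x => (v x - h x)%:C) <= e].
Proof.
move=> mv v2 e0; have e4 : 0 < e / 4 by rewrite divr_gt0.
have [a [b [M [h [a0 b0 hb hv]]]]] := real_bc_dense mv v2 e4.
have [N hN] := (cvg0P (fun n => nq_ge0 leb H _)).1 (avg_cvg hb b0) _ e4.
(* Large enough for the averages to be close to [h], and for the averaging length to be below
   [a / 2], so that the support keeps a positive lower bound. *)
pose n := maxn N (Num.truncn (2 / a)).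
have s0 : 0 < (n.+1%:R^-1 : R) by rewrite invr_gt0.
have sa : n.+1%:R^-1 < a / 2.
  rewrite -[ltRHS]invrK ltf_pV2 ?posrE ?invr_gt0 ?divr_gt0// invf_div.
  by rewrite (lt_le_trans (truncnS_gt _))// ler_nat ltnS leq_maxr.
have hb' := avg_bc hb s0.
exists (a - n.+1%:R^-1), b, M, (avg n.+1%:R^-1 h), (2 * M / n.+1%:R^-1); split => //.
- by rewrite subr_gt0 (lt_trans sa)//; lra.
- by move=> x y; exact: avg_lip hb s0.
- rewrite (_ : e = 2 * (e / 4) + 2 * (e / 4)); last by field.
  apply: (n1_tri v2 (bc_L2 hb) (bc_L2 hb') hv).
  have := hN n (leq_maxl _ _); apply: le_trans; rewrite le_eqVlt; apply/orP; left; apply/eqP.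
  rewrite !nqR; apply: eq_Rintegral => x _; rewrite !normc2E /= expr0n !addr0.
  by rewrite -sqrrN opprB.
Qed.

(** A second averaging, now of a Lipschitz and hence continuous function, yields a C^1 one. *)
Lemma real_C1c_dense v e : measurable_fun (H : set RR) v -> L2 (fun x => (v x)%:C) -> 0 < e ->
  exists u, [/\ C1c u, L2 (fun x => (u x)%:C) & n1 (fun x => (v x - u x)%:C) <= e].
Proof.
move=> mv v2 e0; have e4 : 0 < e / 4 by rewrite divr_gt0.
have [a [b [M [h [L [a0 b0 hb hl hv]]]]]] := real_avg_dense mv v2 e4.
have [N hN] := (cvg0P (fun n => nq_ge0 leb H _)).1 (avg_cvg hb b0) _ e4.
pose n := maxn N (Num.truncn (1 / a)).
have s0 : 0 < (n.+1%:R^-1 : R) by rewrite invr_gt0.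
have sa : n.+1%:R^-1 < a.
  rewrite -[ltRHS]invrK ltf_pV2 ?posrE ?invr_gt0// -div1r.
  by rewrite (lt_le_trans (truncnS_gt _))// ler_nat ltnS leq_maxr.
exists (avg n.+1%:R^-1 h); split.
- exact: avg_C1c hb (lip_continuous hl) s0 sa.
- exact: bc_L2 (avg_bc hb s0).
- rewrite (_ : e = 2 * (e / 4) + 2 * (e / 4)); last by field.
  apply: (n1_tri v2 (bc_L2 hb) (bc_L2 (avg_bc hb s0)) hv).
  have := hN n (leq_maxl _ _); apply: le_trans; rewrite le_eqVlt; apply/orP; left; apply/eqP.
  rewrite !nqR; apply: eq_Rintegral => x _; rewrite !normc2E /= expr0n !addr0.
  by rewrite -sqrrN opprB.
Qed.

Lemma L2_Re f : L2 f -> measurable_fun (H : set RR) (fun x => ReC (f x)) /\ L2 (fun x => (ReC (f x))%:C).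
Proof.
move=> f2; have [f1 _] := L2_cm f2; split => //.
apply: (L2_le mH _ _ (L2_int f2)); first exact: cm_real.
by move=> x _; rewrite !normc2E /= expr0n addr0 lerDl sqr_ge0.
Qed.

Lemma L2_Im f : L2 f -> measurable_fun (H : set RR) (fun x => ImC (f x)) /\ L2 (fun x => (ImC (f x))%:C).
Proof.
move=> f2; have [_ f1] := L2_cm f2; split => //.
apply: (L2_le mH _ _ (L2_int f2)); first exact: cm_real.
by move=> x _; rewrite !normc2E /= expr0n addr0 lerDr sqr_ge0.
Qed.

Lemma n1_ReIm f (u v : R -> R) : L2 f -> L2 (fun x => (u x)%:C) -> L2 (fun x => (v x)%:C) ->
  n1 (fun x => f x - (u x +i* v x)) =
  n1 (fun x => (ReC (f x) - u x)%:C) + n1 (fun x => (ImC (f x) - v x)%:C).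
Proof.
move=> f2 u2 v2.
have [_ r2] := L2_Re f2; have [_ i2'] := L2_Im f2.
have ru := L2B mH r2 u2; have iv := L2B mH i2' v2.
rewrite !nqR -RintegralD; [|exact: mH| |].
- by apply: eq_Rintegral => x _; rewrite !normc2E !CE /= !expr0n /= !addr0.
- by apply: eq_integrable (L2_int ru) => // [|x _]; [exact: mH|rewrite /= !normc2E !CE /= oppr0 addr0].
- by apply: eq_integrable (L2_int iv) => // [|x _]; [exact: mH|rewrite /= !normc2E !CE /= oppr0 addr0].
Qed.

Lemma L2_ReIm (u v : R -> R) : L2 (fun x => (u x)%:C) -> L2 (fun x => (v x)%:C) ->
  L2 (fun x => u x +i* v x).
Proof.
move=> u2 v2; apply: (L2_ext mH _ (L2D mH u2 (L2Z mH (0 +i* 1) v2))) => x _.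
by apply: Cext; rewrite !CE /=; ring.
Qed.

Lemma C1c_dense f e : L2 f -> 0 < e ->
  exists u v, [/\ C1c u, C1c v, L2 (fun x => u x +i* v x) &
    n1 (fun x => f x - (u x +i* v x)) <= e].
Proof.
move=> f2 e0; have e2 : 0 < e / 2 by rewrite divr_gt0.
have [mr r2] := L2_Re f2; have [mi i2'] := L2_Im f2.
have [u [cu u2 hu]] := real_C1c_dense mr r2 e2.
have [v [cv v2 hv]] := real_C1c_dense mi i2' e2.
exists u, v; split => //; first exact: L2_ReIm.
by rewrite n1_ReIm//; lra.
Qed.

(** Translation is a contraction of L^2 of the half line, so [v] may be replaced by a Lipschitz
    function of bounded support, for which the claim is an explicit estimate. *)
Lemma real_translate v e : measurable_fun (H : set RR) v -> L2 (fun x => (v x)%:C) -> 0 < e ->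
  exists2 d, 0 < d & forall s, 0 <= s -> s < d ->
    n1 (fun x => (v (x + s) - v x)%:C) <= e.
Proof.
move=> mv v2 e0; have e16 : 0 < e / 16 by rewrite divr_gt0.
have [a [b [M [h [L [a0 b0 hb hl hv]]]]]] := real_avg_dense mv v2 e16.
have h2 := bc_L2 hb.
(* The increment of [h] has squared norm at most [(L * s)^2 * b], which for [s <= 1] is at most
   [K * s]; the added 1 keeps [K] positive. *)
pose K := L ^+ 2 * b + 1; have K0 : 0 < K by rewrite ltr_wpDl// mulr_ge0// sqr_ge0.
have d0 : 0 < Num.min 1 (e / (8 * K)) by rewrite lt_min ltr01/= divr_gt0// mulr_gt0.
exists (Num.min 1 (e / (8 * K))) => // s s0; rewrite lt_min => /andP[s1 se].
have [bh2 bh] : L2 (fun x => (h (x + s) - h x)%:C) /\ n1 (fun x => (h (x + s) - h x)%:C) <= e / 8.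
  have [mh hM hs] := hb.
  have := @n1_real_bound (fun x => (h (x + s) - h x)%:C) ((L * s) ^+ 2) b.
  case=> //.
  - apply: cm_real; apply: measurable_funTS; apply: measurable_funB => //.
    by apply: (measurableT_comp mh); case: (@mpres_translate R s).
  - move=> x _; rewrite normc2E /= expr0n addr0 -real_normK ?num_real//.
    have := hl x (x + s); rewrite (_ : x + s - x = s); last by ring.
    rewrite (ger0_norm s0) => hx; rewrite ler_sqr// nnegrE//.
    exact: le_trans hx.
  - move=> x bx.
    have z y : b < y -> h y = 0.
      by move=> by'; apply/eqP; apply: contraTT by' => /hs /andP[_]; rewrite -leNgt.
    by rewrite !z ?subrr// ltr_wpDr.
  move=> A B; split => //; apply: le_trans B _.
  have : s ^+ 2 <= s by rewrite expr2 -[leRHS]mulr1 ler_wpM2l// ltW.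
  have sK : s * K < e / 8.
    by rewrite -ltr_pdivlMr// (lt_le_trans se)// invfM mulrA.
  have : 0 <= L ^+ 2 * b by rewrite mulr_ge0// sqr_ge0.
  rewrite exprMn => Lb ss; rewrite /K in sK.
  by apply: (@le_trans _ _ (L ^+ 2 * b * s)); [rewrite mulrAC; exact: ler_wpM2l|lra].
have vs2 := L2_back s0 v2; have hs2 := L2_back s0 h2.
have e1 : n1 (fun x => (v (x + s) - h (x + s))%:C) <= e / 16.
  apply: le_trans hv; apply: le_trans (n1_back_le s0 (_ : L2 (fun x => (v x - h x)%:C))).
    by rewrite le_eqVlt eqxx.
  by apply: (L2_ext mH _ (L2B mH v2 h2)) => x _; rewrite rmorphB.
have e3 : n1 (fun x => (h x - v x)%:C) <= e / 16.
  apply: le_trans hv; rewrite le_eqVlt; apply/orP; left; apply/eqP.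
  rewrite !nqR; apply: eq_Rintegral => x _; rewrite !normc2E /= expr0n !addr0.
  by rewrite -sqrrN opprB.
have e4 := n1_tri hs2 h2 v2 bh e3.
have e5 := n1_tri vs2 hs2 v2 e1 e4.
by apply: le_trans e5 _; lra.
Qed.

Lemma L2_translate f e : L2 f -> 0 < e -> exists2 d, 0 < d & forall s, 0 <= s -> s < d ->
  n1 (fun x => f (x + s) - f x) <= e.
Proof.
move=> f2 e0; have e2 : 0 < e / 2 by rewrite divr_gt0.
have [mr r2] := L2_Re f2; have [mi i2'] := L2_Im f2.
have [d1 d10 h1] := real_translate mr r2 e2.
have [d2 d20 h2] := real_translate mi i2' e2.
exists (Num.min d1 d2) => [|s s0]; first by rewrite lt_min d10.
rewrite lt_min => /andP[sd1 sd2].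
have b2 := L2_back s0 f2.
rewrite (@n1_ext _ _ (fun x => back s f x - (ReC (f x) +i* ImC (f x)))); last first.
  by move=> x _; rewrite /back; case: (f x).
rewrite n1_ReIm//; have := h1 s s0 sd1; have := h2 s s0 sd2; rewrite /back; lra.
Qed.

End Average.

Section RightLimits.
Variable R : realType.
Implicit Type u : R -> R.

Lemma cvg0_rightP u : (forall s, 0 <= u s) ->
  (u s @[s --> 0^'+] --> (0 : R)) <->
  (forall e, 0 < e -> exists2 d, 0 < d & forall s, 0 < s -> s < d -> u s <= e).
Proof.
move=> u0; split=> [/cvgr0Pnorm_le uc e e0|h].
  have [d /= d0 hd] := uc e e0; exists d => // s s0 sd.
  have := hd s; rewrite /= sub0r normrN gtr0_norm// ger0_norm//; exact.
apply/cvgr0Pnorm_le => e e0; have [d d0 hd] := h e e0.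
near=> s; rewrite ger0_norm//; apply: hd; near: s; first exact: nbhs_right_gt.
exact: nbhs_right_lt.
Unshelve. all: by end_near. Qed.

Lemma cvg0_sqrt (F : set_system R) (FF : Filter F) u :
  u s @[s --> F] --> (0 : R) -> Num.sqrt (u s) @[s --> F] --> (0 : R).
Proof.
move=> h; rewrite -[X in _ --> X]sqrtr0.
exact: (continuous_cvg _ (@sqrt_continuous R 0) h).
Qed.

Lemma rint_dct d (T : measurableType d) (mu : {measure set T -> \bar R})
    (D : set T) (w : nat -> T -> R) (g : T -> R) : measurable D ->
  (forall n, measurable_fun D (w n)) -> mu.-integrable D (EFin \o g) ->
  {ae mu, forall x, D x -> forall n, `|w n x| <= g x} ->
  {ae mu, forall x, D x -> w n x @[n --> \oo] --> (0 : R)} ->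
  Rintegral mu D (w n) @[n --> \oo] --> (0 : R).
Proof.
move=> mD mw gi wg w0.
have mF n : measurable_fun D (EFin \o w n) by apply/measurable_EFinP.
have h1 : {ae mu, forall x, D x -> (EFin \o w n) x @[n --> \oo] --> (cst 0 : T -> \bar R) x}.
  apply: (aeS _ w0) => x + Dx => /(_ Dx) h.
  by apply: cvg_EFin => //; exact: nearW.
have h2 : {ae mu, forall x n, D x -> (`|(EFin \o w n) x| <= (EFin \o g) x)%E}.
  by apply: (aeS _ wg) => x h n Dx; rewrite /= lee_fin; exact: h.
have [_ _ h] := dominated_convergence mD mF (measurable_cst _) h1 gi h2.
rewrite integral0 in h.
by move/fine_cvg : h.
Qed.

End RightLimits.

(** * Continuity and decay of translated kernels *)

Section KernelTranslation.
Variable R : realType.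
Notation leb := (@lebesgue_measure R).
Notation leb2 := (@leb2 R).
Notation RR := (measurableTypeR R).
Notation H := (@halfline R).
Notation Q := (@quadrant R).
Notation n1 := (nq leb H).
Notation n2 := (nq leb2 Q).
Notation i2 := (ip leb2 Q).
Notation mH := (@m_half R).
Notation mQ := (@m_quad R).
Implicit Types (k : R * R -> R[i]).

Lemma L2_tr2 s t k : 0 <= s -> 0 <= t -> isL2 leb2 Q k ->
  isL2 leb2 Q (fun p => k (p.1 + s, p.2 + t)) /\
  n2 (fun p => k (p.1 + s, p.2 + t)) <= n2 k.
Proof.
move=> s0 t0 k2; pose E : set (RR * RR) := [set x | s < x] `*` [set x | t < x].
have mE : measurable E by exact: measurableX (m_gt s) (m_gt t).
have EQ : E `<=` Q by move=> p [/= h1 h2]; split; [exact: le_lt_trans h1|exact: le_lt_trans h2].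
have pre : (fun p : RR * RR => (p.1 + s, p.2 + t)) @^-1` E = Q.
  by apply/seteqP; split => p [/= h1 h2]; split; move: h1 h2; rewrite /= ?ltrDr.
have kE := L2_sub mQ mE EQ k2.
split.
  by have := mpres_L2 (@mpres_translate2 R s t) mE kE; rewrite pre.
apply: le_trans (nq_sub mQ mE EQ k2); rewrite le_eqVlt; apply/orP; left; apply/eqP.
by rewrite -(mpres_nq (@mpres_translate2 R s t) mE (L2_cm kE)) pre.
Qed.

Lemma n2_swap k : isL2 leb2 Q k -> isL2 leb2 Q (fun p => k (p.2, p.1)) /\
  n2 (fun p => k (p.2, p.1)) = n2 k.
Proof.
move=> k2; have pre : (fun p : RR * RR => (p.2, p.1)) @^-1` Q = Q.
  by apply/seteqP; split => p [].
split.
  by have := mpres_L2 (@mpres_swap2 R) mQ k2; rewrite pre.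
by rewrite -(mpres_nq (@mpres_swap2 R) mQ (L2_cm k2)) pre.
Qed.

(** Continuity of translations holds on almost every section, and the squared norms of the
    increments are dominated by four times that of the section. *)
Lemma kernel_translate_snd k : isL2 leb2 Q k ->
  n2 (fun p => k (p.1, p.2 + s) - k p) @[s --> 0^'+] --> (0 : R).
Proof.
move=> k2; have [a b c] := L2sec k2.
apply/cvg_at_rightP => u [u0 uc].
have k2s n : isL2 leb2 Q (fun p => k (p.1, p.2 + u n)).
  apply: (L2_ext mQ _ (L2_tr2 (lexx 0) (ltW (u0 n)) k2).1) => p _.
  by rewrite addr0.
have d2 n : isL2 leb2 Q (fun p => k (p.1, p.2 + u n) - k p) by exact: (L2B mQ (k2s n) k2).
pose w n x := n1 (fun y => k (x, y + u n) - k (x, y)).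
have -> : (fun n => n2 (fun p => k (p.1, p.2 + u n) - k p)) = fun n => Rintegral leb H (w n).
  by apply/funext => n; have [_ _ ->] := L2sec (d2 n).
apply: (@rint_dct R _ RR leb H w (fun x => 4 * n1 (fun y => k (x, y))) mH).
- move=> n; have [_ h _] := L2sec (d2 n).
  by apply/measurable_EFinP; exact: measurable_int h.
- exact: (intZ mH).
- apply: (aeS _ a) => x + Hx n => /(_ Hx) kx; rewrite ger0_norm ?nq_ge0//.
  have ks := L2_back (ltW (u0 n)) kx.
  apply: le_trans (nqB_le mH ks kx) _.
  have := n1_back_le (ltW (u0 n)) kx; lra.
- apply: (aeS _ a) => x + Hx => /(_ Hx) kx.
  apply/cvg0P => [n|e e0]; first exact: nq_ge0.
  have [d d0 hd] := L2_translate kx e0.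
  have /cvgr0Pnorm_lt/(_ d d0)[N _ hN] := uc.
  exists N => n Nn; apply: hd; first exact: ltW.
  by have := hN n Nn; rewrite gtr0_norm.
Qed.

Lemma kernel_translate_fst k : isL2 leb2 Q k ->
  n2 (fun p => k (p.1 + s, p.2) - k p) @[s --> 0^'+] --> (0 : R).
Proof.
move=> k2; have [l2 _] := n2_swap k2.
apply: cvg_trans (kernel_translate_snd l2); apply: near_eq_cvg; near=> s.
have s0 : 0 <= s by near: s; exact: nbhs_right_ge.
have d2 : isL2 leb2 Q (fun p => k (p.1 + s, p.2) - k p).
  apply: (L2B mQ _ k2); apply: (L2_ext mQ _ (L2_tr2 s0 (lexx 0) k2).1) => p _.
  by rewrite addr0.
by rewrite -(n2_swap d2).2; apply: n2_ext => -[x y] _.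
Unshelve. all: by end_near. Qed.

(** The diagonal translation is split into one in [x] followed by one in [y]; the error of the
    former is carried along by the latter, which is a contraction. *)
Lemma kernel_translate k : isL2 leb2 Q k ->
  n2 (fun p => shift_kernel s k p - k p) @[s --> 0^'+] --> (0 : R).
Proof.
move=> k2.
have : 2 * n2 (fun p => k (p.1 + s, p.2) - k p) + 2 * n2 (fun p => k (p.1, p.2 + s) - k p)
    @[s --> 0^'+] --> (2 * (0 : R) + 2 * (0 : R)).
  by apply: cvgD; apply: cvgMr; [exact: kernel_translate_fst|exact: kernel_translate_snd].
rewrite !mulr0 addr0 => h.
apply: (squeeze_cvgr _ _ h); last exact: cvg_cst.
near=> s; have s0 : 0 <= s by near: s; exact: nbhs_right_ge.
rewrite nq_ge0/=.
have a2 : isL2 leb2 Q (fun p => k (p.1 + s, p.2)).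
  by apply: (L2_ext mQ _ (L2_tr2 s0 (lexx 0) k2).1) => p _; rewrite addr0.
have b2 : isL2 leb2 Q (fun p => k (p.1, p.2 + s)).
  by apply: (L2_ext mQ _ (L2_tr2 (lexx 0) s0 k2).1) => p _; rewrite addr0.
have ab2 := L2B mQ a2 k2; have bb2 := L2B mQ b2 k2.
have [c2 hc] := L2_tr2 (lexx 0) s0 ab2.
have -> : n2 (fun p => shift_kernel s k p - k p) =
    n2 (fun p => (k (p.1 + 0 + s, p.2 + s) - k (p.1 + 0, p.2 + s)) + (k (p.1, p.2 + s) - k p)).
  by apply: n2_ext => -[x y] _; rewrite /shift_kernel /= !addr0 addrA subrK.
apply: le_trans (nqD_le mQ c2 bb2) _.
by rewrite lerD2r ler_wpM2l.
Unshelve. all: by end_near. Qed.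

(** The norm of the translate is that of [k] restricted to [Qt t], and every point of the quadrant
    eventually leaves these sets. *)
Lemma kernel_vanish k : isL2 leb2 Q k -> n2 (shift_kernel t k) @[t --> +oo] --> (0 : R).
Proof.
move=> k2; apply/cvg_pinftyP => u uc.
pose w n p := if (u n < p.1) && (u n < p.2) then k p else 0.
have mw n : @cmeasurable _ (RR * RR)%type R Q (w n).
  apply: (cm_if mQ (m_Qtb (u n))).
  by apply: (cm_sub mQ) (L2_cm k2); [exact: measurableI mQ (m_Qtb (u n))|exact: subIsetl].
have h : n2 (w n) @[n --> \oo] --> (0 : R).
  apply: (nq_dct mQ mw (L2_int k2)).
    by apply: aeW => p _ n; rewrite /w; case: ifP => _//; rewrite normc_0 expr0n sqr_ge0.
  apply: aeW => p _; apply/cvg0P => [n|e e0]; first exact: sqr_ge0.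
  have /cvgryPgt/(_ p.1)[N _ hN] := uc.
  exists N => n Nn; have un : p.1 < u n by exact: hN.
  by rewrite /w ltNge (ltW un)/= normc_0 expr0n/= ltW.
apply: cvg_trans h; apply: near_eq_cvg.
have /cvgryPge/(_ 0)[N _ hN] := uc; exists N => // n Nn.
have un := hN n Nn.
rewrite (n2_shift_kernel un k2) /w -(Q_Qt un).
exact: (@nq_if _ (RR * RR)%type R leb2 Q (fun p => (u n < p.1) && (u n < p.2))).
Qed.

(** The forward translation is isometric and dual to the backward one, so the squared increment
    equals [- 2 Re <k, k_s - k>]; continuity follows from that of the backward translation. *)
Lemma fkernel_continuous k : isL2 leb2 Q k ->
  n2 (fun p => fkernel s k p - k p) @[s --> 0^'+] --> (0 : R).
Proof.
move=> k2.
have hk : n2 k * n2 (fun p => shift_kernel s k p - k p) @[s --> 0^'+] --> n2 k * (0 : R).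
  by apply: cvgMr; exact: kernel_translate.
rewrite mulr0 in hk.
have : 2 * Num.sqrt (n2 k * n2 (fun p => shift_kernel s k p - k p)) @[s --> 0^'+] --> 2 * (0 : R).
  by apply: cvgMr; exact: cvg0_sqrt hk.
rewrite mulr0 => h; apply: (squeeze_cvgr _ _ h); last exact: cvg_cst.
near=> s; have s0 : 0 <= s by near: s; exact: nbhs_right_ge.
rewrite nq_ge0/=.
have f2 := L2_fkernel s0 k2; have sk2 := L2_shift_kernel s0 k2.
have d2 := L2B mQ sk2 k2.
have -> : n2 (fun p => fkernel s k p - k p) =
    2 * - ReC (i2 k (fun p => shift_kernel s k p - k p)).
  rewrite (nqB mQ f2 k2) n2_fkernel// i2_fkernel// (ipBr mQ sk2 k2 k2) !CE -nq_ip.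
  by move: (n2 k) (ReC _) => x y; ring.
rewrite ler_wpM2l//; apply: le_trans (ler_norm _) _.
rewrite normrN -sqrtr_sqr ler_wsqrtr//; exact: (CS_Re mQ).
Unshelve. all: by end_near. Qed.

End KernelTranslation.

(** * The two semigroups on Hilbert-Schmidt operators *)

Section Semigroups.
Variable R : realType.
Notation leb := (@lebesgue_measure R).
Notation leb2 := (@leb2 R).
Notation H := (@halfline R).
Notation Q := (@quadrant R).
Notation n1 := (nq leb H).
Notation n2 := (nq leb2 Q).
Implicit Types (f : R -> R[i]) (k l : R * R -> R[i]).

Variables (e : nat -> R -> R[i]) (eb : is_onb e).
Implicit Types A B : op R.

Lemma kernel_opeq A B k : L2kernel A k -> L2kernel B k -> opeq A B.
Proof.
move=> /L2kernelP[_ hA] /L2kernelP[_ hB] f f2.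
exact: L2eq_trans (hA _ f2) (L2eq_sym (hB _ f2)).
Qed.

Lemma kernel_lin (a : R[i]) A B k l : L2kernel A k -> L2kernel B l ->
  L2kernel (op_add (op_scale a A) B) (fun p => a * k p + l p).
Proof.
move=> /L2kernelP[k2 hA] /L2kernelP[l2 hB]; apply/L2kernelP; split; first exact: L2k_lin.
move=> f f2; apply: L2eq_trans _ (L2eq_sym (Kop_link a k2 l2 f2)).
by apply: (aeS2 _ (hA _ f2) (hB _ f2)) => x h1 h2 Hx; rewrite /op_add /op_scale h1// h2.
Qed.

Lemma kernel_sub A B k l : L2kernel A k -> L2kernel B l ->
  L2kernel (op_sub A B) (fun p => k p - l p).
Proof.
move=> hA hB; have := kernel_lin (-1) hB hA.
rewrite (_ : op_add _ _ = op_sub A B); last first.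
  by apply/funext => f; apply/funext => x; rewrite /op_add /op_scale /op_sub mulN1r addrC.
by rewrite (_ : (fun p => _) = (fun p => k p - l p))//; apply/funext => p; rewrite mulN1r addrC.
Qed.

Lemma kernel_scale (a : R[i]) A k : L2kernel A k ->
  L2kernel (op_scale a A) (fun p => a * k p).
Proof.
move=> hA; have := kernel_lin (a - 1) hA hA.
rewrite (_ : op_add _ _ = op_scale a A); last first.
  by apply/funext => f; apply/funext => x; rewrite /op_add /op_scale; ring.
by rewrite (_ : (fun p => _) = (fun p => a * k p))//; apply/funext => p; ring.
Qed.

Lemma HSnorm_kernel A k : bounded_op A -> L2kernel A k -> HSnorm A = Num.sqrt (n2 k).
Proof. by move=> [A2 _ _]; exact: HSnormE eb A2. Qed.

Lemma sigma_semigroup : C0_contraction_semigroup (@sigma R).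
Proof.
split.
- move=> t A t0 [bA hA]; have [k Ak] := HS_kernel (conj bA hA).
  by apply: (kernel_HS eb (bounded_sigma (ltW t0) bA)); exact: (sigma_kernel (ltW t0) bA Ak).
- move=> t a A B t0 [bA _] [bB _] f f2.
  have [A2 _ _] := bA; have [B2 _ _] := bB; have s2 := L2_shift (ltW t0) f2.
  have [_ Sl _] := bounded_adj_shift (ltW t0).
  exact: Sl a _ _ (A2 _ s2) (B2 _ s2).
- move=> s t A s0 t0 [bA hA]; have [k Ak] := HS_kernel (conj bA hA).
  have st0 : 0 <= s + t by rewrite addr_ge0// ltW.
  apply: kernel_opeq (sigma_kernel st0 bA Ak) _.
  have -> : shift_kernel (s + t) k = shift_kernel s (shift_kernel t k).
    by apply/funext => p; rewrite /shift_kernel /= !addrA.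
  exact: (sigma_kernel (ltW s0) (bounded_sigma (ltW t0) bA) (sigma_kernel (ltW t0) bA Ak)).
- move=> t A t0 [bA hA]; have [k Ak] := HS_kernel (conj bA hA).
  rewrite (HSnorm_kernel bA Ak) (HSnorm_kernel (bounded_sigma (ltW t0) bA) (sigma_kernel (ltW t0) bA Ak)).
  have [k2 _] := (L2kernelP _ _).1 Ak.
  by rewrite ler_wsqrtr// n2_shift_kernel_le// ltW.
- move=> A [bA hA]; have [k Ak] := HS_kernel (conj bA hA).
  have [k2 _] := (L2kernelP _ _).1 Ak.
  apply: cvg_trans (cvg0_sqrt _ (kernel_translate k2)); apply: near_eq_cvg; near=> t.
  have t0 : 0 <= t by near: t; exact: nbhs_right_ge.
  rewrite (HSnorm_kernel (bounded_sub (bounded_sigma t0 bA) bA)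
    (kernel_sub (sigma_kernel t0 bA Ak) Ak)) //.
Unshelve. all: by end_near. Qed.

Lemma sigma_tilde_semigroup : C0_contraction_semigroup (@sigma_tilde R).
Proof.
split.
- move=> t A t0 [bA hA]; have [k Ak] := HS_kernel (conj bA hA).
  by apply: (kernel_HS eb (bounded_sigma_tilde (ltW t0) bA)); exact: (sigma_tilde_kernel (ltW t0) bA Ak).
- move=> t a A B t0 _ _ f f2; apply: aeW => x _.
  rewrite /sigma_tilde /op_comp /op_add /op_scale /Defs.shift.
  by case: ifP; rewrite ?mulr0 ?addr0.
- move=> s t A s0 t0 [bA hA]; have [k Ak] := HS_kernel (conj bA hA).
  have st0 : 0 <= s + t by rewrite addr_ge0// ltW.
  apply: kernel_opeq (sigma_tilde_kernel st0 bA Ak) _.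
  have -> : fkernel (s + t) k = fkernel s (fkernel t k).
    apply/funext => -[x y]; rewrite /fkernel /= !ltrBrDl !opprD !addrA.
    case: (ltP (s + t) x) => [sx|_] /=; last by rewrite if_same.
    case: (ltP (s + t) y) => [sy|_] /=; last by rewrite if_same.
    by rewrite !(lt_trans _ sx) ?(lt_trans _ sy) ?ltrDl.
  exact: (sigma_tilde_kernel (ltW s0) (bounded_sigma_tilde (ltW t0) bA) (sigma_tilde_kernel (ltW t0) bA Ak)).
- move=> t A t0 [bA hA]; have [k Ak] := HS_kernel (conj bA hA).
  rewrite (HSnorm_kernel bA Ak) (HSnorm_kernel (bounded_sigma_tilde (ltW t0) bA) (sigma_tilde_kernel (ltW t0) bA Ak)).
  have [k2 _] := (L2kernelP _ _).1 Ak.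
  by rewrite n2_fkernel// ltW.
- move=> A [bA hA]; have [k Ak] := HS_kernel (conj bA hA).
  have [k2 _] := (L2kernelP _ _).1 Ak.
  apply: cvg_trans (cvg0_sqrt _ (fkernel_continuous k2)); apply: near_eq_cvg; near=> t.
  have t0 : 0 <= t by near: t; exact: nbhs_right_ge.
  rewrite (HSnorm_kernel (bounded_sub (bounded_sigma_tilde t0 bA) bA)
    (kernel_sub (sigma_tilde_kernel t0 bA Ak) Ak)) //.
Unshelve. all: by end_near. Qed.

Lemma sigma_vanish A : HS A -> HSnorm (sigma t A) @[t --> +oo] --> (0 : R) /\
   forall f : R -> R[i], L2 f -> L2norm (sigma t A f) @[t --> +oo] --> (0 : R).
Proof.
move=> [bA hA]; have [k Ak] := HS_kernel (conj bA hA).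
have [k2 _] := (L2kernelP _ _).1 Ak; have kv := kernel_vanish k2.
split.
  apply: cvg_trans (cvg0_sqrt _ kv); apply: near_eq_cvg; near=> t.
  have t0 : 0 <= t by near: t; exact: nbhs_pinfty_ge.
  by rewrite (HSnorm_kernel (bounded_sigma t0 bA) (sigma_kernel t0 bA Ak)).
move=> f f2.
have : Num.sqrt (n2 (shift_kernel t k) * n1 f) @[t --> +oo] --> (0 : R).
  by apply: cvg0_sqrt; rewrite -(mul0r (n1 f)); apply: cvgMl.
move=> h; apply: (squeeze_cvgr _ _ h); last exact: cvg_cst.
near=> t; have t0 : 0 <= t by near: t; exact: nbhs_pinfty_ge.
rewrite L2normE sqrtr_ge0/= ler_wsqrtr//.
have [s2 sE] := (L2kernelP _ _).1 (sigma_kernel t0 bA Ak).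
have [Kf2 Kfb] := Kop_bound s2 f2.
rewrite (L2eq_n1 _ Kf2 (sE _ f2))//.
by have [+ _ _] := bounded_sigma t0 bA; apply.
Unshelve. all: by end_near. Qed.

(** Multiplicativity holds because the backward shift is a left inverse of the forward shift; the
    duality is that of the two translations of kernels. *)
Lemma sigma_tilde_mul A B t : 0 < t -> HS A -> HS B ->
  opeq (sigma_tilde t (op_comp A B)) (op_comp (sigma_tilde t A) (sigma_tilde t B)) /\
  HSinner (sigma_tilde t A) B = HSinner A (sigma t B).
Proof.
move=> /ltW t0 [bA hA] [bB hB]; have [k Ak] := HS_kernel (conj bA hA).
have [l Bl] := HS_kernel (conj bB hB).
have [k2 _] := (L2kernelP _ _).1 Ak; have [l2 _] := (L2kernelP _ _).1 Bl.
have [A2 _ _] := bA; have [B2 _ _] := bB.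
split.
  move=> f f2; have [a2 _ _] := bounded_adj_shift t0.
  have b2 := B2 _ (a2 _ f2); have sb2 := L2_shift t0 b2.
  rewrite /sigma_tilde /op_comp; apply: (shift_ae).
  apply: (bounded_ae bA b2 (a2 _ sb2)); apply: L2eq_sym.
  apply: L2eq_trans (adj_shift t0 sb2) _.
  apply: aeW => x Hx; rewrite /back /Defs.shift addrK.
  by move: Hx; rewrite /halfline /= => ->.
have [s2 _ _] := bounded_sigma t0 bB; have [st2 _ _] := bounded_sigma_tilde t0 bA.
rewrite (HSinnerE eb st2 (sigma_tilde_kernel t0 bA Ak) B2 Bl).
rewrite (HSinnerE eb A2 Ak s2 (sigma_kernel t0 bB Bl)).
exact: i2_fkernel.
Qed.

End Semigroups.

(** * Test functions and the generator *)

Section PlaneTopology.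
Variable R : realType.
Notation RR := (measurableTypeR R).
Implicit Types (u w : R * R -> R) (p q : R * R).

(** This ties the topology of the plane to the product sigma-algebra: an open set is the countable
    union of the boxes with rational center and radius [1 / (n + 1)] that it contains, the other
    boxes being replaced by the empty set. *)
Lemma open_measurable2 (U : set (R * R)) : open U -> measurable (U : set (RR * RR)).
Proof.
move=> oU.
pose B (x y : rat) n : set (RR * RR) :=
  ball (ratr x : R) (n.+1%:R^-1 : R) `*` ball (ratr y : R) (n.+1%:R^-1 : R).
pose G x y n : set (RR * RR) := if `[< B x y n `<=` U >] then B x y n else set0.
have -> : U = \bigcup_x \bigcup_y \bigcup_n G x y n.
  apply/seteqP; split => [[x y] Uxy|p [a _ [b _ [n _]]]]; last first.
    by rewrite /G; case: asboolP => // h; exact: h.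
  move: (oU); rewrite openE => /(_ _ Uxy)/nbhs_ballP[e /= e0 he].
  have [n hn] : exists n, n.+1%:R^-1 + n.+1%:R^-1 < e :> R.
    exists (Num.truncn (2 / e)).
    have h := truncnS_gt (2 / e); rewrite -mulr2n -[ltLHS]mulr_natl.
    by rewrite ltr_pdivrMr// -ltr_pdivrMl// mulrC.
  have n0 : 0 < (n.+1%:R^-1 : R) by rewrite invr_gt0.
  have rb (z : R) : exists q : rat, ball (ratr q : R) (n.+1%:R^-1 : R) z.
    have /rat_in_itvoo[q /itvP qre] : z < z + n.+1%:R^-1 by rewrite ltrDl.
    exists q; rewrite /ball /= ger0_norm ?subr_ge0 ?qre//.
    by rewrite ltrBlDr addrC qre.
  have [a ha] := rb x; have [b hb] := rb y.
  exists a => //; exists b => //; exists n => //; rewrite /G asboolT//.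
  move=> [x' y'] [/= h1 h2]; apply: he; split => /=.
    by apply: le_ball (ltW hn) _ _; exact: ball_triangle (ball_sym ha) h1.
  by apply: le_ball (ltW hn) _ _; exact: ball_triangle (ball_sym hb) h2.
apply: bigcupT_measurable_rat => x; apply: bigcupT_measurable_rat => y.
apply: bigcupT_measurable => n; rewrite /G; case: ifP => // _.
by apply: measurableX; apply: open_measurable; exact: ball_open.
Qed.

Lemma continuous_measurable2 w : continuous w -> measurable_fun (setT : set (RR * RR)) w.
Proof.
move=> /continuousP cw; apply: (measurability _ (RGenOpens.measurableE R)).
move=> _ [_ [a [b ->] <-]]; rewrite setTI; apply: open_measurable2.
exact/cw/interval_open.
Qed.

Lemma continuous_box_bounded w (a b : R) : continuous w ->
  (forall p, w p != 0 -> a <= p.1 <= b /\ a <= p.2 <= b) ->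
  exists2 M, 0 <= M & forall p, `|w p| <= M.
Proof.
move=> cw hw.
have cK : compact (`[a, b]%classic `*` `[a, b]%classic : set (R * R)).
  by apply: compact_setX; exact: segment_compact.
have : bounded_set (w @` (`[a, b]%classic `*` `[a, b]%classic)).
  by apply: compact_bounded; apply: continuous_compact => //; exact: continuous_subspaceT.
move=> /ex_strict_bound_gt0[M M0 hM]; exists M; first exact: ltW.
move=> p; have [->|/hw[p1 p2]] := eqVneq (w p) 0; first by rewrite normr0 ltW.
by apply/ltW/hM; exists p => //; split; rewrite /= in_itv.
Qed.

Lemma pairD (a b c d : R) : (a, b) + (c, d) = (a + c, b + d) :> R * R.
Proof. by []. Qed.

Lemma pairZ (h a b : R) : h *: ((a, b) : R * R) = (h * a, h * b).
Proof. by []. Qed.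

Definition dtr (s : R) w : R * R -> R := fun p => w (p.1 + s, p.2 + s).

Lemma is_derive_diag_at u p (s : R) : differentiable u (p.1 + s, p.2 + s) ->
  is_derive s 1 (fun r => u (p.1 + r, p.2 + r)) (rdiag_deriv u (p.1 + s, p.2 + s)).
Proof.
move=> dq; set q := (p.1 + s, p.2 + s) in dq *.
have E : rdiag_deriv u q = 'D_((1, 1) : R * R) u q.
  rewrite /rdiag_deriv !deriveE// -linearD; congr ('d u q _).
  by transitivity ((1 + 0, 0 + 1) : R * R); rewrite // addr0 add0r.
have F : (fun h : R => h^-1 *: (((fun r => u (p.1 + r, p.2 + r)) \o shift s) (h *: (1 : R)) -
    u (p.1 + s, p.2 + s))) = (fun h : R => h^-1 *: ((u \o shift q) (h *: ((1, 1) : R * R)) - u q)).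
  apply/funext => h /=; congr (_ *: (u _ - _)).
  by rewrite /q pairZ pairD; congr pair; rewrite addrCA.
split; first by rewrite /derivable F; exact: diff_derivable.
by rewrite /derive F E.
Qed.

Lemma is_derive_diag u p (s : R) : (forall q, differentiable u q) ->
  is_derive s 1 (fun r => u (p.1 + r, p.2 + r)) (rdiag_deriv u (p.1 + s, p.2 + s)).
Proof. by move=> du; exact: is_derive_diag_at. Qed.

Lemma bounded_derive_lip (f df : R -> R) (M : R) : (forall x : R, is_derive x 1 f (df x)) ->
  (forall x, `|df x| <= M) -> forall x y, `|f y - f x| <= M * `|y - x|.
Proof.
move=> fd dM.
have h x y : x <= y -> `|f y - f x| <= M * `|y - x|.
  move=> xy; have cf : {within `[x, y], continuous f}.
    apply: continuous_subspaceT => z; have [d _] := fd z.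
    exact/differentiable_continuous/derivable1_diffP.
  have [c _ ->] := MVT_segment xy (fun z _ => fd z) cf.
  by rewrite normrM ler_wpM2r.
move=> x y; have [/h//|/ltW/h] := leP x y.
by rewrite distrC [X in _ -> _ <= _ * X]distrC.
Qed.

Lemma derive_dtr u s p (e : R * R) : 'D_e (dtr s u) p = 'D_e u (p.1 + s, p.2 + s).
Proof.
rewrite /derive; set F := (X in lim (X @ _) = _); set G := (X in _ = lim (X @ _)).
suff -> : F = G by [].
rewrite /F /G; case: e {F G} => e1 e2; case: p => p1 p2; apply/funext => h.
by rewrite /dtr /= pairZ !pairD /= !addrA.
Qed.

Lemma rdiag_dtr u s p : rdiag_deriv (dtr s u) p = rdiag_deriv u (p.1 + s, p.2 + s).
Proof. by rewrite /rdiag_deriv !derive_dtr. Qed.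

Lemma continuous_dtr w s : continuous w -> continuous (dtr s w).
Proof.
move=> cw p; have -> : dtr s w = w \o (fun q => q + (s, s)) by apply/funext => -[x y].
apply: continuous_comp; last exact: cw.
by apply: cvgD; [exact: cvg_id|exact: cvg_cst].
Qed.

Lemma differentiable_dtr u s p : (forall q, differentiable u q) -> differentiable (dtr s u) p.
Proof.
move=> du.
have -> : dtr s u = u \o (fun q => q + (s, s)) by apply/funext => -[x y].
by apply: differentiable_comp.
Qed.

(** For [s <= 0] the support moves away from the axes; a positive [s] could push it out of the
    quadrant. *)
Lemma test_dtr u s : s <= 0 -> test_function u -> test_function (dtr s u).
Proof.
move=> s0 [du c1 c2 [a [b [a0 hs]]]]; split.
- by move=> p; exact: differentiable_dtr.
- rewrite (_ : (fun p => _) = dtr s (fun p => 'D_((1, 0) : R * R) u p)); first exact: continuous_dtr.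
  by apply/funext => p; rewrite derive_dtr.
- rewrite (_ : (fun p => _) = dtr s (fun p => 'D_((0, 1) : R * R) u p)); first exact: continuous_dtr.
  by apply/funext => p; rewrite derive_dtr.
- exists (a - s), (b - s); split; first by rewrite subr_gt0 (le_lt_trans s0).
  by move=> p /hs /=; rewrite !lerBlDr !lerBrDr.
Qed.

Lemma test_continuous u : test_function u -> continuous u.
Proof. by move=> [du _ _ _] p; exact: differentiable_continuous. Qed.

Lemma test_rd_continuous u : test_function u -> continuous (rdiag_deriv u).
Proof. by move=> [_ c1 c2 _] p; apply: cvgD; [exact: c1|exact: c2]. Qed.

(** The same box contains the support of the derivative: [u] vanishes on the complement of the
    closed box, which is open. *)
Lemma test_bound u : test_function u -> exists a b M, [/\ 0 < a, 0 <= M,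
  forall p, `|u p| <= M, forall p, `|rdiag_deriv u p| <= M &
  forall p, (u p != 0 \/ rdiag_deriv u p != 0) -> a <= p.1 <= b /\ a <= p.2 <= b].
Proof.
move=> tu; have cu := test_continuous tu; have cd := test_rd_continuous tu.
case: (tu) => du _ _ [a [b [a0 hs]]].
have ds p : rdiag_deriv u p != 0 -> a <= p.1 <= b /\ a <= p.2 <= b.
  move=> dp; apply: contrapT => np.
  have : \forall q \near p, u q = 0.
    pose K : set (R * R) := `[a, b]%classic `*` `[a, b]%classic.
    have cK : closed K.
      by apply: compact_closed; [exact: norm_hausdorff|apply: compact_setX; exact: segment_compact].
    have : open (~` K) by exact: closed_openC.
    rewrite openE => /(_ p); rewrite /interior => h.
    have : nbhs p (~` K) by apply: h => -[/= h1 h2]; apply: np; move: h1 h2; rewrite !in_itv.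
    apply: filterS => q Kq; apply/eqP; apply: contrapT => /negP/hs[h1 h2]; apply: Kq.
    by split; rewrite /= in_itv.
  move=> hn; move/eqP: dp; apply.
  by rewrite /rdiag_deriv !(near_eq_derive _ hn) ?derive_cst ?addr0.
have [M1 M10 h1] := continuous_box_bounded cu hs.
have [M2 M20 h2] := continuous_box_bounded cd ds.
exists a, b, (Num.max M1 M2); split => //.
- by rewrite le_max M10.
- by move=> p; rewrite le_max h1.
- by move=> p; rewrite le_max h2 orbT.
- by move=> p [/hs|/ds].
Qed.

End PlaneTopology.

(** * Pairings of kernels with translated test functions *)

Section Pairing.
Variable R : realType.
Notation leb2 := (@leb2 R).
Notation RR := (measurableTypeR R).
Notation Q := (@quadrant R).
Notation n2 := (nq leb2 Q).
Notation i2 := (ip leb2 Q).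
Notation mQ := (@m_quad R).
Implicit Types (g : R -> R[i]) (k : R * R -> R[i]).

Implicit Types (u w : R * R -> R) (p : R * R).

Definition rC w : R * R -> R[i] := fun p => (w p)%:C.

Lemma bounded_L2 w b M : measurable_fun (setT : set (RR * RR)) w ->
  (forall p, `|w p| <= M) -> (forall p, w p != 0 -> p.1 <= b /\ p.2 <= b) ->
  isL2 leb2 Q (rC w).
Proof.
move=> mw wM ws.
pose c x := \1_(`]0, b] : set RR) x : R.
have c2 : L2 (fun x => (c x)%:C).
  apply: (@bc_L2 R 0 b 1 c); split.
  - by apply: measurable_indic; exact: measurable_itv.
  - by move=> x; rewrite /c indicE; case: (x \in _); rewrite ?normr1 ?normr0.
  - move=> x; rewrite /c indicE; case: (boolP (x \in _)) => [/set_mem/=|_]; last by rewrite eqxx.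
    by rewrite in_itv/= => /andP[/ltW -> ->].
have [t2 _] := L2tensor c2 c2.
apply: (L2_le mQ _ _ (L2_int (L2Z mQ M%:C t2))).
  by apply: cm_real; exact: measurable_funTS.
move=> [x y] [/= x0 y0]; rewrite !normc2E !CE /= !(mulr0, mul0r, subr0, addr0, expr0n) /= ?addr0.
have [->|/ws[/= xb yb]] := eqVneq (w (x, y)) 0; first by rewrite expr0n /= sqr_ge0.
have cE z : 0 < z -> z <= b -> c z = 1 by move=> z0 zb; rewrite /c indicE mem_set//= in_itv/= z0.
rewrite !cE// !mulr1 -real_normK ?num_real// ler_sqr ?nnegrE//.
exact: le_trans (wM (x, y)).
Qed.

Lemma test_L2 u : test_function u -> isL2 leb2 Q (rC u).
Proof.
move=> tu; have [a [b [M [a0 M0 h1 _ h3]]]] := test_bound tu.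
apply: (bounded_L2 (b := b) (M := M)) => //.
  exact: (continuous_measurable2 (test_continuous tu)).
by move=> p up; have [] := h3 p (or_introl up); move=> /andP[_ ->] /andP[_ ->].
Qed.

Lemma test_rd_L2 u : test_function u -> isL2 leb2 Q (rC (rdiag_deriv u)).
Proof.
move=> tu; have [a [b [M [a0 M0 _ h2 h3]]]] := test_bound tu.
apply: (bounded_L2 (b := b) (M := M)) => //.
  exact: (continuous_measurable2 (test_rd_continuous tu)).
by move=> p up; have [] := h3 p (or_intror up); move=> /andP[_ ->] /andP[_ ->].
Qed.

Lemma dtr_L2 u s : test_function u -> isL2 leb2 Q (rC (dtr s u)).
Proof.
move=> tu; have [a [b [M [a0 M0 h1 _ h3]]]] := test_bound tu.
apply: (bounded_L2 (b := b - s) (M := M)) => //.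
  exact: (continuous_measurable2 (continuous_dtr (test_continuous tu))).
  by move=> p; exact: h1.
by move=> p up; have [] := h3 _ (or_introl up); rewrite /= !lerBrDr; move=> /andP[_ ->] /andP[_ ->].
Qed.

(* The difference quotient along the backward diagonal flow tends to minus the
   diagonal derivative, so that [dquot u r] tends to 0. *)
Definition dquot u r : R * R -> R := fun p => r^-1 * (dtr (- r) u p - u p) + rdiag_deriv u p.

Lemma dquot_L2 u r : test_function u -> isL2 leb2 Q (rC (dquot u r)).
Proof.
move=> tu.
have := L2D mQ (L2Z mQ (r^-1)%:C (L2B mQ (dtr_L2 (- r) tu) (test_L2 tu))) (test_rd_L2 tu).
by apply: (L2_ext mQ) => p _; apply: Cext; rewrite !CE /rC /dquot /=; ring.
Qed.

Lemma dquot_bound u a b M r p : test_function u ->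
  (forall p, `|rdiag_deriv u p| <= M) ->
  (forall p, (u p != 0 \/ rdiag_deriv u p != 0) -> a <= p.1 <= b /\ a <= p.2 <= b) ->
  r != 0 -> `|r| <= 1 ->
  `|dquot u r p| <= 2 * M /\ (dquot u r p != 0 -> p.1 <= b + 1 /\ p.2 <= b + 1).
Proof.
move=> [du _ _ _] uM us r0 r1; split.
  apply: le_trans (ler_normD _ _) _; rewrite mulr_natl mulr2n lerD//.
  have := bounded_derive_lip (fun s => is_derive_diag p s du) (fun s => uM _) 0 (- r).
  rewrite normrM normfV ler_pdivrMl ?normr_gt0// subr0 normrN !addr0 /dtr mulrC.
  by case: p.
move=> h; have : u (p.1 - r, p.2 - r) != 0 \/ (u p != 0 \/ rdiag_deriv u p != 0).
  apply: contrapT => /not_orP[/negP h1 /not_orP[/negP h2 /negP h3]].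
  move: h1 h2 h3 h; rewrite !negbK => /eqP h1 /eqP h2 /eqP h3.
  by rewrite /dquot /dtr h1 h2 h3 subrr mulr0 addr0 eqxx.
move: r1; rewrite ler_norml => /andP[r1 r2].
case=> [hu|/us[/andP[_ h1] /andP[_ h2]]]; last by split; lra.
have [/= /andP[_ h1] /andP[_ h2]] := us _ (or_introl hu).
by split; lra.
Qed.

Lemma dquot_cvg u : test_function u -> n2 (rC (dquot u r)) @[r --> 0^'] --> (0 : R).
Proof.
move=> tu; have [a [b [M [a0 M0 h1 h2 h3]]]] := test_bound tu.
have [du _ _ _] := tu.
apply/cvgr_dnbhsP => r [r0 rc].
(* Switching off the finitely many terms with [|r n| > 1] gives all remaining ones the bound [2 * M]
   and a support with coordinates at most [b + 1]. *)
pose w n := if `|r n| <= 1 then rC (dquot u (r n)) else fun=> 0.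
have b2 := bounded_L2 (w := fun p => 2 * M * (\1_([set q : RR * RR | q.1 <= b + 1] `&` [set q | q.2 <= b + 1]) p : R)).
have mE : measurable ([set q : RR * RR | q.1 <= b + 1] `&` [set q : RR * RR | q.2 <= b + 1]).
  rewrite (_ : _ `&` _ = (`]-oo, b + 1]%classic : set RR) `*` (`]-oo, b + 1]%classic : set RR)).
    by apply: measurableX; exact: measurable_itv.
  by apply/seteqP; split => [[x y] [/= h h']|[x y] [/=]]; rewrite ?in_itv//= => h h'; split; rewrite /= in_itv.
have {}b2 : isL2 leb2 Q (rC (fun p => 2 * M * (\1_([set q : RR * RR | q.1 <= b + 1] `&` [set q | q.2 <= b + 1]) p : R))).
  apply: (b2 (b + 1) (2 * M)).
  - by apply: measurable_funM => //; exact: measurable_indic.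
  - move=> p; rewrite normrM ger0_norm ?mulr_ge0// indicE; case: (_ \in _); rewrite ?normr1 ?normr0 ?mulr1 ?mulr0 ?mulr_ge0//.
  - move=> p; rewrite indicE; case: (boolP (_ \in _)) => [/set_mem[]//|_].
    by rewrite mulr0 eqxx.
have : n2 (w n) @[n --> \oo] --> (0 : R).
  apply: (nq_dct mQ _ (L2_int b2)).
  - move=> n; rewrite /w; case: ifP => _; last exact: cm_cst.
    exact: L2_cm (dquot_L2 _ tu).
  - apply: aeW => p _ n; rewrite /w; case: ifP => [rn|_]; last by rewrite normc_0 expr0n sqr_ge0.
    have [q1 q2] := dquot_bound p tu h2 h3 (r0 n) rn.
    rewrite !normc2E /= expr0n !addr0.
    have [->|/q2[p1 p2]] := eqVneq (dquot u (r n) p) 0; first by rewrite expr0n /= sqr_ge0.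
    by rewrite indicE mem_set// mulr1 -real_normK ?num_real// ler_sqr ?nnegrE// mulr_ge0.
  - apply: aeW => p _.
    have [dd dv] := is_derive_diag p 0 du.
    have : dquot u (r n) p @[n --> \oo] --> (- rdiag_deriv u p + rdiag_deriv u p).
      rewrite /dquot; apply: cvgD; last exact: cvg_cst.
      pose F s := u (p.1 + s, p.2 + s).
      have cF : (fun h : R => h^-1 *: (F (h *: (1 : R) + 0) - F 0)) @ 0^' --> rdiag_deriv u p.
        have -> : rdiag_deriv u p = rdiag_deriv u (p.1 + 0, p.2 + 0) by rewrite !addr0; case: (p).
        rewrite -dv; exact: dd.
      have c1 : (forall n, - r n != 0) /\ - r n @[n --> \oo] --> (0 : R).
        by split; [move=> n; rewrite oppr_eq0|rewrite -oppr0; exact: cvgN].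
      have {}hc := cvgN ((cvgr_dnbhsP _ _ _).1 cF (fun n => - r n) c1).
      apply: cvg_trans (hc _); apply: near_eq_cvg; apply: nearW => n /=.
      have E (y z : R) : - ((- r n)^-1 *: (y - z)) = (r n)^-1 * (y - z).
        by rewrite invrN scaleNr opprK.
      have E2 : (- r n)%:A + 0 = - r n :> R by rewrite addr0; exact: mulr1.
      transitivity (- ((- r n)^-1 *: (F ((- r n)%:A + 0) - F 0))) => //.
      by rewrite E E2 /F !addr0; case: (p).
    rewrite addNr => hc.
    have /cvgr0Pnorm_le/(_ 1 ltr01)[N _ hN] := rc.
    rewrite (_ : 0 = (0 : R) ^+ 2); last by rewrite expr0n.
    apply: cvg_trans (_ : (dquot u (r n) p) ^+ 2 @[n --> \oo] --> (0 : R) ^+ 2); last first.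
      by rewrite expr2; apply: cvgM.
    apply: near_eq_cvg; exists N => // n Nn; rewrite /w ifT; last exact: hN.
    by rewrite normc2E /= expr0n addr0.
apply: cvg_trans; apply: near_eq_cvg.
have /cvgr0Pnorm_le/(_ 1 ltr01)[N _ hN] := rc.
by exists N => // n Nn; rewrite /w ifT//; exact: hN.
Qed.

Lemma ci_rC k w : isL2 leb2 Q k -> isL2 leb2 Q (rC w) ->
  cintegrable leb2 Q (fun p => k p * rC w p).
Proof. by move=> k2 w2; exact: (L2M_ci mQ k2 w2). Qed.

Lemma cI_rC k w : cintegral leb2 Q (fun p => k p * (w p)%:C) = i2 k (rC w).
Proof. by rewrite ipE; apply: cI_ext => p _; rewrite /rC conjc_real. Qed.

(** The translation is put on the test function, where both signs of [r] make sense. The limit is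
    thus two-sided, and yields the genuine derivative that the mean value theorem requires. *)
Lemma pair_derive k u : isL2 leb2 Q k -> test_function u ->
  r^-1 * (ReC (i2 k (rC (dtr (- r) u))) - ReC (i2 k (rC u))) @[r --> 0^'] -->
  - ReC (i2 k (rC (rdiag_deriv u))).
Proof.
move=> k2 tu; have u2 := test_L2 tu; have d2 := test_rd_L2 tu.
have E r : r^-1 * (ReC (i2 k (rC (dtr (- r) u))) - ReC (i2 k (rC u))) =
    ReC (i2 k (rC (dquot u r))) - ReC (i2 k (rC (rdiag_deriv u))).
  have s2 := dtr_L2 (- r) tu; have q2 := dquot_L2 r tu; have su2 := L2B mQ s2 u2.
  have -> : i2 k (rC (dquot u r)) =
      i2 k (fun p => (r^-1)%:C * (rC (dtr (- r) u) p - rC u p) + rC (rdiag_deriv u) p).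
    apply: (ip_aer mQ) => //; first exact: (L2D mQ (L2Z mQ _ su2) d2).
    by apply: aeW => p _; apply: Cext; rewrite !CE /rC /dquot /=; ring.
  rewrite (ipDr mQ (L2Z mQ _ su2) d2 k2) (ipZr mQ _ su2 k2) (ipBr mQ s2 u2 k2) !CE /=.
  by rewrite oppr0 mul0r subr0 addrK.
rewrite (_ : (fun r => _) = fun r => ReC (i2 k (rC (dquot u r))) - ReC (i2 k (rC (rdiag_deriv u))));
  last by apply/funext => r; exact: E.
rewrite -[X in _ --> X]add0r; apply: cvgB; last exact: cvg_cst.
have h : Num.sqrt (n2 k * n2 (rC (dquot u r))) @[r --> 0^'] --> (0 : R).
  have hk : n2 k * n2 (rC (dquot u r)) @[r --> 0^'] --> n2 k * (0 : R).
    by apply: cvgMr; exact: dquot_cvg.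
  by rewrite mulr0 in hk; exact: cvg0_sqrt hk.
apply/norm_cvg0P; apply: (squeeze_cvgr _ _ h); last exact: cvg_cst.
apply: nearW => r; rewrite normr_ge0/= -sqrtr_sqr ler_wsqrtr//.
exact: (CS_Re mQ k2 (dquot_L2 r tu)).
Qed.

(** Forward translation with extension by zero agrees on the quadrant with plain translation of [u],
    because [u] vanishes off the quadrant. *)
Lemma shift_pair k u s : 0 <= s -> isL2 leb2 Q k -> test_function u ->
  i2 (shift_kernel s k) (rC u) = i2 k (rC (dtr (- s) u)).
Proof.
move=> s0 k2 tu; have u2 := test_L2 tu.
have sk2 := L2_shift_kernel s0 k2.
have [a [b [M [a0 _ _ _ h3]]]] := test_bound tu.
rewrite (ipJ mQ u2 sk2) -(i2_fkernel s0 u2 k2) -(ipJ mQ (L2_fkernel s0 u2) k2).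
apply: (ip_aer mQ) => //; [exact: L2_fkernel|exact: dtr_L2|].
apply: aeW => p _; rewrite /fkernel /rC /dtr; case: ifPn => // /nandP hp.
suff -> : u (p.1 - s, p.2 - s) = 0 by [].
apply/eqP; apply: contraT => up; have [/= /andP[p1 _] /andP[p2 _]] := h3 _ (or_introl up).
by move: hp; rewrite -!leNgt; case=> hp; exfalso; lra.
Qed.

Lemma weakP (k g : R * R -> R[i]) : isL2 leb2 Q k -> isL2 leb2 Q g ->
  weak_diag_deriv k g <->
  (forall u, test_function u -> i2 k (rC (rdiag_deriv u)) = - i2 g (rC u)).
Proof.
move=> k2 g2; split=> [[_ _ h] u tu|h].
  by have [_ _] := h u tu; rewrite !cI_rC.
split; [exact: L2_cm k2|exact: L2_cm g2|] => u tu.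
have u2 := test_L2 tu; have d2 := test_rd_L2 tu.
split; [exact: ci_rC|exact: ci_rC|].
by rewrite !cI_rC; exact: h.
Qed.

(** The pairing of the difference quotient minus [g] with [u] has two limits: 0 by Cauchy-Schwarz,
    and the combination of pairings given by [pair_derive]. *)
Lemma gen_weak_Re (k g : R * R -> R[i]) u : isL2 leb2 Q k -> isL2 leb2 Q g -> test_function u ->
  n2 (fun p => (t^-1)%:C * (shift_kernel t k p - k p) - g p) @[t --> 0^'+] --> (0 : R) ->
  ReC (i2 k (rC (rdiag_deriv u))) = - ReC (i2 g (rC u)).
Proof.
move=> k2 g2 tu hc; have u2 := test_L2 tu.
have c1 : r^-1 * (ReC (i2 k (rC (dtr (- r) u))) - ReC (i2 k (rC u))) - ReC (i2 g (rC u))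
   @[r --> 0^'+] --> - ReC (i2 k (rC (rdiag_deriv u))) - ReC (i2 g (rC u)).
  apply: cvgB; last exact: cvg_cst.
  by apply: cvg_dnbhs_at_right; exact: pair_derive.
suff c2 : r^-1 * (ReC (i2 k (rC (dtr (- r) u))) - ReC (i2 k (rC u))) - ReC (i2 g (rC u))
   @[r --> 0^'+] --> (0 : R).
  have h : - ReC (i2 k (rC (rdiag_deriv u))) - ReC (i2 g (rC u)) = 0 :> R :=
    etrans (esym (cvg_lim (@Rhausdorff R) c1)) (cvg_lim (@Rhausdorff R) c2).
  by rewrite -(subr0_eq (h _ _)) opprK.
have h : Num.sqrt (n2 (fun p => (t^-1)%:C * (shift_kernel t k p - k p) - g p) * n2 (rC u))
    @[t --> 0^'+] --> (0 : R).
  have hk : n2 (fun p => (t^-1)%:C * (shift_kernel t k p - k p) - g p) * n2 (rC u)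
      @[t --> 0^'+] --> (0 : R) * n2 (rC u) by apply: cvgMl.
  by rewrite mul0r in hk; exact: cvg0_sqrt hk.
apply/norm_cvg0P; apply: (squeeze_cvgr _ _ h); last exact: cvg_cst.
near=> r; have r0 : 0 <= r by near: r; exact: nbhs_right_ge.
have sk2 := L2_shift_kernel r0 k2; have d2 := L2B mQ sk2 k2.
rewrite normr_ge0/= -sqrtr_sqr ler_wsqrtr// -(shift_pair r0 k2 tu).
apply: le_trans (CS_Re mQ (L2B mQ (L2Z mQ (r^-1)%:C d2) g2) u2).
rewrite (ipBl mQ (L2Z mQ (r^-1)%:C d2) g2 u2) (ipZl mQ _ d2 u2) (ipBl mQ sk2 k2 u2) !CE /=.
by rewrite mul0r subr0.
Unshelve. all: by end_near. Qed.

Lemma gen_weak (k g : R * R -> R[i]) : isL2 leb2 Q k -> isL2 leb2 Q g ->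
  n2 (fun p => (t^-1)%:C * (shift_kernel t k p - k p) - g p) @[t --> 0^'+] --> (0 : R) ->
  weak_diag_deriv k g.
Proof.
move=> k2 g2 hc; apply/weakP => // u tu.
have u2 := test_L2 tu; have d2 := test_rd_L2 tu.
(* The imaginary part is the real part of the statement for [i * k] and [i * g]. *)
pose i : R[i] := 0 +i* 1.
have ik2 := L2Z mQ i k2; have ig2 := L2Z mQ i g2.
have := gen_weak_Re ik2 ig2 tu; rewrite (ipZl mQ _ k2 d2) (ipZl mQ _ g2 u2) => hi.
apply: Cext; rewrite !CE; first exact: gen_weak_Re.
have {}hi : ReC (i * i2 k (rC (rdiag_deriv u))) = - ReC (i * i2 g (rC u)).
  apply: hi; apply: cvg_trans hc; apply: near_eq_cvg; near=> t.
  have t0 : 0 <= t by near: t; exact: nbhs_right_ge.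
  have sk2 := L2_shift_kernel t0 k2; have s2 := L2B mQ sk2 k2.
  have E (j a b c d : R[i]) : d * (j * a - j * b) - j * c = j * (d * (a - b) - c) by ring.
  have -> : n2 (fun p => (t^-1)%:C * (shift_kernel t (fun x => i * k x) p - i * k p) - i * g p) =
      n2 (fun p => i * ((t^-1)%:C * (shift_kernel t k p - k p) - g p)).
    by apply: n2_ext => p _; exact: E.
  by rewrite (nqZ mQ _ (L2B mQ (L2Z mQ _ s2) g2)) normc2E /= expr0n expr1n add0r mul1r.
by move: hi; rewrite !CE /= !mul0r !mul1r !sub0r => /oppr_inj ->.
Unshelve. all: by end_near. Qed.

End Pairing.

(** * Linear combinations and tensor products of test functions *)

Section TestFunctions.
Variable R : realType.
Implicit Types (u v : R * R -> R) (f h : R -> R) (p e : R * R).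

Lemma is_derive_lin u v (a : R) p e : differentiable u p -> differentiable v p ->
  differentiable (fun q => a * u q + v q) p /\
  'D_e (fun q => a * u q + v q) p = a * 'D_e u p + 'D_e v p.
Proof.
move=> du dv; have E : (fun q => a * u q + v q) = a *: u + v by [].
have dau : differentiable (a *: u) p by exact: differentiableZ.
split; first by rewrite E; exact: differentiableD.
by rewrite E deriveD ?deriveZ//; exact: diff_derivable.
Qed.

Lemma test_lin u v (a : R) : test_function u -> test_function v ->
  test_function (fun p => a * u p + v p).
Proof.
move=> [du u1 u2 [a1 [b1 [a10 h1]]]] [dv v1 v2 [a2 [b2 [a20 h2]]]]; split.
- by move=> p; case: (is_derive_lin a 0 (du p) (dv p)).
- rewrite (_ : 'D_((1, 0) : R * R) (fun p => a * u p + v p) = fun p => a * 'D_((1, 0) : R * R) u p + 'D_((1, 0) : R * R) v p).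
    by move=> p; apply: cvgD; [apply: cvgMr; exact: u1|exact: v1].
  by apply/funext => p; case: (is_derive_lin a (1, 0) (du p) (dv p)).
- rewrite (_ : 'D_((0, 1) : R * R) (fun p => a * u p + v p) = fun p => a * 'D_((0, 1) : R * R) u p + 'D_((0, 1) : R * R) v p).
    by move=> p; apply: cvgD; [apply: cvgMr; exact: u2|exact: v2].
  by apply/funext => p; case: (is_derive_lin a (0, 1) (du p) (dv p)).
- exists (Num.min a1 a2), (Num.max b1 b2); split; first by rewrite lt_min a10.
  move=> p hp; have [up|up] := eqVneq (u p) 0.
    have /h2[/andP[x1 x2] /andP[x3 x4]] : v p != 0.
      by apply: contra_neq hp => ->; rewrite up mulr0 addr0.
    by rewrite !ge_min !le_max x1 x2 x3 x4 !orbT.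
  have [/andP[x1 x2] /andP[x3 x4]] := h1 _ up.
  by rewrite !ge_min !le_max x1 x2 x3 x4.
Qed.

Lemma deriv_fst f p e : derivable f p.1 1 ->
  differentiable (fun q : R * R => f q.1) p /\ 'D_e (fun q : R * R => f q.1) p = e.1 * derive1 f p.1.
Proof.
move=> /derivable1_diffP df.
have d1 : differentiable (fst : R * R -> R) p.
  by apply: linear_differentiable => q; exact: cvg_fst.
have dd : differentiable (fun q : R * R => f q.1) p by exact: (differentiable_comp d1 df).
split=> //; rewrite deriveE// (diff_comp d1 df) /= diff_lin; last by move=> q; exact: cvg_fst.
transitivity ('d f (p.1) (e.1 *: (1 : R))); first by congr ('d f _ _); rewrite [RHS]mulr1.
by rewrite linearZ derive1E'.
Qed.

Lemma deriv_snd f p e : derivable f p.2 1 ->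
  differentiable (fun q : R * R => f q.2) p /\ 'D_e (fun q : R * R => f q.2) p = e.2 * derive1 f p.2.
Proof.
move=> /derivable1_diffP df.
have d1 : differentiable (snd : R * R -> R) p.
  by apply: linear_differentiable => q; exact: cvg_snd.
have dd : differentiable (fun q : R * R => f q.2) p by exact: (differentiable_comp d1 df).
split=> //; rewrite deriveE// (diff_comp d1 df) /= diff_lin; last by move=> q; exact: cvg_snd.
transitivity ('d f (p.2) (e.2 *: (1 : R))); first by congr ('d f _ _); rewrite [RHS]mulr1.
by rewrite linearZ derive1E'.
Qed.

Lemma test_tensor f h : C1c f -> C1c h -> test_function (fun p => f p.1 * h p.2).
Proof.
move=> [df cf [a1 [b1 [a10 h1]]]] [dh ch [a2 [b2 [a20 h2]]]].
have D p e : differentiable (fun p : R * R => f p.1 * h p.2) p /\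
    'D_e (fun p : R * R => f p.1 * h p.2) p = f p.1 * (e.2 * derive1 h p.2) + h p.2 * (e.1 * derive1 f p.1).
  have [d1 e1] := deriv_fst e (df p.1); have [d2 e2] := deriv_snd e (dh p.2).
  have E : (fun p : R * R => f p.1 * h p.2) = (fun q => f q.1) * (fun q => h q.2) by [].
  split; first by rewrite E; exact: differentiableM.
  by rewrite E deriveM ?e1 ?e2//; exact: diff_derivable.
have c1 (w : R -> R) : continuous w -> continuous (fun q : R * R => w q.1).
  by move=> cw q; apply: (@continuous_comp _ _ _ fst w); [exact: cvg_fst|exact: cw].
have c2 (w : R -> R) : continuous w -> continuous (fun q : R * R => w q.2).
  by move=> cw q; apply: (@continuous_comp _ _ _ snd w); [exact: cvg_snd|exact: cw].
have cf0 : continuous f by move=> x; apply/differentiable_continuous/derivable1_diffP.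
have ch0 : continuous h by move=> x; apply/differentiable_continuous/derivable1_diffP.
split.
- by move=> p; case: (D p 0).
- rewrite (_ : 'D_((1, 0) : R * R) (fun p : R * R => f p.1 * h p.2) = fun p => h p.2 * derive1 f p.1).
    by move=> p; apply: cvgM; [exact: (c2 _ ch0)|exact: (c1 _ cf)].
  by apply/funext => p; rewrite (D _ _).2 /= mul0r mulr0 add0r mul1r.
- rewrite (_ : 'D_((0, 1) : R * R) (fun p : R * R => f p.1 * h p.2) = fun p => f p.1 * derive1 h p.2).
    by move=> p; apply: cvgM; [exact: (c1 _ cf0)|exact: (c2 _ ch)].
  by apply/funext => p; rewrite (D _ _).2 /= mul0r mulr0 addr0 mul1r.
- exists (Num.min a1 a2), (Num.max b1 b2); split; first by rewrite lt_min a10.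
  move=> p; rewrite mulf_eq0 negb_or => /andP[/h1/andP[x1 x2] /h2/andP[x3 x4]].
  by rewrite !ge_min !le_max x1 x2 x3 x4 !orbT.
Qed.

End TestFunctions.

(** * Density of test functions and the generator *)

Section Generator.
Variable R : realType.
Notation leb := (@lebesgue_measure R).
Notation leb2 := (@leb2 R).
Notation RR := (measurableTypeR R).
Notation H := (@halfline R).
Notation Q := (@quadrant R).
Notation n1 := (nq leb H).
Notation n2 := (nq leb2 Q).
Notation i2 := (ip leb2 Q).
Notation mH := (@m_half R).
Notation mQ := (@m_quad R).
Implicit Types (f g : R -> R[i]) (k l : R * R -> R[i]).

Implicit Types (s t : R) (u : R * R -> R) (p : R * R) (U : R * R -> R[i]).

Definition test_C U := test_function (fun p => ReC (U p)) /\ test_function (fun p => ImC (U p)).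

Lemma test_C_L2 U : test_C U -> isL2 leb2 Q U.
Proof.
move=> [/test_L2 r2 /test_L2 m2].
have := L2D mQ r2 (L2Z mQ (0 +i* 1) m2); apply: (L2_ext mQ) => p _.
by apply: Cext; rewrite !CE /rC /=; ring.
Qed.

Lemma test_C_tensor (f1 f2 g1 g2 : R -> R) : C1c f1 -> C1c f2 -> C1c g1 -> C1c g2 ->
  test_C (fun p => (f1 p.1 +i* f2 p.1) * (g1 p.2 +i* g2 p.2)).
Proof.
move=> a1 a2 b1 b2; split.
- rewrite (_ : (fun p => _) = fun p => (-1) * (f2 p.1 * g2 p.2) + f1 p.1 * g1 p.2).
    by apply: test_lin; exact: test_tensor.
  by apply/funext => p; rewrite CE /=; ring.
- rewrite (_ : (fun p => _) = fun p => 1 * (f1 p.1 * g2 p.2) + f2 p.1 * g1 p.2).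
    by apply: test_lin; exact: test_tensor.
  by apply/funext => p; rewrite CE /=; ring.
Qed.

Definition approximable k := forall e : R, 0 < e -> exists2 U, test_C U & n2 (fun p => k p - U p) <= e.

Lemma approximable_tensor f g : L2 f -> L2 g -> approximable (fun p => f p.1 * g p.2).
Proof.
move=> f2 g2 e e0.
have le (x y : R) : x <= e / 4 -> y <= e / 4 -> 2 * x + 2 * y <= e by lra.
have e1 : 0 < e / (4 * (n1 g + 1)) by rewrite divr_gt0// mulr_gt0// ltr_wpDl// nq_ge0.
have [u1 [v1 [cu1 cv1 h2 h]]] := C1c_dense f2 e1.
pose f' x := u1 x +i* v1 x.
(* The second tolerance depends on the approximant [f'] already chosen, because the error splits as
   [(f - f') g + f' (g - g')]. *)
have e2 : 0 < e / (4 * (n1 f' + 1)) by rewrite divr_gt0// mulr_gt0// ltr_wpDl// nq_ge0.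
have [u3 [v3 [cu3 cv3 h4 h']]] := C1c_dense g2 e2.
exists (fun p => f' p.1 * (u3 p.2 +i* v3 p.2)); first exact: test_C_tensor.
pose g' x := u3 x +i* v3 x.
have d1 := L2B mH f2 h2; have d2 := L2B mH g2 h4.
have [t1 E1] := L2tensor d1 g2; have [t2 E2] := L2tensor h2 d2.
have -> : n2 (fun p => f p.1 * g p.2 - f' p.1 * (u3 p.2 +i* v3 p.2)) =
    n2 (fun p => (f p.1 - f' p.1) * g p.2 + f' p.1 * (g p.2 - g' p.2)).
  by apply: n2_ext => p _; rewrite /g'; ring.
apply: le_trans (nqD_le mQ t1 t2) _; rewrite E1 E2.
have a1 : n1 (fun x => f x - f' x) * n1 g <= e / 4.
  apply: (@le_trans _ _ (e / (4 * (n1 g + 1)) * (n1 g + 1))).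
    apply: ler_pM; rewrite ?nq_ge0//; last by rewrite lerDl.
  have g0 : n1 g + 1 != 0 by rewrite gt_eqF// ltr_wpDl// nq_ge0.
  by rewrite le_eqVlt; apply/orP; left; apply/eqP; field.
have a2 : n1 f' * n1 (fun x => g x - g' x) <= e / 4.
  apply: (@le_trans _ _ ((n1 f' + 1) * (e / (4 * (n1 f' + 1))))).
    apply: ler_pM; rewrite ?nq_ge0//; last by rewrite lerDl.
  have g0 : n1 f' + 1 != 0 by rewrite gt_eqF// ltr_wpDl// nq_ge0.
  by rewrite le_eqVlt; apply/orP; left; apply/eqP; field.
exact: le a1 a2.
Qed.

Lemma test_C_add U V : test_C U -> test_C V -> test_C (fun p => U p + V p).
Proof.
move=> [a1 a2] [b1 b2]; split.
- rewrite (_ : (fun p => _) = fun p => 1 * ReC (U p) + ReC (V p)); first exact: test_lin.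
  by apply/funext => p; rewrite CE mul1r.
- rewrite (_ : (fun p => _) = fun p => 1 * ImC (U p) + ImC (V p)); first exact: test_lin.
  by apply/funext => p; rewrite CE mul1r.
Qed.

Lemma test_C0 : test_C (fun=> 0).
Proof.
have t0 : test_function (fun _ : R * R => 0 : R).
  split.
  - by move=> p; exact: differentiable_cst.
  - rewrite (_ : (fun p => _) = fun=> 0); first exact: cst_continuous.
    by apply/funext => p; rewrite derive_cst.
  - rewrite (_ : (fun p => _) = fun=> 0); first exact: cst_continuous.
    by apply/funext => p; rewrite derive_cst.
  - by exists 1, 1; split => // p; rewrite eqxx.
by split.
Qed.

Lemma approximable_near k : isL2 leb2 Q k ->
  (forall e : R, 0 < e -> exists l, [/\ isL2 leb2 Q l, approximable l & n2 (fun p => k p - l p) <= e]) ->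
  approximable k.
Proof.
move=> k2 h e e0; have e4 : 0 < e / 4 by rewrite divr_gt0.
have [l [l2 la le]] := h _ e4; have [U tU hU] := la _ e4.
exists U => //; have U2 := test_C_L2 tU.
have -> : n2 (fun p => k p - U p) = n2 (fun p => (k p - l p) + (l p - U p)).
  by apply: n2_ext => p _; rewrite addrA subrK.
apply: le_trans (nqD_le mQ (L2B mQ k2 l2) (L2B mQ l2 U2)) _; lra.
Qed.

Lemma approximable_add k l : isL2 leb2 Q k -> isL2 leb2 Q l ->
  approximable k -> approximable l -> approximable (fun p => k p + l p).
Proof.
move=> k2 l2 ka la e e0; have e4 : 0 < e / 4 by rewrite divr_gt0.
have [U tU hU] := ka _ e4; have [V tV hV] := la _ e4.
exists (fun p => U p + V p); first exact: test_C_add.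
have U2 := test_C_L2 tU; have V2 := test_C_L2 tV.
have -> : n2 (fun p => k p + l p - (U p + V p)) = n2 (fun p => (k p - U p) + (l p - V p)).
  by apply: n2_ext => p _; ring.
apply: le_trans (nqD_le mQ (L2B mQ k2 U2) (L2B mQ l2 V2)) _; lra.
Qed.

(** The operator of [k] is Hilbert-Schmidt, so uniqueness of kernels makes [k] an L^2 limit of
    finite sums of tensors, each of which is approximable. *)
Lemma approximable_all (e : nat -> R -> R[i]) k : is_onb e -> isL2 leb2 Q k -> approximable k.
Proof.
move=> eb k2.
have Kk : L2kernel (Kop k) k by apply/L2kernelP; split => // f _; exact: L2eq_refl.
have [l [a [b [lk a2 b2 lc]]]] := HS_kernel_series (kernel_HS eb (bounded_Kop k2) Kk).
have [l2 _] := (L2kernelP _ _).1 lk.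
have kl := kernel_unique eb Kk lk.
have S2 n : isL2 leb2 Q (fun p => \sum_(i < n) a i p.1 * b i p.2).
  exact: (L2_sum mQ n (fun i => (L2tensor (a2 i) (b2 i)).1)).
apply: approximable_near => // d d0.
have [N hN] := (cvg0P (fun n => nq_ge0 leb2 Q _)).1 lc _ d0.
exists (fun p => \sum_(i < N) a i p.1 * b i p.2); split => //; last first.
  apply: le_trans (hN N (leqnn N)); rewrite (nqB_sym mQ k2 (S2 N)).
  rewrite le_eqVlt; apply/orP; left; apply/eqP.
  apply: (nq_ae mQ (L2B mQ (S2 N) k2) (L2B mQ (S2 N) l2)).
  by apply: (aeS _ kl) => p h Qp; rewrite h.
elim: N {hN} => [|N IH].
  move=> c c0; exists (fun=> 0); first exact: test_C0.
  rewrite (_ : n2 _ = 0) ?ltW//; apply: (ae_nq0 mQ); last by apply: aeW => p _; rewrite big_ord0 subr0.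
  by apply: (L2_ext mQ _ (@L2_0 _ (RR * RR)%type R leb2 Q mQ)) => p _; rewrite big_ord0 subr0.
have := approximable_add (S2 N) (L2tensor (a2 N) (b2 N)).1 IH (approximable_tensor (a2 N) (b2 N)).
by rewrite (_ : (fun p => _) = fun p => \sum_(i < N.+1) a i p.1 * b i p.2)//;
  apply/funext => p; rewrite big_ord_recr.
Qed.

(* Both sides are compared through [0 <= n2 (k - U)] with [U] close to [k], which
   avoids extracting square roots from Cauchy-Schwarz. *)
Lemma test_dual k (e : R) : isL2 leb2 Q k -> approximable k ->
  (forall U, test_C U -> 2 * ReC (i2 k U) <= e + n2 U) -> n2 k <= e.
Proof.
move=> k2 ka h; apply/ler_addgt0Pr => d d0; have [U tU hU] := ka _ d0.
have := h U tU; have := nqB mQ k2 (test_C_L2 tU); lra.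
Qed.

(** The derivative at [s] is the derivative at 0 for the translated function [dtr (- s) u], which is
    again a test function because [s >= 0]. *)
Lemma translate_derive k l u s : isL2 leb2 Q k -> isL2 leb2 Q l -> weak_diag_deriv k l ->
  test_function u -> 0 <= s ->
  is_derive s (1 : R) (fun r => ReC (i2 k (rC (dtr (- r) u)))) (ReC (i2 l (rC (dtr (- s) u)))).
Proof.
move=> k2 l2 kl tu s0; have sn : - s <= 0 by rewrite oppr_le0.
have tsu := test_dtr sn tu.
have ds := pair_derive k2 tsu.
rewrite ((weakP k2 l2).1 kl _ tsu) !CE opprK in ds.
have E : (fun h : R => h^-1 *: (((fun r => ReC (i2 k (rC (dtr (- r) u)))) \o shift s) (h *: (1 : R)) -
      ReC (i2 k (rC (dtr (- s) u))))) =
    (fun r => r^-1 * (ReC (i2 k (rC (dtr (- r) (dtr (- s) u)))) - ReC (i2 k (rC (dtr (- s) u))))).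
  apply/funext => h /=; congr (_ * (ReC (i2 k (rC _)) - _)); apply/funext => p.
  have -> : h%:A + s = h + s by congr (_ + _); exact: mulr1.
  by rewrite /dtr /= opprD !addrA.
split; first by rewrite /derivable E; apply/cvg_ex; eexists; exact: ds.
by rewrite /derive E; apply: cvg_lim.
Qed.

Lemma i2_test_C k U : isL2 leb2 Q k -> test_C U ->
  ReC (i2 k U) = ReC (i2 k (rC (fun p => ReC (U p)))) +
    ReC (i2 (fun p => (0 +i* 1)^* * k p) (rC (fun p => ImC (U p)))).
Proof.
move=> k2 [/test_L2 r2 /test_L2 m2]; have im2 := L2Z mQ (0 +i* 1) m2.
rewrite (ipZl mQ _ k2 m2) -(ipZr mQ _ m2 k2) -ReD -(ipDr mQ r2 im2 k2); congr ReC.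
rewrite !ipE; apply: cI_ext => p _; congr (_ * _^*).
by apply: Cext; rewrite !CE /rC /=; ring.
Qed.

(* The mean value theorem for [s |-> Re <k_s, U>], whose derivative is
   [Re <l_s, U>]. *)
Lemma increment_dual k l U t : isL2 leb2 Q k -> isL2 leb2 Q l -> weak_diag_deriv k l ->
  test_C U -> 0 < t -> exists2 c, 0 < c < t &
    ReC (i2 (fun p => (t^-1)%:C * (shift_kernel t k p - k p) - l p) U) =
    ReC (i2 (fun p => shift_kernel c l p - l p) U).
Proof.
move=> k2 l2 kl tU t0; have [tu tv] := tU; have U2 := test_C_L2 tU.
pose j : R[i] := (0 +i* 1)^*.
have jk2 := L2Z mQ j k2; have jl2 := L2Z mQ j l2.
have jkl : weak_diag_deriv (fun p => j * k p) (fun p => j * l p).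
  apply/weakP => // w tw; have w2 := test_L2 tw; have dw2 := test_rd_L2 tw.
  by rewrite (ipZl mQ _ k2 dw2) (ipZl mQ _ l2 w2) ((weakP k2 l2).1 kl _ tw) mulrN.
pose u p := ReC (U p); pose v p := ImC (U p).
pose D s := ReC (i2 k (rC (dtr (- s) u))) + ReC (i2 (fun p => j * k p) (rC (dtr (- s) v))).
pose d s := ReC (i2 l (rC (dtr (- s) u))) + ReC (i2 (fun p => j * l p) (rC (dtr (- s) v))).
have Dd s : 0 <= s -> is_derive s (1 : R) D (d s).
  move=> s0; have h1 := translate_derive k2 l2 kl tu s0.
  have h2 := translate_derive jk2 jl2 jkl tv s0.
  exact: is_deriveD.
have cD : {within `[0, t], continuous D}.
  apply: continuous_in_subspaceT => s; rewrite inE /= in_itv/= => /andP[s0 _].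
  by have [ds _] := Dd s s0; exact/differentiable_continuous/derivable1_diffP.
have [s|c /itvP ct eq] := @MVT R D d 0 t t0 _ cD.
  by rewrite in_itv/= => /andP[/ltW s0 _]; exact: Dd.
have c0 : 0 <= c by rewrite ltW// ct.
have t0' := ltW t0.
exists c; first by rewrite !ct.
have st2 := L2_shift_kernel t0' k2; have sc2 := L2_shift_kernel c0 l2.
have Pk s (m : R * R -> R[i]) : isL2 leb2 Q m -> 0 <= s ->
    ReC (i2 (shift_kernel s m) U) = ReC (i2 m (rC (dtr (- s) u))) + ReC (i2 (fun p => j * m p) (rC (dtr (- s) v))).
  move=> m2 s0; rewrite (i2_test_C (L2_shift_kernel s0 m2) tU) (shift_pair s0 m2 tu).
  by rewrite -(shift_pair s0 (L2Z mQ j m2) tv).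
have P0 (m : R * R -> R[i]) : isL2 leb2 Q m -> ReC (i2 m U) = ReC (i2 m (rC (dtr (- 0) u))) +
    ReC (i2 (fun p => j * m p) (rC (dtr (- 0) v))).
  move=> m2; rewrite -(Pk 0 m m2 (lexx _)); congr (ReC (i2 _ U)).
  by apply/funext => -[x y]; rewrite /shift_kernel /= !addr0.
rewrite (ipBl mQ (L2Z mQ _ (L2B mQ st2 k2)) l2 U2) (ipZl mQ _ (L2B mQ st2 k2) U2).
rewrite (ipBl mQ st2 k2 U2) (ipBl mQ sc2 l2 U2) !CE /= mul0r subr0; congr (_ - _).
rewrite (Pk t k k2 t0') (P0 k k2) (Pk c l l2 c0) -/(D t) -/(D 0) -/(d c) eq subr0.
by rewrite mulrC mulfK ?gt_eqF.
Qed.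

Lemma weak_gen (e : nat -> R -> R[i]) k l : is_onb e -> isL2 leb2 Q k -> isL2 leb2 Q l ->
  weak_diag_deriv k l ->
  n2 (fun p => (t^-1)%:C * (shift_kernel t k p - k p) - l p) @[t --> 0^'+] --> (0 : R).
Proof.
move=> eb k2 l2 kl; apply/cvg0_rightP => [s|d d0]; first exact: nq_ge0.
have [a a0 ha] := (cvg0_rightP (fun s => nq_ge0 leb2 Q _)).1 (kernel_translate l2) _ d0.
exists a => // t t0 ta; have t0' := ltW t0.
have h2 := L2B mQ (L2Z mQ (t^-1)%:C (L2B mQ (L2_shift_kernel t0' k2) k2)) l2.
apply: (test_dual h2 (approximable_all eb h2)) => U tU.
have [c /andP[c0 ct] ->] := increment_dual k2 l2 kl tU t0.
have sl2 := L2B mQ (L2_shift_kernel (ltW c0) l2) l2.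
have := ha c c0 (lt_trans ct ta); have := nqB mQ sl2 (test_C_L2 tU).
have := nq_ge0 leb2 Q (fun p => shift_kernel c l p - l p - U p).
by move: (n2 _) (n2 U) (n2 _) (ReC _) => x y z r; lra.
Qed.

Lemma generator_diag_deriv (e : nat -> R -> R[i]) (A B : op R) : is_onb e ->
  generator (@sigma R) A B <-> diag_deriv_op A B.
Proof.
move=> eb.
have key k l : bounded_op A -> bounded_op B -> L2kernel A k -> L2kernel B l ->
   {near 0^'+, (fun t => Num.sqrt (n2 (fun p => (t^-1)%:C * (shift_kernel t k p - k p) - l p)))
     =1 (fun t => HSnorm (op_sub (op_scale (t^-1)%:C (op_sub (sigma t A) A)) B))}.
  move=> bA bB Ak Bl; near=> t; have t0 : 0 <= t by near: t; exact: nbhs_right_ge.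
  have bs := bounded_sub (bounded_scale (t^-1)%:C (bounded_sub (bounded_sigma t0 bA) bA)) bB.
  by rewrite (HSnorm_kernel eb bs (kernel_sub (kernel_scale (t^-1)%:C (kernel_sub (sigma_kernel t0 bA Ak) Ak)) Bl)).
split=> [[hA hB lim]|[hA hB [k [l [Ak Bl kl]]]]]; have [bA _] := hA; have [bB _] := hB; split => //.
  have [k Ak] := HS_kernel hA; have [l Bl] := HS_kernel hB.
  have [k2 _] := (L2kernelP _ _).1 Ak; have [l2 _] := (L2kernelP _ _).1 Bl.
  exists k, l; split => //; apply: gen_weak => //.
  have sq : Num.sqrt (n2 (fun p => (t^-1)%:C * (shift_kernel t k p - k p) - l p)) @[t --> 0^'+] --> (0 : R).
    by apply: cvg_trans lim; apply: near_eq_cvg; apply: filterS (key _ _ bA bB Ak Bl) => t ->.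
  rewrite -[X in _ --> X](mulr0 (0 : R)); apply: cvg_trans (cvgM sq sq).
  apply: near_eq_cvg; apply: nearW => t.
  by rewrite /= -expr2 sqr_sqrtr// nq_ge0.
have [k2 _] := (L2kernelP _ _).1 Ak; have [l2 _] := (L2kernelP _ _).1 Bl.
apply: cvg_trans (cvg0_sqrt _ (weak_gen eb k2 l2 kl)); apply: near_eq_cvg; exact: key.
Unshelve. all: by end_near. Qed.

End Generator.

(** * Everywhere differentiable functions *)

Section EverywhereDerivable.
Variable R : realType.
Notation leb := (@lebesgue_measure R).
Notation RR := (measurableTypeR R).
Implicit Types (f g h F : R -> R) (a b c x y t d e : R).

(* [P x] is the sum over [n] of the measures of the [V n `&` `]-oo, x]], for open
   sets [V n] containing [N] of measure at most [e / 2 ^ n.+1]. *)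
Lemma steep_on_negligible (N : set R) e : leb.-negligible (N : set RR) -> 0 < e ->
  exists P : R -> R, [/\ forall x y, x <= y -> P x <= P y, forall x, 0 <= P x <= e &
    forall x (n : nat), N x -> exists2 d, 0 < d & forall t, x < t -> t < x + d ->
      n%:R * (t - x) <= P t - P x].
Proof.
move=> [A [mA A0 NA]] e0.
have hU n : exists U : set R, [/\ open U, A `<=` U & (leb U <= (e / (2 ^ n.+1)%:R)%:E)%E].
  have en : 0 < e / (2 ^ n.+1)%:R by rewrite divr_gt0// ltr0n expn_gt0.
  have [|U [oU AU hU]] := lebesgue_regularity_outer mA _ en.
    by apply: (@le_lt_trans _ _ 0%E); [rewrite le_eqVlt; apply/orP; left; apply/eqP; exact: A0|exact: ltry].
  exists U; split => //; have mU : measurable (U : set RR) by exact: open_measurable.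
  rewrite -(setDUK AU) measureU//; [|exact: measurableD|by rewrite setDIK].
  by rewrite [X in (X + _)%E]A0 add0e ltW.
pose V n := sval (cid (hU n)).
have V1 n : open (V n) by rewrite /V; case: cid => U [].
have V2 n : A `<=` V n by rewrite /V; case: cid => U [].
have V3 n : (leb (V n) <= (e / (2 ^ n.+1)%:R)%:E)%E by rewrite /V; case: cid => U [].
have mV n : measurable (V n : set RR) by exact: open_measurable.
have mI (a : itv_bound R) (b : itv_bound R) n : measurable (V n `&` [set` Interval a b] : set RR).
  by apply: measurableI => //; exact: measurable_itv.
pose p x := (\sum_(0 <= n <oo) leb (V n `&` `]-oo, x]))%E.
have p0 x : (0 <= p x)%E by apply: nneseries_ge0 => n _ _; exact: measure_ge0.
have pe x : (p x <= e%:E)%E.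
  apply: le_trans (epsilon_trick0 xpredT (ltW e0)); apply: lee_nneseries => n *.
    exact: measure_ge0.
  by apply: le_trans (V3 n); apply: le_measure; rewrite ?inE//.
have pf x : p x \is a fin_num by rewrite ge0_fin_numE// (le_lt_trans (pe x))// ltry.
have pD x y : x <= y -> (p y = p x + \sum_(0 <= n <oo) leb (V n `&` `]x, y]))%E.
  move=> xy; rewrite /p -nneseriesD => [|n _ _|n _ _]; try exact: measure_ge0.
  apply: eq_eseriesr => n _; rewrite -measureU; [| |exact: mI|].
  - by rewrite -setIUr -itv_bndbnd_setU.
  - exact: mI.
  - apply/seteqP; split => // z [[_ /=] + [_ /=]]; rewrite !in_itv/= => h1 /andP[h2 _].
    by move: (lt_le_trans h2 h1); rewrite ltxx.
have sub0 x y : (0 <= \sum_(0 <= n <oo) leb (V n `&` `]x, y]))%E.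
  by apply: nneseries_ge0 => n _ _; exact: measure_ge0.
exists (fun x => fine (p x)); split.
- by move=> x y xy; rewrite -lee_fin !fineK// (pD _ _ xy) leeDl.
- by move=> x; rewrite fine_ge0//= -lee_fin fineK.
- move=> x n Nx.
  (* The first [n] open sets share an interval to the right of [x]; each adds [t - x] to the
     increment. *)
  have [d d0 hd] : exists2 d, 0 < d & forall t i, (i < n)%N -> x <= t -> t < x + d -> V i t.
    elim: n => [|n [d d0 hd]]; first by exists 1.
    have := V1 n; rewrite openE => /(_ x (V2 n _ (NA _ Nx)))/nbhs_ballP[r /= r0 hr].
    exists (Num.min d r); first by rewrite lt_min d0.
    move=> t i; rewrite ltnS leq_eqVlt => /predU1P[->|ni] xt; rewrite -ltrBlDl lt_min => /andP[t1 t2].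
      by apply: hr; rewrite /ball /= distrC ger0_norm ?subr_ge0.
    by apply: hd => //; rewrite -ltrBlDl.
  exists d => // t xt tx; rewrite -lee_fin EFinB !fineK//.
  have xt' := ltW xt; rewrite (pD _ _ xt') addeAC subee// add0e.
  have := @nneseries_lim_ge R (fun n => leb (V n `&` `]x, t])) xpredT 0%N n.
  move=> /(_ (fun i _ _ => measure_ge0 _ _)); apply: le_trans.
  rewrite big_mkord (eq_bigr (fun=> (t - x)%:E)) => [|i _].
    by rewrite sumEFin sumr_const card_ord mulr_natl lexx.
  rewrite (_ : _ `&` _ = `]x, t]%classic).
    have -> : leb `]x, t] = (t - x)%:E by rewrite lebesgue_measure_itv/= lte_fin xt -EFinB.
    by [].
  apply/seteqP; split => [z []//|z zx]; split => //.
  by move: zx; rewrite /= in_itv/= => /andP[xz zt]; apply: (hd z i) => //; [exact: ltW|exact: le_lt_trans tx].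
Qed.

(* Adding [e * x] and a function that is steep on [N] makes [F] increase to the
   right of every point; the supremum of the points of [a, b] where the sum is
   at least its value at [a] must then be [b]. *)
Lemma dini_nondecreasing (N : set R) F a b : leb.-negligible (N : set RR) ->
  (forall c e, 0 < e -> exists2 d, 0 < d & forall x, c - d < x -> x <= c -> - e <= F c - F x) ->
  (forall x, exists C d, 0 < d /\ forall t, x < t -> t < x + d -> - C * (t - x) <= F t - F x) ->
  (forall x e, ~ N x -> 0 < e -> exists2 d, 0 < d & forall t, x < t -> t < x + d ->
     - e * (t - x) <= F t - F x) ->
  a <= b -> F a <= F b.
Proof.
move=> N0 hL hC hA ab.
(* The linear term costs [e * (b - a)], and the steep function, with values in [[0, e]], costs at
   most [e]. *)
suff main e : 0 < e -> F a <= F b + e * (b - a + 1).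
  apply/ler_addgt0Pr => e e0; have b1 : 0 < b - a + 1 by rewrite ltr_wpDl// subr_ge0.
  by have := main (e / (b - a + 1)) (divr_gt0 e0 b1); rewrite divfK// gt_eqF.
move=> e0; have [P [P1 P2 P3]] := steep_on_negligible N0 e0.
pose K x := F x + e * x + P x.
suff : K a <= K b.
  by have := P2 a; have := P2 b; rewrite /K => /andP[h1 h2] /andP[h3 h4]; lra.
have step x : exists2 d, 0 < d & forall t, x < t -> t < x + d -> K x <= K t.
  have [Nx|/hA/(_ e0)[d d0 hd]] := pselect (N x); last first.
    exists d => // t xt tx; have := hd t xt tx; have := P1 _ _ (ltW xt); rewrite /K; lra.
  have [C [d [d0 hd]]] := hC x.
  (* An integer slope above [C] compensates the lower bound [- C] on the difference quotients of [F]
     at [x]. *)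
  have [d' d'0 hd'] := P3 x (Num.truncn C).+1 Nx.
  exists (Num.min d d'); first by rewrite lt_min d0.
  move=> t xt; rewrite -ltrBlDl lt_min !ltrBlDl => /andP[t1 t2].
  have h1 := hd t xt t1; have h2 := hd' t xt t2.
  have h3 : C * (t - x) <= (Num.truncn C).+1%:R * (t - x).
    by rewrite ler_wpM2r ?subr_ge0 ?ltW// truncnS_gt.
  have h4 : 0 <= e * (t - x) by apply: mulr_ge0; [exact: ltW|rewrite subr_ge0 ltW].
  by rewrite /K; lra.
pose S := [set x | a <= x <= b /\ K a <= K x].
have hS : has_sup S.
  by split; [exists a; split => //; rewrite lexx|exists b => x [/andP[]]].
have aS : a <= sup S by apply: sup_upper_bound => //; split => //; rewrite lexx.
have Sb : sup S <= b by apply: ge_sup; [exists a; split => //; rewrite lexx|move=> x [/andP[]]].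
have KS : K a <= K (sup S).
  apply/ler_addgt0Pr => r r0; have [d d0 hd] := hL (sup S) r r0.
  have [x Sx dx] := sup_adherent d0 hS.
  have xs : x <= sup S by exact: sup_upper_bound.
  have := hd x dx xs; have := P1 _ _ xs; case: Sx => _.
  have : 0 <= e * (sup S - x) by rewrite mulr_ge0 ?subr_ge0// ltW.
  by rewrite /K; lra.
move: Sb; rewrite le_eqVlt => /predU1P[<-//|sb].
have [d d0 hd] := step (sup S).
pose t := Num.min (sup S + d / 2) b.
have st : sup S < t by rewrite lt_min sb andbT ltrDl divr_gt0.
have td : t < sup S + d by rewrite gt_min ltrD2l ltr_pdivrMr// ltr_pMr// ltr1n.
have : S t.
  split; first by rewrite (le_trans aS (ltW st))/= ge_min lexx orbT.
  exact: le_trans KS (hd t st td).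
by move=> /(sup_upper_bound hS); rewrite leNgt st.
Qed.

Lemma derive_right_lower F x l e : is_derive x (1 : R) F l -> 0 < e ->
  exists2 d, 0 < d & forall t, `|t - x| < d -> `|F t - F x - l * (t - x)| <= e * `|t - x|.
Proof.
move=> [dF vF] e0; have : (fun s : R => s^-1 *: ((F \o shift x) (s *: (1 : R)) - F x)) @ 0^' --> l.
  by rewrite -vF; exact: dF.
move=> /cvgrPdist_le/(_ e e0)[d /= d0 hd]; exists d => // t td.
have [->|tx] := eqVneq t x; first by rewrite !subrr mulr0 subr0 !normr0 mulr0.
have tx0 : t - x != 0 by rewrite subr_eq0.
have := hd (t - x); rewrite /= sub0r normrN => /(_ td tx0).
have -> : (t - x)%:A + x = t by rewrite -[RHS](subrK x); congr (_ + _); exact: mulr1.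
have sc (p q : R) : p *: q = p * q by [].
rewrite sc => h.
have -> : F t - F x - l * (t - x) = (t - x) * ((t - x)^-1 * (F t - F x) - l) by field.
by rewrite normrM mulrC ler_wpM2r// distrC.
Qed.

Lemma prim_int_ae h : leb.-integrable setT (EFin \o h) ->
  {ae leb, forall x, is_derive x (1 : R) (prim h) (h x)}.
Proof.
move=> hi.
have : {ae leb, forall x, derivable (prim h) x 1 /\ derive1 (prim h) x = h x}.
  apply: FTC1Ny => [y|]; first by exact: integrableS hi.
  apply: open_integrable_locally; first exact: openT.
  exact: hi.
apply: aeS => x [h1 h2]; split; first exact: h1.
by rewrite -derive1E; exact: h2.
Qed.

(* The truncation [min g n] is bounded above, hence [f] minus its primitive has a
   lower right derivative that is finite everywhere and nonnegative almost
   everywhere. *)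
Lemma ftc_derivable_ge f g a b : (forall x, is_derive x (1 : R) f (g x)) ->
  leb.-integrable setT (EFin \o g) -> a <= b ->
  Rintegral leb `]a, b] g <= f b - f a.
Proof.
move=> fg gi ab.
have fin (x y z e : R) : x - y <= e -> y <= z -> x <= z + e by lra.
have mg : measurable_fun (setT : set RR) g by apply/measurable_EFinP; exact: measurable_int gi.
pose h (n : nat) x := Num.min (g x) n%:R.
have mh n : measurable_fun (setT : set RR) (h n) by exact: measurable_minr.
have hg n x : `|h n x| <= `|g x|.
  rewrite /h /Num.min; case: ifPn => //; rewrite -leNgt => ng.
  by rewrite ger0_norm// (le_trans ng)// ler_norm.
have hi n : leb.-integrable setT (EFin \o h n).
  by apply: (intle _ (mh n) (fun x _ => hg n x)) => //; exact: integrable_norm gi.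
have hi' n (A : set RR) : measurable A -> leb.-integrable A (EFin \o h n).
  by move=> mA; exact: integrableS (hi n).
have pr n x y : x <= y -> prim (h n) y - prim (h n) x = Rintegral leb `]x, y] (h n).
  move=> xy; apply: Rintegral_itvB; [|by []|by rewrite bnd_simp].
  exact: (hi' n _ (measurable_itv _)).
have pu n x y : x <= y -> prim (h n) y - prim (h n) x <= n%:R * (y - x).
  move=> xy; rewrite (pr _ _ _ xy).
  have mxy : leb `]x, y] = (y - x)%:E.
    rewrite lebesgue_measure_itv/= lte_fin -EFinB; move: xy; rewrite le_eqVlt => /predU1P[->|->//].
    by rewrite ltxx subrr.
  rewrite -[leRHS](_ : Rintegral leb `]x, y] (fun=> n%:R) = _); last first.
    by rewrite Rintegral_cst//= mxy.
  apply: le_Rintegral => //.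
  - exact: hi'.
  - by apply: (int_bounded (M := n%:R)) => //; [exact: leb_itv_fin|move=> z _; rewrite ger0_norm].
  - by move=> z _; rewrite /h ge_min lexx orbT.
have le n : Rintegral leb `]a, b] (h n) <= f b - f a.
  rewrite -(pr _ _ _ ab); suff : f a - prim (h n) a <= f b - prim (h n) b by lra.
  (* The exceptional set is the set of points where [prim (h n)] fails to have derivative [h n];
     unfolding turns the almost everywhere statement into its negligibility. *)
  have := prim_int_ae (hi n); rewrite /almost_everywhere => N0.
  apply: (dini_nondecreasing (F := fun x => f x - prim (h n) x) N0) => //.
  - move=> c e e0; pose C := `|g c| + 1 + n%:R.
    have C0 : 0 < C by rewrite /C ltr_wpDr// ltr_wpDl.
    have [d d0 hd] := derive_right_lower (fg c) ltr01.
    exists (Num.min d (e / C)) => [|x]; first by rewrite lt_min d0 divr_gt0.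
    rewrite ltrBlDr -ltrBlDl lt_min => /andP[x1 x2] xc.
    have xc0 : 0 <= c - x by rewrite subr_ge0.
    have := hd x; rewrite distrC ger0_norm// => /(_ x1).
    rewrite ler_norml => /andP[h1 h2]; have h3 := pu n x c xc.
    have h4 : - `|g c| * (c - x) <= g c * (c - x).
      by rewrite ler_wpM2r//; have := ler_norm (- g c); rewrite normrN; lra.
    have h5 : C * (c - x) <= e by rewrite mulrC -ler_pdivlMr// ltW.
    by move: h5; rewrite /C; lra.
  - move=> x; exists (`|g x| + 1 + n%:R).
    have [d d0 hd] := derive_right_lower (fg x) ltr01.
    exists d; split => // t xt tx; have xt0 : 0 <= t - x by rewrite subr_ge0 ltW.
    have := hd t; rewrite ger0_norm// => /(_ _); rewrite ltrBlDl => /(_ tx).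
    rewrite ler_norml => /andP[h1 h2]; have h3 := pu n x t (ltW xt).
    have h4 : - `|g x| * (t - x) <= g x * (t - x).
      by rewrite ler_wpM2r//; have := ler_norm (- g x); rewrite normrN; lra.
    by lra.
  - move=> x e /contrapT px e0; have e2 : 0 < e / 2 by rewrite divr_gt0.
    have [d d0 hd] := derive_right_lower (fg x) e2.
    have [d' d'0 hd'] := derive_right_lower px e2.
    exists (Num.min d d') => [|t xt]; first by rewrite lt_min d0.
    rewrite -ltrBlDl lt_min => /andP[t1 t2]; have xt0 : 0 <= t - x by rewrite subr_ge0 ltW.
    have := hd t; have := hd' t; rewrite ger0_norm// => /(_ t2) + /(_ t1).
    rewrite !ler_norml => /andP[_ h1] /andP[h2 _].
    have h3 : h n x * (t - x) <= g x * (t - x) by rewrite ler_wpM2r// /h ge_min lexx.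
    by lra.
have mI : measurable (`]a, b]%classic : set RR) by exact: measurable_itv.
have gi' : leb.-integrable (`]a, b]%classic : set RR) (EFin \o g) by exact: integrableS gi.
have c : Rintegral leb `]a, b] (fun x => g x - h n x) @[n --> \oo] --> (0 : R).
  apply: (@rint_dct R _ RR leb _ (fun n x => g x - h n x) (fun x => 2 * `|g x|) mI).
  - by move=> n; apply: measurable_funTS; exact: measurable_funB.
  - by apply: (intZ mI); exact: (integrable_norm gi').
  - apply: aeW => x _ n; apply: le_trans (ler_normB _ _) _; have := hg n x; lra.
  - apply: aeW => x _; apply: (@cvg_near_cst _ _ _ _ _ eventually_filter).
    exists (Num.truncn (g x)).+1 => // n /= Nn.
    rewrite /h /Num.min ifT ?subrr//; apply: lt_le_trans (truncnS_gt _) _.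
    by rewrite ler_nat.
have E n : Rintegral leb `]a, b] (fun x => g x - h n x) =
    Rintegral leb `]a, b] g - Rintegral leb `]a, b] (h n).
  by rewrite RintegralB//; exact: hi'.
apply/ler_addgt0Pr => e e0.
have /cvgr0Pnorm_le/(_ e e0)[n _ /(_ n (leqnn n))] := c.
by rewrite E ler_norml => /andP[_ h1]; exact: fin h1 (le n).
Qed.

(** The missing inequality is the known one applied to [- f] and [- g]. *)
Lemma ftc_derivable f g a b : (forall x, is_derive x (1 : R) f (g x)) ->
  leb.-integrable setT (EFin \o g) -> a <= b ->
  Rintegral leb `]a, b] g = f b - f a.
Proof.
move=> fg gi ab; apply/eqP; rewrite eq_le (ftc_derivable_ge fg gi ab)/=.
have fgN x : is_derive x (1 : R) (fun y => - f y) (- g x) by exact: is_deriveN.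
have := ftc_derivable_ge fgN (intN measurableT gi) ab.
rewrite (_ : Rintegral leb `]a, b] (fun x => - g x) = - Rintegral leb `]a, b] g); first lra.
have gi' : leb.-integrable (`]a, b]%classic : set RR) (EFin \o g) by exact: integrableS gi.
rewrite /Rintegral -fineN -integralN//; last exact: integrable_add_def gi'.
Qed.

Lemma integral_derivable_compact f g a b : (forall x, is_derive x (1 : R) f (g x)) ->
  leb.-integrable setT (EFin \o g) -> a <= b -> f a = 0 -> f b = 0 ->
  (forall x, g x != 0 -> a < x <= b) -> Rintegral leb setT g = 0.
Proof.
move=> fg gi ab fa fb gs; have := ftc_derivable fg gi ab; rewrite fa fb subrr => <-.
rewrite /Rintegral [in RHS]integral_mkcond; congr fine; apply: eq_integral => x _.
rewrite patchE; case: ifPn => //; rewrite notin_setE /= in_itv/= => nx.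
by have [->//|/gs] := eqVneq (g x) 0.
Qed.

End EverywhereDerivable.

Section ZeroExtension.
Context d (T : measurableType d) (R : realType) (mu : {measure set T -> \bar R}).
Variables (D : set T) (W : T -> R).
Hypotheses (mD : measurable D) (W0 : forall x, ~ D x -> W x = 0).

Lemma integrable_zero_ext : mu.-integrable D (EFin \o W) -> mu.-integrable setT (EFin \o W).
Proof.
move=> /(integrable_mkcond _ mD); apply: eq_integrable => // x _.
by rewrite patchE; case: ifPn => //; rewrite notin_setE /= => /W0 ->.
Qed.

Lemma Rintegral_zero_ext : Rintegral mu D W = Rintegral mu setT W.
Proof.
rewrite /Rintegral [in LHS]integral_mkcond; congr fine; apply: eq_integral => x _.
by rewrite patchE; case: ifPn => //; rewrite notin_setE /= => /W0 ->.
Qed.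

End ZeroExtension.

(** * Integration by parts along the diagonals for differentiable kernels *)

Section Diagonals.
Variable R : realType.
Notation leb := (@lebesgue_measure R).
Notation leb2 := (@leb2 R).
Notation RR := (measurableTypeR R).
Notation Q := (@quadrant R).
Notation mQ := (@m_quad R).
Implicit Types (k : R * R -> R[i]).

Implicit Types (W q u : R * R -> R) (a s : R).

Lemma mpres_comp d (T : measurableType d) (mu : {measure set T -> \bar R}) (h j : T -> T) :
  mpres mu h -> mpres mu j -> mpres mu (h \o j).
Proof.
move=> [mh h1] [mj j1]; split; first exact: measurableT_comp.
move=> A mA; rewrite comp_preimage j1 ?h1//.
by rewrite -[X in measurable X]setTI; exact: mh.
Qed.

(* Volume-preserving coordinates: the lines of constant [p.1] are the diagonals. *)
Definition diag (p : R * R) : R * R := (p.2, p.1 + p.2).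

Lemma mpres_diag : mpres leb2 (diag : RR * RR -> RR * RR).
Proof. exact: mpres_comp (@mpres_shear R) (@mpres_swap2 R). Qed.

Lemma diag_fubini W : leb2.-integrable (setT : set (RR * RR)) (EFin \o W) ->
  [/\ {ae leb, forall a, leb.-integrable (setT : set RR) (EFin \o (fun s => W (s, a + s)))},
    leb.-integrable (setT : set RR) (EFin \o (fun a => Rintegral leb setT (fun s => W (s, a + s)))) &
    Rintegral leb2 setT W = Rintegral leb setT (fun a => Rintegral leb setT (fun s => W (s, a + s)))].
Proof.
move=> Wi; have Wi' := mpres_integrable mpres_diag measurableT Wi.
have e := mpres_eq mpres_diag measurableT (measurable_int _ Wi).
rewrite preimage_setT in Wi' e.
have Wi2 : leb2.-integrable ((setT : set RR) `*` (setT : set RR)) (EFin \o (W \o diag)).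
  by rewrite setXTT.
have [h1 h2 h3] := @fubini_real _ _ RR RR R leb leb setT setT measurableT measurableT _ Wi2.
split => //; first by apply: (aeS _ h1) => a; apply.
by rewrite -h3 setXTT /Rintegral -e.
Qed.

Lemma kernel_by_parts q u : (forall p, Q p -> differentiable q p) -> test_function u ->
  leb2.-integrable Q (EFin \o (fun p => q p * rdiag_deriv u p)) ->
  leb2.-integrable Q (EFin \o (fun p => rdiag_deriv q p * u p)) ->
  Rintegral leb2 Q (fun p => q p * rdiag_deriv u p) = - Rintegral leb2 Q (fun p => rdiag_deriv q p * u p).
Proof.
move=> dq tu i1' i2'; have [a0 [b [M [a0p M0 _ _ us]]]] := test_bound tu.
have [du _ _ _] := tu.
pose W p := q p * rdiag_deriv u p + rdiag_deriv q p * u p.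
have nQ p : p.1 < a0 \/ p.2 < a0 \/ b < p.1 -> u p = 0 /\ rdiag_deriv u p = 0.
  move=> h; split; apply/eqP; apply: contraT => hp.
    by have [/andP[h1 h2] /andP[h3 h4]] := us p (or_introl hp); case: h => [|[]]; lra.
  by have [/andP[h1 h2] /andP[h3 h4]] := us p (or_intror hp); case: h => [|[]]; lra.
have Q0 p : ~ Q p -> p.1 < a0 \/ p.2 < a0 \/ b < p.1.
  move=> nq; have [h|h] := ltP p.1 a0; first by left.
  have [h'|h'] := ltP p.2 a0; first by right; left.
  by exfalso; apply: nq; split; [exact: lt_le_trans h|exact: lt_le_trans h'].
have W0 p : ~ Q p -> W p = 0.
  by move=> /Q0/nQ[h1 h2]; rewrite /W h1 h2 !mulr0 addr0.
have Wi : leb2.-integrable Q (EFin \o W) by exact: (intD mQ i1' i2').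
suff : Rintegral leb2 Q W = 0.
  rewrite /W RintegralD => [|//|//|//]; last exact: mQ.
  by move/eqP; rewrite addr_eq0 => /eqP.
have WT : leb2.-integrable (setT : set (RR * RR)) (EFin \o W).
  exact: (@integrable_zero_ext _ (RR * RR)%type R leb2 Q W mQ W0 Wi).
rewrite (@Rintegral_zero_ext _ (RR * RR)%type R leb2 Q W W0).
have [h1 _ ->] := diag_fubini WT.
rewrite (_ : Rintegral leb setT _ = Rintegral leb setT (fun=> 0 : R)); first by rewrite Rintegral_cst//= mul0r.
rewrite /Rintegral; congr fine; apply: ae_eq_integral => //.
- by apply/measurable_EFinP; have [_ h2 _] := diag_fubini WT; apply/measurable_EFinP; exact: measurable_int h2.
- apply: (aeS _ h1) => a ha _; congr EFin.
  pose f s := q (s, a + s) * u (s, a + s).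
  (* The first coordinates of the support lie in [[a0, b]] with [a0 > 0]; the right end exceeds [b]
     and is nonnegative whatever the sign of [b]. *)
  apply: (integral_derivable_compact (f := f) (g := fun s => W (s, a + s)) (a := 0) (b := `|b| + 1)) => //.
  + move=> s; have [Qs|nQs] := pselect (Q (s, a + s)).
      have E (w : R * R -> R) : differentiable w (s, a + s) ->
          is_derive s (1 : R) (fun s => w (s, a + s)) (rdiag_deriv w (s, a + s)).
        move=> dw; have := @is_derive_diag_at R w (0, a) s; rewrite /= !add0r => /(_ dw).
        by rewrite (_ : (fun r => _) = (fun r => w (r, a + r)))//; apply/funext => r; rewrite add0r.
      have dm := is_deriveM (E q (dq _ Qs)) (E u (du _)).
      rewrite (_ : W (s, a + s) = q (s, a + s) *: rdiag_deriv u (s, a + s) + u (s, a + s) *: rdiag_deriv q (s, a + s))//.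
      by rewrite /W; congr (_ + _); exact: mulrC.
    (* Outside the quadrant nothing is known about [q], but [u] vanishes on the part of the diagonal
       within [a0] of such a point, so [f] is locally 0. *)
    rewrite W0//; apply: (@near_eq_is_derive _ _ _ (cst 0)).
      near=> r; rewrite /f /=.
      have : (r, a + r).1 < a0 \/ (r, a + r).2 < a0 \/ b < (r, a + r).1.
        have rs : `|s - r| < a0 by near: r; exact: (@cvgr_dist_lt _ _ _ _ _ id s cvg_id a0 a0p).
        move: rs; rewrite ltr_norml => /andP[r1 r2] /=.
        have [h|h] := ltP r a0; first by left.
        have [h'|h'] := ltP (a + r) a0; first by right; left.
        by exfalso; apply: nQs; split => /=; lra.
      by move=> /nQ[-> _]; rewrite mulr0.
  + by rewrite /f (nQ _ _).1 ?mulr0//=; left; rewrite a0p.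
  + rewrite /f (nQ _ _).1 ?mulr0//=; right; right; have := ler_norm b; lra.
  + move=> s Ws; have : u (s, a + s) != 0 \/ rdiag_deriv u (s, a + s) != 0.
      apply: contrapT => /not_orP[/negP]; rewrite negbK => /eqP z1 /negP.
      by rewrite negbK => /eqP z2; move: Ws; rewrite /W z1 z2 !mulr0 addr0 eqxx.
    by move=> /us[/= /andP[z1 z2] _]; have := ler_norm b; lra.
Unshelve. all: by end_near. Qed.

Lemma weak_diag_deriv_diff k : isL2 leb2 Q k -> isL2 leb2 Q (diag_deriv k) ->
  differentiable_kernel k -> weak_diag_deriv k (diag_deriv k).
Proof.
move=> k2 d2 dk; split; [exact: L2_cm k2|exact: L2_cm d2|] => u tu.
have u2 := test_L2 tu; have du2 := test_rd_L2 tu.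
have c1 := ci_rC k2 du2; have c2 := ci_rC d2 u2; split => //.
have Rr (a : R[i]) (x : R) : ReC (a * x%:C) = ReC a * x by rewrite CE /= mulr0 subr0.
have Ri (a : R[i]) (x : R) : ImC (a * x%:C) = ImC a * x by rewrite CE /= mulr0 add0r.
have [r1 m1] := c1; have [r2 m2] := c2.
have eR (l : R * R -> R[i]) w : (fun p => ReC (l p * rC w p)) = fun p => ReC (l p) * w p.
  by apply/funext => p; rewrite Rr.
have eI (l : R * R -> R[i]) w : (fun p => ImC (l p * rC w p)) = fun p => ImC (l p) * w p.
  by apply/funext => p; rewrite Ri.
have int_eq (D : set (RR * RR)) (F G : RR * RR -> R) : F = G ->
   leb2.-integrable D (fun x => (F x)%:E) -> leb2.-integrable D (EFin \o G) by move=> ->.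
have r1' := int_eq _ _ _ (eR k (rdiag_deriv u)) r1; have m1' := int_eq _ _ _ (eI k (rdiag_deriv u)) m1.
have r2' := int_eq _ _ _ (eR (diag_deriv k) u) r2; have m2' := int_eq _ _ _ (eI (diag_deriv k) u) m2.
have hr := kernel_by_parts (fun p Qp => (dk p Qp).1) tu r1' r2'.
have hi := kernel_by_parts (fun p Qp => (dk p Qp).2) tu m1' m2'.
have RI (l : R * R -> R[i]) w : ReC (cintegral leb2 Q (fun p => l p * (w p)%:C)) =
    Rintegral leb2 Q (fun p => ReC (l p) * w p) by rewrite -eR.
have II (l : R * R -> R[i]) w : ImC (cintegral leb2 Q (fun p => l p * (w p)%:C)) =
    Rintegral leb2 Q (fun p => ImC (l p) * w p) by rewrite -eI.
apply: Cext.
  by rewrite ReN (RI k) (RI (diag_deriv k)); exact: hr.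
by rewrite ImN (II k) (II (diag_deriv k)); exact: hi.
Qed.

Lemma generator_differentiable (e : nat -> R -> R[i]) (A B : op R) k : is_onb e ->
  HS A -> HS B -> L2kernel A k -> differentiable_kernel k ->
  L2kernel B (diag_deriv k) -> generator (@sigma R) A B.
Proof.
move=> eb hA hB Ak dk Bk; apply/(generator_diag_deriv _ _ eb); split => //.
have [k2 _] := (L2kernelP _ _).1 Ak; have [l2 _] := (L2kernelP _ _).1 Bk.
by exists k, (diag_deriv k); split => //; exact: weak_diag_deriv_diff.
Qed.

End Diagonals.

(** * Hankel products *)

Section ComplexZeroExtension.
Context d (T : measurableType d) (R : realType) (mu : {measure set T -> \bar R}).
Variables (D E : set T) (f : T -> R[i]).
Hypotheses (mD : measurable D) (mE : measurable E) (ED : E `<=` D)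
  (f0 : forall x, D x -> ~ E x -> f x = 0).

Let fE x : D x -> (if x \in E then f x else 0) = f x.
Proof. by move=> Dx; case: ifPn => //; rewrite notin_setE => /(f0 Dx). Qed.

Let mbE : measurable [set x | x \in E].
Proof. by rewrite set_mem_set. Qed.

Let DE : D `&` [set x | x \in E] = E.
Proof. by rewrite set_mem_set; exact/setIidr. Qed.

Lemma ci_zero_ext : cintegrable mu E f -> cintegrable mu D f.
Proof. by move=> fi; apply: (ci_ext mD fE); apply: (ci_if mD mbE); rewrite DE. Qed.

Lemma cI_zero_ext : cintegral mu E f = cintegral mu D f.
Proof. by rewrite -(cI_ext mu fE) (cI_if mu D (fun x => x \in E)) DE. Qed.

End ComplexZeroExtension.

(** * Integration by parts for tail integrals *)

Section Hankel.
Variable R : realType.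
Notation leb := (@lebesgue_measure R).
Notation leb2 := (@leb2 R).
Notation RR := (measurableTypeR R).
Notation H := (@halfline R).
Notation Q := (@quadrant R).
Notation mH := (@m_half R).
Notation mQ := (@m_quad R).

Implicit Types (u : R * R -> R) (a b s : R).

Lemma diag_fubiniC (W : R * R -> R[i]) : cintegrable leb2 (setT : set (RR * RR)) W ->
  [/\ {ae leb, forall a, cintegrable leb (setT : set RR) (fun s => W (s, a + s))},
    cintegrable leb (setT : set RR) (fun a => cintegral leb (setT : set RR) (fun s => W (s, a + s))) &
    cintegral leb2 setT W = cintegral leb setT (fun a => cintegral leb setT (fun s => W (s, a + s)))].
Proof.
move=> Wi; have Wi' := mpres_ci (mpres_diag R) measurableT Wi.
have e := mpres_cI (mpres_diag R) measurableT (ci_cm Wi).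
rewrite preimage_setT in Wi' e.
have Wi2 : cintegrable leb2 ((setT : set RR) `*` (setT : set RR)) (W \o (diag (R:=R))).
  by rewrite setXTT.
have [h1 h2 h3] := @fubini_C _ _ RR RR R leb leb setT setT measurableT measurableT _ Wi2.
split => //; first by apply: (aeS _ h1) => a; apply.
by rewrite -h3 setXTT -e.
Qed.

(** This supplies base points at which an integral known to converge almost everywhere does
    converge. *)
Lemma ae_itv (P : R -> Prop) a b : a < b -> {ae leb, forall x, P x} -> exists2 x, a < x < b & P x.
Proof.
move=> ab [N [mN N0 PN]]; apply: contrapT => h.
have sub : `]a, b[%classic `<=` N.
  move=> x /=; rewrite in_itv/= => xab; apply: PN => /= Px; apply: h; by exists x.
have : (leb (`]a, b[%classic : set RR) <= leb N)%E by apply: le_measure; rewrite ?inE//; exact: measurable_itv.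
have -> : leb N = 0%E := N0.
by rewrite lebesgue_measure_itv/= lte_fin ab -EFinB leNgt lte_fin subr_gt0 ab.
Qed.

(** Fubini on the triangle [x < y]: the inner integral of [w'] over []0, y[] is [w y]. In this way
    the tail integral of a merely integrable [G] never has to be differentiated. *)
Lemma tail_by_parts (G : R -> R[i]) (w w' : R -> R) : cintegrable leb H G ->
  (forall x, is_derive x (1 : R) w (w' x)) -> leb.-integrable (setT : set RR) (EFin \o w') -> w 0 = 0 ->
  cintegral leb H (fun x => (w' x)%:C * cintegral leb H (fun z => G (z + x))) =
  cintegral leb H (fun x => G x * (w x)%:C).
Proof.
move=> Gi wd wi w0.
have mw : measurable_fun (setT : set RR) w' by apply/measurable_EFinP; exact: measurable_int wi.
have wi' : leb.-integrable H (EFin \o w') by apply: (integrableS _ _ _ wi) => //; exact: mH.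
have wC : cintegrable leb H (fun x => (w' x)%:C).
  split; first exact: wi'.
  exact: integrable0.
have mlt : measurable [set p : RR * RR | p.1 < p.2].
  have : measurable_fun setT (fun p : RR * RR => p.1 < p.2) by exact: measurable_fun_ltr.
  by move=> /(_ measurableT [set true] I); rewrite setTI.
pose T (p : R * R) := if p.1 < p.2 then (w' p.1)%:C * G p.2 else 0.
have Ti : cintegrable leb2 Q T.
  apply: (ci_if mQ mlt); apply: (ci_sub mQ (measurableI _ _ mQ mlt) (@subIsetl _ _ _)).
  by have := ci_tensor mH mH wC Gi; rewrite -quadrantE.
have Tsi : cintegrable leb2 Q (fun p => T (p.2, p.1)).
  by have := mpres_ci (@mpres_swap2 R) mQ Ti; rewrite (_ : _ @^-1` _ = Q)//;
    apply/seteqP; split => p [].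
have Tse : cintegral leb2 Q (fun p => T (p.2, p.1)) = cintegral leb2 Q T.
  rewrite -(mpres_cI (@mpres_swap2 R) mQ (ci_cm Ti)); congr cintegral.
  by apply/seteqP; split => p [].
have [_ _ e1] := @fubini_C _ _ RR RR R leb leb H H mH mH _ Ti.
have [_ _ e2] := @fubini_C _ _ RR RR R leb leb H H mH mH _ Tsi.
transitivity (cintegral leb2 Q T).
  rewrite e1; apply: cI_ext => x Hx; rewrite /T /=.
  have Hx' : H `&` [set y | x < y] = [set y | x < y].
    by apply/setIidr => y /= xy; exact: lt_trans Hx xy.
  have Gx : cintegrable leb [set y | x < y] G.
    by apply: (ci_sub mH (m_gt x) _ Gi) => y /= xy; exact: lt_trans Hx xy.
  have -> : cintegral leb H (fun z => G (z + x)) = cintegral leb H (fun y => if x < y then G y else 0).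
    rewrite (@cI_if _ RR R leb H (fun y => x < y)) Hx'.
    rewrite -(mpres_cI (@mpres_translate R x) (m_gt x) (ci_cm Gx)); congr cintegral.
    by apply/seteqP; split => y; rewrite /= ltrDr.
  rewrite -(cIZ mH); last by apply: (ci_if mH (m_gt x)); rewrite Hx'.
  by apply: cI_ext => y _; case: ifP => _; rewrite ?mulr0.
rewrite -Tse e2; apply: cI_ext => r Hr; rewrite /T /=.
have mr : measurable ([set x | x < r] : set RR).
  by rewrite (_ : [set x | x < r] = `]-oo, r[%classic); [exact: measurable_itv|apply/seteqP; split => y; rewrite /= in_itv].
have Hr' : H `&` [set x | x < r] = `]0, r[%classic.
  by apply/seteqP; split => y /=; rewrite in_itv/=; [move=> [-> ->]|move=> /andP[]].
have -> : w r = Rintegral leb `]0, r[ w'.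
  rewrite Rintegral_itv_bndo_bndc; last by apply: (integrableS _ _ _ wi) => //; exact: measurable_itv.
  by rewrite (ftc_derivable wd wi (ltW Hr)) w0 subr0.
have -> : (Rintegral leb `]0, r[ w')%:C = cintegral leb H (fun x => if x < r then (w' x)%:C else 0).
  rewrite (@cI_if _ RR R leb H (fun x => x < r)) Hr' /cintegral /=.
  by apply: Cext => //=; rewrite Rintegral_cst//= mul0r.
rewrite -(cIZ mH).
  by apply: cI_ext => x _; case: ifP => _; rewrite ?mulr0// mulrC.
by apply: (ci_if mH mr); apply: (ci_sub mH (measurableI _ _ mH mr) (@subIsetl _ _ _) wC).
Qed.

(** In the application, [F (x, y)] is the product of the transpose of [phi x] with [psi y], and [k0]
    is the kernel of the Hankel product. *)
Variable F : R * R -> R[i].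
Definition box a b : set (R * R) := `]a, b]%classic `*` `]a, b]%classic.
Hypothesis Floc : forall a b, 0 < a -> cintegrable leb2 (box a b : set (RR * RR)) F.
Hypothesis Fae : {ae leb2, forall p, Q p -> cintegrable leb H (fun z => F (p.1 + z, z + p.2))}.
Let k0 p := cintegral leb H (fun z => F (p.1 + z, z + p.2)).
Hypothesis k02 : isL2 leb2 Q k0.

Lemma loc_test_ci u : test_function u -> cintegrable leb2 Q (fun p => F p * (u p)%:C).
Proof.
move=> tu; have [a [b [M [a0 M0 uM _ us]]]] := test_bound tu.
have mu : measurable_fun (setT : set (RR * RR)) u by exact: (continuous_measurable2 (test_continuous tu)).
(* The box is open on the left while the support of [u] may touch [a]; halving leaves room. *)
have a2 : 0 < a / 2 by rewrite divr_gt0.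
have mB : measurable (box (a / 2) b : set (RR * RR)) by apply: measurableX; exact: measurable_itv.
have Fi := Floc b a2.
apply: (@ci_zero_ext _ (RR * RR)%type R leb2 Q (box (a / 2) b) _ mQ mB).
- by move=> p [/=]; rewrite !in_itv/= => /andP[h1 _] /andP[h2 _]; split; exact: lt_trans a2 _.
- move=> p _ nb; have [->|up] := eqVneq (u p) 0; first by rewrite mulr0.
  have [/andP[h1 h2] /andP[h3 h4]] := us p (or_introl up).
  by exfalso; apply: nb; split; rewrite /= in_itv/=; apply/andP; split => //; lra.
- apply: (ci_le mB (g := fun p => M * Normc.normc (F p))).
  + apply: (cmM (ci_cm Fi)); apply: cm_real; exact: measurable_funTS.
  + move=> p _; rewrite Normc.normcM mulrC ler_wpM2r ?normc_ge0//.
    by rewrite /Normc.normc /= expr0n addr0 sqrtr_sqr.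
  + exact: (intZ mB _ (ci_normc mB Fi)).
Qed.

(* [F (p + z)] need not be integrable in [p] and [z] jointly, even locally in [p],
   so the order of integration is only exchanged within a single diagonal. *)
Lemma hankel_diagonal u a : test_function u ->
  cintegrable leb (setT : set RR) (fun s => if (s, a + s) \in Q then k0 (s, a + s) * (rdiag_deriv u (s, a + s))%:C else 0) ->
  cintegrable leb (setT : set RR) (fun s => if (s, a + s) \in Q then F (s, a + s) * (u (s, a + s))%:C else 0) ->
  {ae leb, forall s, Q (s, a + s) -> cintegrable leb H (fun z => F (s + z, z + (a + s)))} ->
  cintegral leb (setT : set RR) (fun s => if (s, a + s) \in Q then k0 (s, a + s) * (rdiag_deriv u (s, a + s))%:C else 0) =
  cintegral leb (setT : set RR) (fun s => if (s, a + s) \in Q then F (s, a + s) * (u (s, a + s))%:C else 0).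
Proof.
move=> tu i1' i2' hae; have [a0 [b [M [a00 M0 uM duM us]]]] := test_bound tu.
have [du _ _ _] := tu.
(* The diagonal enters the quadrant at parameter [m], and [u] vanishes on it up to [m + a0]. The
   base point [s0] is taken in between, where the tail integral converges. *)
pose m := Num.max 0 (- a).
have [s0 /andP[ms0 s0c] hs0] : exists2 s0, m < s0 < m + a0 &
   Q (s0, a + s0) -> cintegrable leb H (fun z => F (s0 + z, z + (a + s0))).
  by apply: (ae_itv _ hae); rewrite ltrDl.
have Qs s : m < s -> Q (s, a + s).
  by rewrite gt_max => /andP[h1 h2]; split => //=; lra.
have {}hs0 := hs0 (Qs _ ms0).
have z s : s <= s0 -> u (s, a + s) = 0 /\ rdiag_deriv u (s, a + s) = 0.
  move=> ss; have lt : ~ (a0 <= s /\ a0 <= a + s).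
    move=> [h1 h2]; have : m + a0 <= s by rewrite -lerBrDr ge_max; apply/andP; split; lra.
    by move: s0c => + h3; have := le_trans h3 ss; move=> /le_lt_trans h4 /h4; rewrite ltxx.
  split; apply/eqP; apply: contraT => h.
    by exfalso; apply: lt; have [/= /andP[h1 _] /andP[h2 _]] := us _ (or_introl h).
  by exfalso; apply: lt; have [/= /andP[h1 _] /andP[h2 _]] := us _ (or_intror h).
have red (W : R * R -> R[i]) : cintegrable leb (setT : set RR) (fun s => if (s, a + s) \in Q then W (s, a + s) else 0) ->
   (forall s, s <= s0 -> W (s, a + s) = 0) ->
   cintegral leb (setT : set RR) (fun s => if (s, a + s) \in Q then W (s, a + s) else 0) =
   cintegral leb H (fun x => W (x + s0, a + (x + s0))).
  move=> Wi Wz.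
  rewrite -(@cI_zero_ext _ RR R leb setT [set s | s0 < s]) //; last first.
    by move=> s _ /negP; rewrite -leNgt => ss; rewrite Wz// if_same.
  have Wi' := ci_sub measurableT (m_gt s0) (fun _ _ => I) Wi.
  rewrite -(mpres_cI (@mpres_translate R s0) (m_gt s0) (ci_cm Wi')).
  rewrite (_ : _ @^-1` _ = H); last by apply/seteqP; split => y; rewrite /= ltrDr.
  by apply: cI_ext => x Hx /=; rewrite mem_set//; apply: Qs; rewrite (lt_trans ms0)// ltrDr.
rewrite (red (fun p => k0 p * (rdiag_deriv u p)%:C))//; last by move=> s /z[_ ->]; rewrite mulr0.
rewrite (red (fun p => F p * (u p)%:C))//; last by move=> s /z[-> _]; rewrite mulr0.
pose w x := u (s0 + x, a + s0 + x); pose w' x := rdiag_deriv u (s0 + x, a + s0 + x).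
pose G x := F (s0 + x, x + (a + s0)).
have wd x : is_derive x (1 : R) w (w' x) by exact: (is_derive_diag (s0, a + s0) x du).
have E1 x : a + (x + s0) = a + s0 + x by ring.
have w'i : leb.-integrable (setT : set RR) (EFin \o w').
  apply: (@bc_int R (a0 - s0) (b - s0) M w' setT) => //; split => //.
  - apply: continuous_measurable_fun => x.
    apply: (@continuous_comp _ _ _ (fun x : R => (s0 + x, a + s0 + x)) (rdiag_deriv u)); last exact: test_rd_continuous.
    exact: (cvg_pair (cvgD (cvg_cst _) cvg_id) (cvgD (cvg_cst _) cvg_id)).
  - by move=> x; exact: duM.
  - by move=> x /(fun h => us _ (or_intror h))[/= h _]; rewrite lerBlDl lerBrDl.
have w0 : w 0 = 0 by rewrite /w !addr0; exact: (z s0 (lexx _)).1.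
have Gi : cintegrable leb H G by exact: hs0.
have := tail_by_parts Gi wd w'i w0.
have -> : cintegral leb H (fun x => G x * (w x)%:C) =
    cintegral leb H (fun x => F (x + s0, a + (x + s0)) * (u (x + s0, a + (x + s0)))%:C).
  by apply: cI_ext => x _; rewrite /G /w E1 [s0 + x]addrC [x + (a + s0)]addrC.
move=> <-; apply: cI_ext => x _; rewrite mulrC /w' E1 [s0 + x]addrC; congr (_ * _).
rewrite /k0 /=; apply: cI_ext => y _; rewrite /G; congr F; congr pair; ring.
Qed.

(** Extension by zero to the plane allows Fubini in diagonal coordinates; the integrability required
    by [hankel_diagonal] then holds on almost every diagonal. *)
Lemma hankel_by_parts u : test_function u ->
  cintegral leb2 Q (fun p => k0 p * (rdiag_deriv u p)%:C) = cintegral leb2 Q (fun p => F p * (u p)%:C).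
Proof.
move=> tu; have c1 := ci_rC k02 (test_rd_L2 tu); have c2 := loc_test_ci tu.
have ext (W : R * R -> R[i]) : cintegrable leb2 Q W ->
    cintegrable leb2 (setT : set (RR * RR)) (fun p => if p \in Q then W p else 0) /\
    cintegral leb2 Q W = cintegral leb2 (setT : set (RR * RR)) (fun p => if p \in Q then W p else 0).
  move=> Wi; have z (p : RR * RR) : setT p -> ~ Q p -> (if p \in Q then W p else 0) = 0.
    by move=> _ nQ; rewrite memNset.
  have E (p : RR * RR) : Q p -> W p = if p \in Q then W p else 0 by move=> Qp; rewrite mem_set.
  have Wi' := ci_ext mQ E Wi.
  split; first exact: (@ci_zero_ext _ (RR * RR)%type R leb2 setT Q _ measurableT mQ (fun _ _ => I) z Wi').
  by rewrite (cI_ext leb2 E) (@cI_zero_ext _ (RR * RR)%type R leb2 setT Q _ (fun _ _ => I) z).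
have [e1 ->] := ext _ c1; have [e2 ->] := ext _ c2.
have [d1 d1' ->] := diag_fubiniC e1; have [d2 d2' ->] := diag_fubiniC e2.
apply: (cI_ae measurableT (ci_cm d1') (ci_cm d2')).
have hae : {ae leb2, forall p : RR * RR, Q (diag p) ->
   cintegrable leb H (fun z => F ((diag p).1 + z, z + (diag p).2))} by exact: (mpres_ae (mpres_diag R) Fae).
have hae' : {ae leb, forall a, {ae leb, forall s, Q (s, a + s) -> cintegrable leb H (fun z => F (s + z, z + (a + s)))}}.
  have := @ae_prod _ _ RR RR R leb leb setT setT
    (fun p => Q (diag p) -> cintegrable leb H (fun z => F ((diag p).1 + z, z + (diag p).2))).
  move=> /(_ (aeS (fun p h _ => h) hae)); apply: aeS => a /(_ I); apply: aeS => s; exact.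
have imp a : cintegrable leb (setT : set RR) (fun s => if (s, a + s) \in Q then F (s, a + s) * (u (s, a + s))%:C else 0) ->
    {ae leb, forall s, Q (s, a + s) -> cintegrable leb H (fun z => F (s + z, z + (a + s)))} ->
    cintegrable leb (setT : set RR) (fun s => if (s, a + s) \in Q then k0 (s, a + s) * (rdiag_deriv u (s, a + s))%:C else 0) ->
    cintegral leb (setT : set RR) (fun s => if (s, a + s) \in Q then k0 (s, a + s) * (rdiag_deriv u (s, a + s))%:C else 0) =
    cintegral leb (setT : set RR) (fun s => if (s, a + s) \in Q then F (s, a + s) * (u (s, a + s))%:C else 0).
  by move=> h2 h3 h1; exact: hankel_diagonal.
have h23 := @aeS2 _ RR R leb _ _ _ imp d2 hae'.
by apply: (@aeS2 _ RR R leb _ _ _ _ h23 d1) => a h h1 _; exact: h h1.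
Qed.

End Hankel.

(** * Finite rank from the values on a dense subspace *)

Section FiniteRank.
Variable R : realType.
Notation leb := (@lebesgue_measure R).
Notation RR := (measurableTypeR R).
Notation H := (@halfline R).
Notation n1 := (nq leb H).
Notation i1 := (ip leb H).
Notation mH := (@m_half R).
Implicit Types (g : R -> R[i]).

Variables (n : nat) (a : 'I_n -> R -> R[i]).
Implicit Types (e : nat -> R -> R[i]) (r : nat) (h : R -> R[i]).

Definition in_span h := exists c : 'I_n -> R[i], L2eq h (fun x => \sum_(j < n) c j * a j x).

Lemma in_span_lin (z : R[i]) h g : in_span h -> in_span g -> in_span (fun x => z * h x + g x).
Proof.
move=> [c hc] [d hd]; exists (fun j => z * c j + d j).
apply: (aeS2 _ hc hd) => x h1 h2 Hx; rewrite h1// h2// mulr_sumr -big_split /=.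
by apply: eq_bigr => j _; rewrite mulrDl mulrA.
Qed.

Lemma in_span0 : in_span (fun=> 0).
Proof. by exists (fun=> 0); apply: aeW => x _; rewrite big1// => j _; rewrite mul0r. Qed.

Lemma in_span_ext h g : (forall x, h x = g x) -> in_span h -> in_span g.
Proof. by move=> hg; rewrite (_ : h = g)//; exact/funext. Qed.

Lemma in_span_sum e (d : nat -> R[i]) r : (forall i, in_span (e i)) ->
  in_span (fun x => \sum_(i < r) d i * e i x).
Proof.
move=> es; elim: r => [|r IH]; first by apply: in_span_ext in_span0 => x; rewrite big_ord0.
apply: in_span_ext (in_span_lin (d r) (es r) IH) => x.
by rewrite big_ord_recr /= addrC.
Qed.

(** The family is indexed by all integers with orthonormality asked of the first [r] members, so
    that it can be extended without changing its type. *)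
Definition orthonormal_in_span e r := [/\ forall i, L2 (e i), forall i, in_span (e i) &
  forall i j, (i < r)%N -> (j < r)%N -> i1 (e i) (e j) = (i == j)%:R].

Lemma ip_comb e r (d : nat -> R[i]) m : orthonormal_in_span e r -> (m < r)%N ->
  i1 (fun x => \sum_(i < r) d i * e i x) (e m) = d m.
Proof.
move=> [e2 _ eo] mr.
rewrite (@ip_suml _ RR R leb H mH r (fun i x => d i * e i x)) => [|i|]; [|exact: (L2Z mH _ (e2 i))|exact: e2].
rewrite (bigD1 (Ordinal mr))//= (ipZl mH _ (e2 m) (e2 m)) eo// eqxx mulr1 big1 ?addr0// => i im.
by rewrite (ipZl mH _ (e2 i) (e2 m)) eo// (negbTE (_ : (i : nat) != m)) ?mulr0.
Qed.

(** If [r > n], the coefficient matrix has a nonzero vector in its left kernel. The corresponding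
    combination vanishes almost everywhere, although its coefficients are recovered as inner
    products. *)
Lemma orthonormal_size e r : orthonormal_in_span e r -> (r <= n)%N.
Proof.
move=> eP; have [e2 es eo] := eP; rewrite leqNgt; apply/negP => nr.
have [c hc] := choice es.
pose C : 'M[R[i]]_(r, n) := \matrix_(i, j) c i j.
have : kermx C != 0.
  rewrite kermx_eq0 /row_free neq_ltn (leq_ltn_trans (rank_leq_col C) nr)//.
move=> /rowV0Pn[d /sub_kermxP dC d0].
pose D (j : nat) : R[i] := if (insub j : option 'I_r) is Some i then d 0 i else 0.
have DE (i : 'I_r) : D i = d 0 i by rewrite /D valK.
have h2 : L2 (fun x => \sum_(i < r) D i * e i x).
  by apply: (@L2_sum _ RR R leb H mH r (fun i x => D i * e i x)) => i; exact: (L2Z mH _ (e2 i)).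
have h0 : L2eq (fun x => \sum_(i < r) D i * e i x) (fun=> 0).
  have hall : {ae leb, forall x, forall i, H x -> e i x = \sum_(j < n) c i j * a j x} by exact: ae_foralln.
  apply: (aeS _ hall) => x hx Hx.
  under eq_bigr => i _ do rewrite hx// mulr_sumr.
  rewrite exchange_big /= big1// => j _.
  under eq_bigr => i _ do rewrite mulrA.
  rewrite -mulr_suml.
  have := congr1 (fun M : 'rV[R[i]]_n => M 0 j) dC; rewrite !mxE => E.
  rewrite (_ : \sum_(i < r) _ = 0) ?mul0r// -[RHS]E; apply: eq_bigr => i _.
  by rewrite mxE DE.
move/eqP: d0; apply; apply/rowP => i; rewrite mxE -DE -(ip_comb D eP (ltn_ord i)).
rewrite (ip_ael mH h2 (e2 i) (L2z R) h0) ipE -[RHS](cI0 leb H).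
by apply: cI_ext => x _; rewrite mul0r.
Qed.

Definition resid e r h x := h x - \sum_(i < r) i1 h (e i) * e i x.

Lemma resid_L2 e r h : orthonormal_in_span e r -> L2 h -> L2 (resid e r h).
Proof.
move=> [e2 _ _] h2; apply: (L2B mH h2).
by apply: (@L2_sum _ RR R leb H mH r (fun i x => i1 h (e i) * e i x)) => i; exact: (L2Z mH _ (e2 i)).
Qed.

Lemma L2_comb e r (d : nat -> R[i]) : orthonormal_in_span e r -> L2 (fun x => \sum_(i < r) d i * e i x).
Proof.
move=> [e2 _ _].
by apply: (@L2_sum _ RR R leb H mH r (fun i x => d i * e i x)) => i; exact: (L2Z mH _ (e2 i)).
Qed.

Lemma resid_perp e r h m : orthonormal_in_span e r -> L2 h -> (m < r)%N -> i1 (resid e r h) (e m) = 0.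
Proof.
move=> eP h2 mr; have [e2 _ _] := eP.
have -> : resid e r h = fun x => h x - (fun x => \sum_(i < r) i1 h (e i) * e i x) x by [].
rewrite (ipBl mH h2 (L2_comb (fun i => i1 h (e i)) eP) (e2 m)).
by rewrite (ip_comb (fun i => i1 h (e i)) eP mr) subrr.
Qed.

(** Orthogonal projection is the best approximation: any other combination differs from it by a
    vector orthogonal to the residual. *)
Lemma resid_best e r h (d : nat -> R[i]) : orthonormal_in_span e r -> L2 h ->
  n1 (resid e r h) <= n1 (fun x => h x - \sum_(i < r) d i * e i x).
Proof.
move=> eP h2; have [e2 _ _] := eP; have r2 := resid_L2 eP h2.
pose c i := i1 h (e i) - d i; have c2 := L2_comb c eP.
have -> : n1 (fun x => h x - \sum_(i < r) d i * e i x) =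
    n1 (fun x => resid e r h x + \sum_(i < r) c i * e i x).
  apply: n1_ext => x _; rewrite /resid.
  have -> : \sum_(i < r) c i * e i x = \sum_(i < r) i1 h (e i) * e i x - \sum_(i < r) d i * e i x.
    by rewrite -sumrB; apply: eq_bigr => i _; rewrite mulrBl.
  by rewrite addrA subrK.
rewrite (nqD mH r2 c2) (_ : ReC _ = 0) ?mulr0 ?addr0 ?lerDl ?nq_ge0//.
rewrite (ipJ mH c2 r2) (@ip_suml _ RR R leb H mH r (fun i x => c i * e i x) _ _ r2); last first.
  by move=> i; exact: (L2Z mH _ (e2 i)).
rewrite big1 ?ReJ// => i _; rewrite (ipZl mH _ (e2 i) r2) (ipJ mH r2 (e2 i)).
by rewrite (resid_perp eP h2 (ltn_ord i)) conjc0 mulr0.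
Qed.

(* Orthonormal families in the span have at most [n] members; for one of maximal
   length, the normalized residual of an element of the span would extend it. *)
Lemma max_orthonormal : exists r e, orthonormal_in_span e r /\
  forall h, L2 h -> in_span h -> n1 (resid e r h) = 0.
Proof.
pose P r := `[< exists e, orthonormal_in_span e r >].
have P0 : exists r, P r.
  exists 0%N; apply/asboolP; exists (fun _ _ => 0); split=> // i; first exact: L2z.
  exact: in_span0.
have Pn r : P r -> (r <= n)%N by move=> /asboolP[e]; exact: orthonormal_size.
have [r /asboolP[e eP] rmax] := ex_maxnP P0 Pn.
exists r, e; split => // h h2 hs; apply/eqP; apply: contraT => rn0.
have [e2 es eo] := eP; have r2 := resid_L2 eP h2.
have rs : in_span (resid e r h).
  apply: in_span_ext (in_span_lin (-1) (in_span_sum (fun i => i1 h (e i)) r es) hs) => x.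
  by rewrite mulN1r addrC.
pose z : R[i] := ((Num.sqrt (n1 (resid e r h)))^-1)%:C.
pose e' i := if (i < r)%N then e i else (fun x => z * resid e r h x).
suff : P r.+1 by move=> /rmax; rewrite ltnn.
apply/asboolP; exists e'; split.
- by move=> i; rewrite /e'; case: ifP => _; [exact: e2|exact: (L2Z mH z r2)].
- move=> i; rewrite /e'; case: ifP => _; first exact: es.
  by apply: in_span_ext (in_span_lin z rs in_span0) => x; rewrite addr0.
- move=> i j; rewrite !ltnS /e'; case: (ltnP i r) => [ir _|ri ir]; case: (ltnP j r) => [jr _|rj jr].
  + exact: eo.
  + have -> : j = r by apply/eqP; rewrite eqn_leq jr.
    by rewrite (ipZr mH _ r2 (e2 i)) (ipJ mH r2 (e2 i)) (resid_perp eP h2 ir) conjc0 mulr0 ltn_eqF.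
  + have -> : i = r by apply/eqP; rewrite eqn_leq ir.
    by rewrite (ipZl mH _ r2 (e2 j)) (resid_perp eP h2 jr) mulr0 gtn_eqF.
  + have -> : i = j by apply/eqP; rewrite eqn_leq (leq_trans ir rj) (leq_trans jr ri).
    rewrite eqxx (ipZl mH _ r2 (L2Z mH z r2)) (ipZr mH _ r2 r2) ip_nq conjc_real -!rmorphM /=.
    have p0 : 0 < n1 (resid e r h) by rewrite lt_def rn0 nq_ge0.
    by rewrite mulrA -invfM -expr2 sqr_sqrtr ?nq_ge0// mulVf.
Qed.

(** For a C^1 approximant [w] of [f], the image [G w] is a combination of the maximal family, so the
    squared residual of [G f] is at most [|G (f - w)|^2], which is arbitrarily small. *)
Lemma dense_span_finite_rank (G : op R) : bounded_op G ->
  (forall u v, C1c u -> C1c v -> L2 (fun x => u x +i* v x) -> in_span (G (fun x => u x +i* v x))) ->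
  finite_rank_op G.
Proof.
move=> bG Gs; split => //; have [r [e [eP eM]]] := max_orthonormal.
have [e2 _ _] := eP; exists r, (fun i => e i); split => // f f2.
have [G2 Gl _] := bG; have [M M0 hM] := bounded_nq bG; have Gf2 := G2 _ f2.
exists (fun i => i1 (G f) (e i)).
apply/(L2eq_nq Gf2 (L2_comb (fun i => i1 (G f) (e i)) eP)).
apply/eqP; rewrite eq_le nq_ge0 andbT; apply/ler_addgt0Pr => d d0; rewrite add0r.
have M1 : 0 < M + 1 by rewrite ltr_wpDl.
have [u [v [cu cv w2 hw]]] := C1c_dense f2 (divr_gt0 d0 M1).
pose w x := u x +i* v x; have Gw2 := G2 _ w2.
have rw0 := eM _ Gw2 (Gs _ _ cu cv w2).
have := resid_best (fun i => i1 (G w) (e i)) eP Gf2.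
rewrite /resid => /le_trans; apply.
have Ew : L2eq (G w) (fun x => \sum_(i < r) i1 (G w) (e i) * e i x).
  exact: (L2eq_nq Gw2 (L2_comb (fun i => i1 (G w) (e i)) eP)).2 rw0.
have fw2 := L2B mH f2 w2.
rewrite (L2eq_n1 (g := G (fun x => f x - w x)) _ (G2 _ fw2)); last first.
- have q2 : L2 (fun x => -1 * w x + f x) by exact: L2_lin.
  have E : L2eq (fun x => f x - w x) (fun x => -1 * w x + f x) by apply: aeW => x _; rewrite mulN1r addrC.
  have h1 := L2eq_trans (bounded_ae bG fw2 q2 E) (Gl (-1) _ _ w2 f2).
  by apply: (aeS2 _ h1 Ew) => x h2 h3 Hx; rewrite h2// -h3// mulN1r addrC.
- exact: (L2B mH Gf2 (L2_comb (fun i => i1 (G w) (e i)) eP)).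
apply: le_trans (hM _ fw2) _; apply: (@le_trans _ _ ((M + 1) * (d / (M + 1)))).
  by apply: ler_pM => //; [exact: nq_ge0|rewrite lerDl].
by rewrite mulrC divfK// gt_eqF.
Qed.

End FiniteRank.

Section OrdinalSums.
Context d (T : measurableType d) (R : realType) (mu : {measure set T -> \bar R}).
Variables (D : set T) (mD : measurable D).

Lemma cm_sum_ord n (F : 'I_n -> T -> R[i]) : (forall j, cmeasurable D (F j)) ->
  cmeasurable D (fun x => \sum_(j < n) F j x).
Proof.
elim: n F => [|n IH] F mF.
  by apply: (cm_ext _ (cm_cst D 0)) => x _; rewrite big_ord0.
have := cmD (IH (fun j => F (widen_ord (leqnSn n) j)) (fun j => mF _)) (mF ord_max).
by apply: cm_ext => x _; rewrite big_ord_recr.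
Qed.

Lemma cI_sum_ord n (F : 'I_n -> T -> R[i]) : (forall j, cintegrable mu D (F j)) ->
  cintegrable mu D (fun x => \sum_(j < n) F j x) /\
  cintegral mu D (fun x => \sum_(j < n) F j x) = \sum_(j < n) cintegral mu D (F j).
Proof.
elim: n F => [|n IH] F Fi.
  split; first by apply: (ci_ext mD _ (ci0 mu D)) => x _; rewrite big_ord0.
  by rewrite big_ord0 -[RHS](cI0 mu D); apply: cI_ext => x _; rewrite big_ord0.
have [i e] := IH (fun j => F (widen_ord (leqnSn n) j)) (fun j => Fi _).
split; first by apply: (ci_ext mD _ (ciD mD i (Fi ord_max))) => x _; rewrite big_ord_recr.
rewrite big_ord_recr /= -e -(cID mD i (Fi ord_max)).
by apply: cI_ext => x _; rewrite big_ord_recr.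
Qed.

End OrdinalSums.

(** * The weak derivative of the kernel of a Hankel product *)

Section HankelProduct.
Variable R : realType.
Notation leb := (@lebesgue_measure R).
Notation leb2 := (@leb2 R).
Notation RR := (measurableTypeR R).
Notation H := (@halfline R).
Notation Q := (@quadrant R).
Notation mH := (@m_half R).
Notation mQ := (@m_quad R).
Implicit Types (f g : R -> R[i]) (k : R * R -> R[i]).

Implicit Types (u : R * R -> R) (a b t : R).

Lemma diag_shift_ci (W : R * R -> R[i]) t : 0 <= t -> cintegrable leb2 Q W ->
  (forall p, Q p -> ~ Qt t p -> W p = 0) ->
  cintegrable leb2 Q (shift_kernel t W) /\ cintegral leb2 Q (shift_kernel t W) = cintegral leb2 Q W.
Proof.
move=> t0 Wi W0; have Wt := ci_sub mQ (m_Qt t) (Qt_sub t0) Wi.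
have := mpres_ci (@mpres_translate2 R t t) (m_Qt t) Wt.
have := mpres_cI (@mpres_translate2 R t t) (m_Qt t) (ci_cm Wt).
rewrite pre_Qt => e i; split; first exact: i.
rewrite -(@cI_zero_ext _ (RR * RR)%type R leb2 Q (Qt t) W (Qt_sub t0) W0).
exact: e.
Qed.

(** The translation is moved to the test function: integration by parts for the unshifted kernel is
    applied to [dtr (- t) u], which vanishes off [Qt t], and both sides are then translated back. *)
Lemma hankel_weak_shift (F k : R * R -> R[i]) t :
  (forall a b, 0 < a -> cintegrable leb2 (box a b : set (RR * RR)) F) ->
  {ae leb2, forall p, Q p -> cintegrable leb H (fun z => F (p.1 + z, z + p.2))} ->
  @cmeasurable _ (RR * RR)%type R Q F -> isL2 leb2 Q k ->
  aeeq leb2 Q k (fun p => cintegral leb H (fun z => F (p.1 + z, z + p.2))) ->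
  isL2 leb2 Q (fun p => cintegral leb H (fun z => F (p.1 + z, z + p.2))) ->
  0 < t -> weak_diag_deriv (shift_kernel t k) (fun p => - F (p.1 + t, p.2 + t)).
Proof.
move=> Floc Fae Fm k2 kk0 k02 /ltW t0; have sk2 := L2_shift_kernel t0 k2.
split; first exact: (L2_cm sk2).
  have := mpres_cm (@mpres_translate2 R t t) (m_Qt t) (cm_sub mQ (m_Qt t) (Qt_sub t0) Fm).
  by rewrite pre_Qt => h; exact: (cmN h).
move=> u tu; have tn : - t <= 0 by rewrite oppr_le0.
have tut := test_dtr tn tu; have [a0 [b [M [a00 _ _ _ us]]]] := test_bound tu.
have z p : ~ Qt t p -> dtr (- t) u p = 0 /\ rdiag_deriv (dtr (- t) u) p = 0.
  move=> nQ; have nn : ~ (a0 <= p.1 - t /\ a0 <= p.2 - t).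
    by move=> [h1 h2]; apply: nQ; split => /=; lra.
  rewrite rdiag_dtr /dtr; split; apply/eqP; apply: contraT => h; exfalso; apply: nn.
    by have [/= /andP[h1 _] /andP[h2 _]] := us _ (or_introl h).
  by have [/= /andP[h1 _] /andP[h2 _]] := us _ (or_intror h).
have zF p : Q p -> ~ Qt t p -> F p * (dtr (- t) u p)%:C = 0 by move=> _ /z[-> _]; rewrite mulr0.
have zk p : Q p -> ~ Qt t p -> k p * rC (rdiag_deriv (dtr (- t) u)) p = 0.
  by move=> _ /z[_ h]; rewrite /rC h mulr0.
have Fu := loc_test_ci Floc tut.
have [f1 f2] := diag_shift_ci t0 Fu zF.
have ku := ci_rC k2 (test_rd_L2 tut).
have [_ g2] := diag_shift_ci t0 ku zk.
have E1 : shift_kernel t (fun p => F p * (dtr (- t) u p)%:C) = fun p => F (p.1 + t, p.2 + t) * (u p)%:C.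
  by apply/funext => -[x y]; rewrite /shift_kernel /dtr /= !addrK.
have E2 : shift_kernel t (fun p => k p * rC (rdiag_deriv (dtr (- t) u)) p) =
    fun p => shift_kernel t k p * (rdiag_deriv u p)%:C.
  by apply/funext => -[x y]; rewrite /shift_kernel /rC rdiag_dtr /= !addrK.
rewrite E1 in f1 f2; rewrite E2 in g2.
have N : (fun p => - F (p.1 + t, p.2 + t) * (u p)%:C) = (fun p => - (F (p.1 + t, p.2 + t) * (u p)%:C)).
  by apply/funext => p; rewrite mulNr.
split.
- exact: (ci_rC sk2 (test_rd_L2 tu)).
- by rewrite N; exact: (ciN mQ f1).
- rewrite N (cIN mQ f1) opprK f2 g2 -(hankel_by_parts Floc Fae k02 tut).
  apply: (cI_ae mQ (ci_cm ku) (ci_cm (ci_rC k02 (test_rd_L2 tut)))).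
  by apply: (aeS _ kk0) => p h Qp; rewrite h.
Qed.

(** Applied to the indicator of []0, b]], the integral defining the operator converges at some [x]
    in []0, a[]; this is the integrability of [phi] on []x, x + b]], which contains []a, b]]. *)
Lemma hankel_local (phi : R -> R[i]) (A : op R) a b : measurable1 phi -> hankel_op phi A ->
  0 < a -> cintegrable leb (`]a, b]%classic : set RR) phi.
Proof.
move=> mphi [_ [_ hA]] a0.
pose f x : R[i] := (\1_(`]0, b] : set RR) x : R)%:C.
have mI (x y : R) : measurable (`]x, y]%classic : set RR) by exact: measurable_itv.
have f2 : L2 f.
  apply: (@bc_L2 R 0 b 1 (fun x => \1_(`]0, b] : set RR) x : R)); split.
  - exact: measurable_indic.
  - by move=> x; rewrite indicE; case: (x \in _); rewrite ?normr1 ?normr0.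
  - move=> x; rewrite indicE; case: (boolP (x \in _)) => [/set_mem/=|_]; last by rewrite eqxx.
    by rewrite in_itv/= => /andP[/ltW -> ->].
have [x /andP[x0 xa] /(_ x0)[hx _]] := ae_itv a0 (hA f f2).
have sub : `]a, b]%classic `<=` [set y | x < y].
  by move=> y /=; rewrite in_itv/= => /andP[ay _]; exact: lt_trans xa ay.
have := mpres_ci (@mpres_translate R (- x)) mH hx.
rewrite (_ : _ @^-1` _ = [set y | x < y]); last by apply/seteqP; split => y; rewrite /halfline /= subr_gt0.
move=> /(ci_sub (m_gt x) (mI a b) sub); apply: (ci_ext (mI a b)) => y /=.
rewrite in_itv/= => /andP[ay yb]; rewrite /= addrC subrK /f indicE mem_set ?mulr1//=.
by rewrite in_itv/= subr_gt0 (lt_trans xa ay)/= lerBlDr (le_trans yb)// lerDl ltW.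
Qed.

Lemma measurable1_back (f : R -> R[i]) t : 0 <= t -> measurable1 f -> measurable1 (fun x => f (x + t)).
Proof.
move=> t0 mf; have := mpres_cm (@mpres_translate R t) (m_gt t) (cm_sub mH (m_gt t) (gt_sub t0) mf).
by rewrite pre_back.
Qed.

Lemma C1c_bounded (v : R -> R) : C1c v -> exists b M, [/\ forall x, `|v x| <= M,
  forall x, v x != 0 -> 0 < x <= b & measurable_fun (setT : set RR) v].
Proof.
move=> [dv _ [a [b [a0 hs]]]].
have cv : continuous v by move=> x; apply/differentiable_continuous/derivable1_diffP.
have : bounded_set (v @` `[a, b]).
  apply: compact_bounded; apply: continuous_compact; last exact: segment_compact.
  exact: continuous_subspaceT.
move=> /ex_strict_bound_gt0[M M0 hM]; exists b, M; split.
- move=> x; have [->|/hs xab] := eqVneq (v x) 0; first by rewrite normr0 ltW.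
  by apply/ltW/hM; exists x.
- by move=> x /hs/andP[ax ->]; rewrite (lt_le_trans a0 ax).
- exact: continuous_measurable_fun.
Qed.

Lemma local_C1c_ci (f : R -> R[i]) (u v : R -> R) : (forall b, cintegrable leb (`]0, b]%classic : set RR) f) ->
  C1c u -> C1c v -> cintegrable leb H (fun y => f y * (u y +i* v y)).
Proof.
move=> fl cu cv.
have [b1 [M1 [u1 u2 mu]]] := C1c_bounded cu; have [b2 [M2 [v1 v2 mv]]] := C1c_bounded cv.
pose b := Num.max b1 b2; have mI : measurable (`]0, b]%classic : set RR) by exact: measurable_itv.
apply: (@ci_zero_ext _ RR R leb H `]0, b]%classic _ mH mI).
- by move=> y /=; rewrite in_itv/= => /andP[].
- move=> y Hy ny; have nb : ~ y <= b by move=> yb; apply: ny; rewrite /= in_itv/= Hy.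
  have -> : u y = 0.
    by apply/eqP; apply: contraT => /u2/andP[_ h]; exfalso; apply: nb; rewrite le_max h.
  have -> : v y = 0.
    by apply/eqP; apply: contraT => /v2/andP[_ h]; exfalso; apply: nb; rewrite le_max h orbT.
  by rewrite mulr0.
- apply: (ci_le mI (g := fun y => (M1 + M2) * Normc.normc (f y))).
  + apply: (cmM (ci_cm (fl b))); split; exact: measurable_funTS.
  + move=> y _; rewrite Normc.normcM mulrC ler_wpM2r ?normc_ge0//.
    by apply: le_trans (normc_le_ReIm _) _ => /=; exact: lerD.
  + exact: (intZ mI _ (ci_normc mI (fl b))).
Qed.

Lemma hankel_product_weak (e : nat -> R -> R[i]) (K : op R) k t : is_onb e -> hankel_product K ->
  L2kernel K k -> 0 < t -> exists g : R * R -> R[i],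
    [/\ weak_diag_deriv (shift_kernel t k) g, finite_rank_kernel g &
      forall G : op R, bounded_op G -> integral_op g G -> finite_rank_op G].
Proof.
move=> eb [n [phi [psi [A [B [hA hB _ hae hK]]]]]] Kk t0; have t0' := ltW t0.
have [k2 _] := (L2kernelP _ _).1 Kk; have [k02 _] := (L2kernelP _ _).1 hK.
pose al j x := phi x j 0; pose be j x := psi x j 0.
have ma j : measurable1 (al j) by case: (hA j).
have mb j : measurable1 (be j) by case: (hB j).
have la j a b : 0 < a -> cintegrable leb (`]a, b]%classic : set RR) (al j).
  by move=> a0; have [_ h] := hA j; exact: hankel_local (ma j) h a0.
have lb j a b : 0 < a -> cintegrable leb (`]a, b]%classic : set RR) (be j).
  by move=> a0; have [_ h] := hB j; exact: hankel_local (mb j) h a0.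
pose F p := ((phi p.1)^T *m psi p.2) 0 0.
have FE p : F p = \sum_(j < n) al j p.1 * be j p.2.
  by rewrite /F mxE; apply: eq_bigr => j _; rewrite mxE.
have mI (x y : R) : measurable (`]x, y]%classic : set RR) by exact: measurable_itv.
have Floc a b : 0 < a -> cintegrable leb2 (box a b : set (RR * RR)) F.
  move=> a0; have mB : measurable (box a b : set (RR * RR)) by exact: measurableX.
  apply: (ci_ext mB (f := fun p => \sum_(j < n) al j p.1 * be j p.2)) => [p _|]; first by rewrite FE.
  have tj j := ci_tensor (mI a b) (mI a b) (la j a b a0) (lb j a b a0).
  exact: (cI_sum_ord mB tj).1.
have Fm : @cmeasurable _ (RR * RR)%type R Q F.
  apply: (cm_ext (f := fun p => \sum_(j < n) al j p.1 * be j p.2)) => [p _|]; first by rewrite FE.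
  apply: cm_sum_ord => j; apply: cmM.
    by rewrite quadrantE; split; [exact: (meas_fst mH (ma j).1)|exact: (meas_fst mH (ma j).2)].
  by rewrite quadrantE; split; [exact: (meas_snd mH (mb j).1)|exact: (meas_snd mH (mb j).2)].
have kk0 := kernel_unique eb Kk hK.
exists (fun p => - F (p.1 + t, p.2 + t)); split.
- exact: (hankel_weak_shift Floc hae Fm k2 kk0 k02 t0).
- exists n, (fun j x => - al j (x + t)), (fun j y => be j (y + t)); split.
    move=> j; split; last exact: measurable1_back.
    have h := measurable1_back t0' (ma j); exact: (cmN h).
  by apply: aeW => p _; rewrite FE -sumrN; apply: eq_bigr => j _; rewrite mulNr.
- move=> G bG [_ hG].
  apply: (@dense_span_finite_rank R n (fun j x => al j (x + t)) G bG) => u v cu cv w2.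
  exists (fun j => - cintegral leb H (fun y => be j (y + t) * (u y +i* v y))).
  (* Since [t > 0], the interval []0, b]] is carried to []t, b + t]], away from 0, where [be j] is
     integrable. *)
  have ci j : cintegrable leb H (fun y => be j (y + t) * (u y +i* v y)).
    apply: local_C1c_ci => // b.
    have := mpres_ci (@mpres_translate R t) (mI t (b + t)) (lb j t (b + t) t0).
    rewrite (_ : _ @^-1` _ = `]0, b]%classic)//.
    by apply/seteqP; split => y; rewrite /= !in_itv/= ltrDr lerD2r.
  apply: (aeS _ (hG _ w2)) => x h Hx; have [_ ->] := h Hx.
  pose N j y := - al j (x + t) * (be j (y + t) * (u y +i* v y)).
  have Ni j : cintegrable leb H (N j) by exact: (ciZ mH).
  rewrite (_ : cintegral leb H _ = cintegral leb H (fun y => \sum_(j < n) N j y)); last first.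
    apply: cI_ext => y _; rewrite FE mulNr mulr_suml -sumrN; apply: eq_bigr => j _.
    by rewrite /N mulNr mulrA.
  rewrite (cI_sum_ord mH Ni).2; apply: eq_bigr => j _.
  by rewrite /N (cIZ mH)// mulNr mulrC mulNr.
Qed.

End HankelProduct.

Theorem proposition2p8 (R : realType) (K L : op R) (hK : HS K) (hL : HS L) :
  (* (i) *)
  C0_contraction_semigroup (@sigma R) /\
  (* (ii) *)
  (HSnorm (sigma t K) @[t --> +oo] --> (0 : R) /\
   forall f : R -> R[i], L2 f ->
     L2norm (sigma t K f) @[t --> +oo] --> (0 : R)) /\
  (* (iii) *)
  ((forall A B : op R, generator (@sigma R) A B <-> diag_deriv_op A B) /\
   (forall (A B : op R) (k : R * R -> R[i]),
      HS A -> HS B -> L2kernel A k -> differentiable_kernel k ->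
      L2kernel B (diag_deriv k) -> generator (@sigma R) A B)) /\
  (* (iv) *)
  C0_contraction_semigroup (@sigma_tilde R) /\
  (* (v) *)
  (forall t : R, 0 < t ->
     opeq (sigma_tilde t (op_comp K L))
          (op_comp (sigma_tilde t K) (sigma_tilde t L)) /\
     HSinner (sigma_tilde t K) L = HSinner K (sigma t L)) /\
  (* (vi) *)
  (hankel_product K ->
   forall (k : R * R -> R[i]) (t : R), L2kernel K k -> 0 < t ->
     exists g : R * R -> R[i],
       [/\ weak_diag_deriv (shift_kernel t k) g,
           finite_rank_kernel g
         & forall G : op R, bounded_op G -> integral_op g G ->
             finite_rank_op G]).
Proof.
have [_ [e eb _]] := hK.
split; first exact: (sigma_semigroup eb).
split; first exact: (sigma_vanish eb hK).
split.
  split=> [A B|A B k hA hB Ak dk Bk]; first exact: (generator_diag_deriv A B eb).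
  exact: (generator_differentiable eb hA hB Ak dk Bk).
split; first exact: (sigma_tilde_semigroup eb).
split=> [t t0|hp k t Kk t0]; first exact: (sigma_tilde_mul eb t0 hK hL).
exact: (hankel_product_weak eb hp Kk t0).
Qed.
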